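(* Let $\mathbf{k}$ be a field of characteristic $0$, let $r\ge 0$ and let $P$ be an $r$-tame operad in chain complexes of $\mathbf{k}$-vector spaces (with homological degree). Then every $r$-connected $P$-algebra $A$ has a Sullivan $r$-minimal model $f:\mathcal{M}\to A$ with $\mathcal{M}_0=P(0)$ and $\mathcal{M}_i=0$ for all $i<r$ with $i\neq 0$. Furthermore, if $A$ is $(r+1)$-connected and $H_*(A)$ is of finite type, then $\mathcal{M}$ is of finite type.
   Context: Operads are unital symmetric operads in chain complexes of $\mathbf{k}$-vector spaces (homological grading, differential of degree $-1$). Every operad $P$ considered is assumed connected ($P(1)=\mathbf{k}$ in degree $0$) and either reduced ($P(0)=0$) or unitary ($P(0)=\mathbf{k}$ in degree $0$). $P$-algebras are algebras in chain complexes with strict morphisms; quasi-isomorphisms are the morphisms inducing isomorphisms in homology. $r$-tame: for all $n\ge 2$, $P(n)_q=0$ for all $q\le(1-n)(1+r)$ (where $q$ is the homological degree). $r$-connected: $A$ is $0$-connected if $H_i(A)=0$ for $i<0$ and the unit map $P(0)\to A$ induces an isomorphism $P(0)\cong H_0(A)$; it is $r$-connected if in addition $H_1(A)=\dots=H_r(A)=0$. KS-extensions: $P\langle V\rangle=\bigoplus_{m\ge 0}P(m)\otimes_{\Sigma_m}V^{\otimes m}$ is the free graded $P$-algebra on a graded vector space $V$; $P\langle 0\rangle=P(0)$. Let $A=P\langle V\rangle$ be a $P$-algebra free as a graded algebra. A KS-extension of $A$ of degree $n>0$ is $A\sqcup_d P\langle V'\rangle$, with underlying graded algebra $P\langle V\oplus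 V'\rangle$, where $V'$ is homogeneous of degree $n$ and $d:V'\to Z_{n-1}(A)$ is a linear map to cycles; its differential is the unique $P$-derivation (compatible with the differential of $P$) extending the differential of $A$ and $d$ on $V'$. Sullivan $r$-minimal: a Sullivan $r$-minimal $P$-algebra is the colimit $\mathcal{M}=\bigcup_{i\ge 0}\mathcal{M}[i]$ of a sequence of KS-extensions $\mathcal{M}[0]=P(0)\to\mathcal{M}[1]=P\langle V[1]\rangle\to\mathcal{M}[2]=\mathcal{M}[1]\sqcup_d P\langle V[2]\rangle\to\cdots$ with $r<\deg(V[n])\le\deg(V[n+1])$ for all $n\ge 1$. A Sullivan $r$-minimal model of $A$ is such an $\mathcal{M}$ together with a quasi-isomorphism of $P$-algebras $f:\mathcal{M}\to A$. Finite type means finite-dimensional in each degree.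
   Formalization: In the ''Furthermore'' clause the operad P is additionally assumed to be of finite type (each P(n)_q finite-dimensional); without this the claim that M is of finite type fails, e.g. for the free operad on infinitely many binary operations of degree 0. *)

(* Defs.v *)
From HB Require Import structures.
From mathcomp Require Import all_boot all_order all_algebra all_fingroup.

Set Implicit Arguments.
Unset Strict Implicit.
Unset Printing Implicit Defensive.

Import Order.TTheory GRing.Theory Num.Theory.
Local Open Scope ring_scope.

(** * Graded vector spaces and chain complexes *)

(* A Z-graded vector space V = (V_i) is represented by its total space
   \bigoplus_i V_i together with the projections on the components; V_i is then
   the subspace of the x with [gr_pr i x = x].  The dimensions are arbitrary. *)
Record grMod (k : fieldType) := GrMod {
  gr_sort :> lmodType k;
  gr_pr : int -> gr_sort -> gr_sort;
  gr_pr_linear : forall i, linear (gr_pr i);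
  gr_pr_pr : forall i j x,
    gr_pr i (gr_pr j x) = if i == j then gr_pr j x else 0;
  gr_pr_sum : forall x, exists2 s : seq int,
    uniq s & x = \sum_(i <- s) gr_pr i x }.

Definition homog (k : fieldType) (V : grMod k) (i : int) (x : V) : Prop :=
  gr_pr i x = x.

Definition grLinear (k : fieldType) (V W : grMod k) (f : V -> W) : Prop :=
  linear f /\ forall i x, homog i x -> homog i (f x).

Definition finite_type (k : fieldType) (V : grMod k) : Prop :=
  forall i, exists n, exists2 s : 'I_n -> V,
    forall j, homog i (s j) &
    forall x, homog i x -> exists c : 'I_n -> k, x = \sum_j c j *: s j.

Record chComplex (k : fieldType) := ChComplex {
  cc_gr :> grMod k;
  cc_d : cc_gr -> cc_gr;
  cc_d_linear : linear cc_d;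
  cc_d_deg : forall i x, homog i x -> homog (i - 1) (cc_d x);
  cc_dd : forall x, cc_d (cc_d x) = 0 }.

Definition cycle (k : fieldType) (C : chComplex k) (i : int) (z : C) : Prop :=
  homog i z /\ cc_d z = 0.

(* z and z' define the same class of H_i(C) *)
Definition homologous (k : fieldType) (C : chComplex k) (i : int)
    (z z' : C) : Prop :=
  exists2 b : C, homog (i + 1) b & z - z' = cc_d b.

(* H_i(C) = 0 *)
Definition acyclic_at (k : fieldType) (C : chComplex k) (i : int) : Prop :=
  forall z : C, cycle i z -> homologous i z 0.

(* every H_i(C) is finite-dimensional *)
Definition finite_type_homology (k : fieldType) (C : chComplex k) : Prop :=
  forall i, exists n, exists2 s : 'I_n -> C,
    forall j, cycle i (s j) &
    forall z, cycle i z ->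
      exists c : 'I_n -> k, homologous i z (\sum_j c j *: s j).

Section DirectSum.

Variable k : fieldType.

Definition gr0_pr (i : int) (x : 'rV[k]_0) : 'rV[k]_0 := 0.

Lemma gr0_pr_linear i : linear (gr0_pr i).
Proof. by move=> c x y; rewrite /gr0_pr scaler0 addr0. Qed.

Lemma gr0_pr_pr i j x :
  gr0_pr i (gr0_pr j x) = if i == j then gr0_pr j x else 0.
Proof. by rewrite /gr0_pr if_same. Qed.

Lemma gr0_pr_sum x : exists2 s : seq int,
  uniq s & x = \sum_(i <- s) gr0_pr i x.
Proof. by exists [::] => //; rewrite big_nil thinmx0. Qed.

Definition grZero : grMod k := GrMod gr0_pr_linear gr0_pr_pr gr0_pr_sum.

Lemma gr_pr0 (V : grMod k) i : gr_pr i (0 : V) = 0.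
Proof.
by have := gr_pr_linear (g := V) i (-1) 0 0; rewrite scaler0 addr0 scaleN1r addNr.
Qed.

Lemma gr_pr_supp (V : grMod k) (x : V) (s : seq int) i :
  x = \sum_(j <- s) gr_pr j x -> i \notin s -> gr_pr i x = 0.
Proof.
move=> -> nis.
have prD (y z : V) : gr_pr i (y + z) = gr_pr i y + gr_pr i z.
  by have := gr_pr_linear (g := V) i 1 y z; rewrite !scale1r.
rewrite (big_morph (gr_pr i) prD (gr_pr0 V i)) big_seq big1 // => j js.
by rewrite gr_pr_pr; case: eqP => // eij; rewrite eij js in nis.
Qed.

Lemma gr_pr_sum_sub (V : grMod k) (x : V) (s t : seq int) :
  uniq s -> uniq t -> {subset s <= t} ->
  x = \sum_(j <- s) gr_pr j x -> x = \sum_(j <- t) gr_pr j x.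
Proof.
move=> us ut sst xs; rewrite {1}xs [RHS](bigID (mem s) predT) /=.
rewrite [X in _ = _ + X]big1 => [|j njs]; last exact: gr_pr_supp xs njs.
rewrite addr0 -[RHS]big_filter; apply: perm_big.
apply: uniq_perm => //; first exact: filter_uniq.
move=> j; rewrite mem_filter /=.
by case js: (j \in s) => //=; rewrite (sst _ js).
Qed.

Variables V W : grMod k.

Definition grSum_pr (i : int) (x : V * W) : V * W :=
  (gr_pr i x.1, gr_pr i x.2).

Lemma grSum_pr_linear i : linear (grSum_pr i).
Proof. by move=> c x y; rewrite /grSum_pr /= !gr_pr_linear. Qed.

Lemma grSum_pr_pr i j x :
  grSum_pr i (grSum_pr j x) = if i == j then grSum_pr j x else 0.
Proof. by rewrite /grSum_pr /= !gr_pr_pr; case: (i == j). Qed.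

Lemma grSum_pr_sum x : exists2 s : seq int,
  uniq s & x = \sum_(i <- s) grSum_pr i x.
Proof.
have [s us xs] := gr_pr_sum x.1; have [t ut xt] := gr_pr_sum x.2.
have uu : uniq (undup (s ++ t)) by exact: undup_uniq.
exists (undup (s ++ t)) => //.
have xs' : x.1 = \sum_(j <- undup (s ++ t)) gr_pr j x.1.
  by apply: gr_pr_sum_sub us uu _ xs => j js; rewrite mem_undup mem_cat js.
have xt' : x.2 = \sum_(j <- undup (s ++ t)) gr_pr j x.2.
  by apply: gr_pr_sum_sub ut uu _ xt => j js; rewrite mem_undup mem_cat js orbT.
rewrite [LHS]surjective_pairing {1}xs' {1}xt'.
by elim/big_rec3: _ => // j y1 y2 y3 _ <-.
Qed.

Definition grSum : grMod k := GrMod grSum_pr_linear grSum_pr_pr grSum_pr_sum.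

End DirectSum.

(** * Operads *)

(* Slots of a partial composition \mu o_i \nu, with \nu of arity n: slot
   a != i of \mu becomes slot [outer i n a], and slot b of \nu becomes slot
   i + b (everything is numbered from 0). *)
Definition outer (i n a : nat) : nat := if (a < i)%N then a else (a + n).-1.

(* \rho = \sigma o_i \tau, the block permutation for which
   (\mu\sigma) o_i (\nu\tau) = (\mu o_(\sigma i) \nu)\rho. *)
Definition block_perm (m n p : nat) (i : 'I_m)
    (s : 'S_m) (t : 'S_n) (r : 'S_p) : Prop :=
  (forall (a : 'I_m) (x : 'I_p), a != i ->
     x = outer i n a :> nat -> r x = outer (s i) n (s a) :> nat) /\
  (forall (b : 'I_n) (x : 'I_p),
     x = (i + b)%N :> nat -> r x = (s i + t b)%N :> nat).

(* Unital symmetric operads in chain complexes, presented by the partial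
   compositions o_i : P(m) (x) P(n) -> P(m + n - 1).
   - [op_act s mu] is the right action \mu s: slot a of \mu s is slot s(a) of
     \mu.  It is a right action for the composition of functions, hence the
     order in [op_actM], since (s * t) x = t (s x) in 'S_n.
   - The target arity of [op_comp] is any p with m + n = p + 1, so that the
     axioms need no transport along equalities of arities. *)
Record operad (k : fieldType) := Operad {
  op :> nat -> chComplex k;
  op_act : forall n, 'S_n -> op n -> op n;
  op_id : op 1%N;
  op_comp : forall (m n p : nat) (i : 'I_m), (m + n = p.+1)%N ->
    op m -> op n -> op p;
  op_act_grLinear : forall n (s : 'S_n), grLinear (op_act s);
  op_act_d : forall n (s : 'S_n) (mu : op n),
    cc_d (op_act s mu) = op_act s (cc_d mu);
  op_act1 : forall n (mu : op n), op_act 1%g mu = mu;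
  op_actM : forall n (s t : 'S_n) (mu : op n),
    op_act (s * t)%g mu = op_act s (op_act t mu);
  op_id_deg : homog 0 op_id;
  op_comp_linearl : forall m n p i (e : (m + n = p.+1)%N) nu,
    linear (fun mu => op_comp i e mu nu);
  op_comp_linearr : forall m n p i (e : (m + n = p.+1)%N) mu,
    linear (op_comp i e mu);
  op_comp_deg : forall m n p i (e : (m + n = p.+1)%N) a b mu nu,
    homog a mu -> homog b nu -> homog (a + b) (op_comp i e mu nu);
  op_comp_d : forall m n p i (e : (m + n = p.+1)%N) a mu nu, homog a mu ->
    cc_d (op_comp i e mu nu) =
    op_comp i e (cc_d mu) nu + (-1) ^ a *: op_comp i e mu (cc_d nu);
  op_idl : forall n i (e : (1 + n = n.+1)%N) (nu : op n),
    op_comp i e op_id nu = nu;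
  op_idr : forall m i (e : (m + 1 = m.+1)%N) (mu : op m),
    op_comp i e mu op_id = mu;
  op_comp_act : forall m n p (i : 'I_m) (e : (m + n = p.+1)%N)
      (s : 'S_m) (t : 'S_n) (r : 'S_p) mu nu,
    block_perm i s t r ->
    op_comp i e (op_act s mu) (op_act t nu) =
    op_act r (op_comp (s i) e mu nu);
  (* (lam o_i mu) o_(i+j) nu = lam o_i (mu o_j nu) *)
  op_comp_seq : forall l m n p q s (i : 'I_l) (j : 'I_m) (u : 'I_p)
      (e1 : (l + m = p.+1)%N) (e2 : (p + n = q.+1)%N)
      (e3 : (m + n = s.+1)%N) (e4 : (l + s = q.+1)%N) lam mu nu,
    u = (i + j)%N :> nat ->
    op_comp u e2 (op_comp i e1 lam mu) nu =
    op_comp i e4 lam (op_comp j e3 mu nu);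
  (* (lam o_i mu) o_(j+m-1) nu = +/- (lam o_j nu) o_i mu, for i < j *)
  op_comp_par : forall l m n p q s (i j : 'I_l) (u : 'I_p) (v : 'I_s)
      (e1 : (l + m = p.+1)%N) (e2 : (p + n = q.+1)%N)
      (e3 : (l + n = s.+1)%N) (e4 : (s + m = q.+1)%N) a b lam mu nu,
    (i < j)%N -> u = (j + m).-1 :> nat -> v = i :> nat ->
    homog a mu -> homog b nu ->
    op_comp u e2 (op_comp i e1 lam mu) nu =
    (-1) ^ (a * b) *: op_comp v e4 (op_comp j e3 lam nu) mu }.

(* P(1) = k, in degree 0 since op_id is *)
Definition op_connected (k : fieldType) (P : operad k) : Prop :=
  op_id P != 0 /\ forall x : P 1%N, exists c : k, x = c *: op_id P.

(* P(0) = 0 *)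
Definition op_reduced (k : fieldType) (P : operad k) : Prop :=
  forall x : P 0%N, x = 0.

(* P(0) = k in degree 0 *)
Definition op_unitary (k : fieldType) (P : operad k) : Prop :=
  exists e : P 0%N,
    [/\ homog 0 e, e != 0 & forall x : P 0%N, exists c : k, x = c *: e].

Definition op_tame (k : fieldType) (r : nat) (P : operad k) : Prop :=
  forall (n : nat) (q : int), (2 <= n)%N ->
    q <= (1 - n%:Z) * (1 + r%:Z) -> forall x : P n, homog q x -> x = 0.

Definition op_finite_type (k : fieldType) (P : operad k) : Prop :=
  forall n, finite_type (P n).

(** * Algebras *)

Definition ffupd (T : Type) (n : nat) (x : {ffun 'I_n -> T}) (a : 'I_n)
    (y : T) : {ffun 'I_n -> T} :=
  [ffun b => if b == a then y else x b].

Definition ffnth (V : nmodType) (n : nat) (x : {ffun 'I_n -> V}) (l : nat) : V :=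
  if insub l is Some a then x a else 0.

(* exponent of the Koszul sign of the permutation s of factors of degrees e *)
Definition koszul (n : nat) (s : 'S_n) (e : 'I_n -> int) : int :=
  \sum_(a < n) \sum_(b < n | (a < b)%N && (s b < s a)%N) e a * e b.

(* Structure of graded P-algebra, the differential of P being forgotten;
   [al_act n mu x] is mu(x_0, ..., x_(n-1)). *)
Record algStruct (k : fieldType) (P : operad k) (A : grMod k) := AlgStruct {
  al_act : forall n, P n -> {ffun 'I_n -> A} -> A;
  al_act_linearl : forall n (x : {ffun 'I_n -> A}),
    linear (fun mu => al_act mu x);
  al_act_linearr : forall n (mu : P n) (x : {ffun 'I_n -> A}) (a : 'I_n),
    linear (fun y => al_act mu (ffupd x a y));
  al_act_deg : forall n (mu : P n) (x : {ffun 'I_n -> A}) q (e : 'I_n -> int),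
    homog q mu -> (forall a, homog (e a) (x a)) ->
    homog (q + \sum_a e a) (al_act mu x);
  al_act_id : forall x, al_act (op_id P) x = x ord0;
  al_act_perm : forall n (s : 'S_n) (mu : P n) (x : {ffun 'I_n -> A})
      (e : 'I_n -> int),
    (forall a, homog (e a) (x a)) ->
    al_act (op_act s mu) x =
    (-1) ^ koszul s e *: al_act mu [ffun a => x (s^-1 a)%g];
  (* (mu o_i nu)(x) = +/- mu(x_0, ..., nu(x_i, ..., x_(i+n-1)), ...) *)
  al_act_comp : forall m n p (i : 'I_m) (em : (m + n = p.+1)%N)
      (mu : P m) (nu : P n) (x : {ffun 'I_p -> A}) q (e : 'I_p -> int),
    homog q nu -> (forall a, homog (e a) (x a)) ->
    al_act (op_comp i em mu nu) x =
    (-1) ^ (q * \sum_(l < p | (l < i)%N) e l) *: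
      al_act mu [ffun a : 'I_m =>
        if a == i then al_act nu [ffun b : 'I_n => ffnth x (i + b)]
        else ffnth x (outer i n a)] }.

Record grAlg (k : fieldType) (P : operad k) := GrAlg {
  ga_gr :> grMod k;
  ga_struct :> algStruct P ga_gr }.

(* P-algebras in chain complexes *)
Record dgAlg (k : fieldType) (P : operad k) := DgAlg {
  dg_cc :> chComplex k;
  dg_struct :> algStruct P dg_cc;
  dg_act_d : forall n (mu : P n) (x : {ffun 'I_n -> dg_cc}) q (e : 'I_n -> int),
    homog q mu -> (forall a, homog (e a) (x a)) ->
    cc_d (al_act dg_struct mu x) =
    al_act dg_struct (cc_d mu) x +
    \sum_(a < n) (-1) ^ (q + \sum_(b < n | (b < a)%N) e b) *:
      al_act dg_struct mu (ffupd x a (cc_d (x a))) }.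

Definition dg_grAlg (k : fieldType) (P : operad k) (A : dgAlg P) : grAlg P :=
  GrAlg (dg_struct A).

Definition is_grAlgHom (k : fieldType) (P : operad k) (A B : grAlg P)
    (f : A -> B) : Prop :=
  grLinear f /\
  forall n (mu : P n) (x : {ffun 'I_n -> A}),
    f (al_act A mu x) = al_act B mu [ffun a => f (x a)].

Definition is_dgAlgHom (k : fieldType) (P : operad k) (A B : dgAlg P)
    (f : A -> B) : Prop :=
  is_grAlgHom (A := dg_grAlg A) (B := dg_grAlg B) f /\
  forall x, f (cc_d x) = cc_d (f x).

(* H_i(f) is injective and surjective for all i *)
Definition quasi_iso (k : fieldType) (C D : chComplex k) (f : C -> D) : Prop :=
  forall i,
    (forall z : C, cycle i z -> homologous i (f z) 0 -> homologous i z 0) /\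
    (forall w : D, cycle i w -> exists2 z : C, cycle i z & homologous i w (f z)).

(* the unit map P(0) -> A *)
Definition alg_unit (k : fieldType) (P : operad k) (A : dgAlg P)
    (x : P 0%N) : A :=
  al_act A x [ffun=> 0].

Definition alg_connected (k : fieldType) (P : operad k) (r : nat)
    (A : dgAlg P) : Prop :=
  [/\ forall i : int, i < 0 -> acyclic_at A i,
      (* the unit map induces a bijection P(0) -> H_0(A) *)
      forall z : A, cycle 0 z ->
        exists! x : P 0%N, homologous 0 z (alg_unit A x)
    & forall i : int, 1 <= i <= r%:Z -> acyclic_at A i].

(** * Free algebras, KS-extensions and Sullivan minimal algebras *)

(* A, with iota : V -> A, is the free graded P-algebra P<V>; this determines
   (A, iota) up to a unique isomorphism. *)
Definition is_free (k : fieldType) (P : operad k) (V : grMod k) (A : grAlg P)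
    (iota : V -> A) : Prop :=
  grLinear iota /\
  forall (C : grAlg P) (g : V -> C), grLinear g ->
    exists h : A -> C,
      [/\ is_grAlgHom h, forall v, h (iota v) = g v
        & forall h' : A -> C, is_grAlgHom h' ->
            (forall v, h' (iota v) = g v) -> forall x, h' x = h x].

(* Given A free on iota : V -> A, the algebra B is the KS-extension
   A u_d P<V'> of degree n attached by del : V' -> Z_(n-1)(A), with inclusions
   j : A -> B and eta : V' -> B: it is P<V (+) V'> as a graded algebra, and its
   differential, which is a derivation as B is a [dgAlg], extends those of A
   and del. *)
Definition is_KSext (k : fieldType) (P : operad k) (V : grMod k) (A : dgAlg P)
    (iota : V -> A) (n : int) (V' : grMod k) (del : V' -> A)
    (B : dgAlg P) (j : A -> B) (eta : V' -> B) : Prop :=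
  [/\ 0 < n,
      forall v : V', homog n v,
      linear del /\ forall v, cycle (n - 1) (del v),
      is_free (A := dg_grAlg A) iota
    & [/\ is_free (V := grSum V V') (A := dg_grAlg B)
            (fun w => j (iota w.1) + eta w.2),
          is_dgAlgHom j
        & forall v, cc_d (eta v) = j (del v)]].

(* V[1] (+) ... (+) V[n]; the value of V at 0 is not used *)
Fixpoint gens (k : fieldType) (V : nat -> grMod k) (n : nat) : grMod k :=
  if n is n'.+1 then grSum (gens V n') (V n) else grZero k.

Fixpoint gens_map (k : fieldType) (P : operad k) (V : nat -> grMod k)
    (M : nat -> dgAlg P) (j : forall n, M n -> M n.+1)
    (eta : forall n, V n -> M n) (n : nat) : gens V n -> M n :=
  match n return gens V n -> M n with
  | 0 => fun=> 0
  | n'.+1 => fun w => j n' (gens_map j eta w.1) + eta n'.+1 w.2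
  end.

(* A presentation of M as the union of a sequence of KS-extensions
   P(0) = M[0] -> M[1] -> M[2] -> ..., the n-th one attaching V[n] of degree
   [su_deg n]; [su_in n] is the inclusion of M[n] in M.  The algebra M[0] is
   identified with P(0) by its unit map. *)
Record sullivanTower (k : fieldType) (P : operad k) (r : nat) (M : dgAlg P) :=
  SullivanTower {
  su_stage : nat -> dgAlg P;
  su_V : nat -> grMod k;
  su_deg : nat -> int;
  su_del : forall n, su_V n.+1 -> su_stage n;
  su_next : forall n, su_stage n -> su_stage n.+1;
  su_gen : forall n, su_V n -> su_stage n;
  su_in : forall n, su_stage n -> M;
  su_stage0 : bijective (alg_unit (su_stage 0%N));
  su_deg_gt : forall n, (1 <= n)%N -> r%:Z < su_deg n;
  su_deg_le : forall n, (1 <= n)%N -> su_deg n <= su_deg n.+1;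
  su_KSext : forall n,
    is_KSext (gens_map su_next su_gen (n := n)) (su_deg n.+1) (@su_del n)
      (@su_next n) (@su_gen n.+1);
  su_in_hom : forall n, is_dgAlgHom (@su_in n);
  su_in_next : forall n (x : su_stage n), su_in (su_next x) = su_in x;
  su_in_inj : forall n, injective (@su_in n);
  su_in_union : forall y : M, exists n (x : su_stage n), y = su_in x }.

Definition sullivan_minimal (k : fieldType) (P : operad k) (r : nat)
    (M : dgAlg P) : Prop :=
  inhabited (sullivanTower r M).

Definition sullivan_minimal_model (k : fieldType) (P : operad k) (r : nat)
    (A M : dgAlg P) (f : M -> A) : Prop :=
  [/\ sullivan_minimal r M, is_dgAlgHom f & quasi_iso f].

(* Main.v *)
Require Import Defs.
From HB Require Import structures.
From mathcomp Require Import all_boot all_order all_algebra all_fingroup.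
From mathcomp Require Import boolp.
From mathcomp Require Import zify.

Set Implicit Arguments.
Unset Strict Implicit.
Unset Printing Implicit Defensive.

Import Order.TTheory GRing.Theory Num.Theory.
Local Open Scope ring_scope.

(** The model is built degree by degree, starting from M[0] = P(0).  Suppose
    that f : M[n] -> A is bijective on H_i for i < N and surjective for i = N,
    where N = r + n.  New generators V' of degree N + 1 are attached that span
    the homology of the cone of f in degree N + 1: pairs (z, a) of a cycle z of
    degree N of M[n] and an element a of A with f(z) = d(a).  The generator v
    of such a pair has d(v) = z and is sent to a.  This kills the kernel of
    H_N(f) and makes H_(N+1)(f) surjective, provided that nothing else happens
    in degrees at most N.  That is where tameness comes in: an operation of
    arity m >= 2 has degree greater than (1 - m)(1 + r) while all the
    generators have degree at least r + 1, so that a product of generators has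
    a larger degree than each of its factors.  The elements of degree at most
    N of M[n + 1] therefore come from M[n] ([tame_low_degrees]), and the union
    of the M[n] is a model ([step_exists], [tower_model]).

    If A is (r+1)-connected, there is no generator of degree r + 1
    ([cone_acyclic]).  The generators then have degree at least r + 2, only
    finitely many arities contribute to a given degree, and the cone has finite
    dimensional homology as long as M[n] has ([tame_finite_type],
    [cone_finite]).

    Two constructions are needed for this.  The free algebra on V is the
    quotient of a type of formal expressions by the relation of having the same
    value in every P-algebra and for every graded linear map from V
    ([equiv_term]).  It satisfies every identity of P-algebras by construction,
    and its universal property together with induction on expressions replaces
    the description of P<V> as a sum of tensor products: for instance the
    inclusion of a KS-extension is injective because it has a retraction.  The
    union of the tower is obtained in the same way, as the free algebra on all
    the generators together ([union_exists]).

    Differentials come from square-zero extensions: a map D is a derivation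
    along a morphism h : M -> C exactly when (h, D) is a morphism of algebras
    from M to C (+) C[1], where an operation mu acts as mu + eps d(mu) with
    eps of degree 1 ([epsStruct], [der_hom], [hom_der]).  The universal property
    of a free algebra thus determines derivations by their values on generators
    ([der_exists], [der_unique]).  The verification that this extension is an
    algebra is the only place where the Koszul signs of all the axioms have to
    be compared. *)

(** * Graded vector spaces *)

Section LinearMaps.

Variables (k : fieldType) (U V : lmodType k) (f : U -> V) (lf : linear f).

Lemma linD x y : f (x + y) = f x + f y.
Proof. by have := lf 1 x y; rewrite !scale1r. Qed.

Lemma lin0 : f 0 = 0.
Proof. by have := lf (-1) 0 0; rewrite scaler0 addr0 scaleN1r addNr. Qed.

Lemma linZ c x : f (c *: x) = c *: f x.
Proof. by have := lf c x 0; rewrite addr0 lin0 addr0. Qed.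

Lemma linN x : f (- x) = - f x.
Proof. by rewrite -!scaleN1r linZ. Qed.

Lemma linB x y : f (x - y) = f x - f y.
Proof. by rewrite linD linN. Qed.

Lemma lin_sum (I : Type) (r : seq I) (P : pred I) (F : I -> U) :
  f (\sum_(i <- r | P i) F i) = \sum_(i <- r | P i) f (F i).
Proof. exact: (big_morph f linD lin0). Qed.

End LinearMaps.

Section LinearClosure.

Variables (k : fieldType) (U V W : lmodType k).

Lemma linear_add (f g : U -> V) : linear f -> linear g ->
  linear (fun x => f x + g x).
Proof. by move=> lf lg c x y; rewrite lf lg scalerDr addrACA. Qed.

Lemma linear_comp (f : U -> V) (g : V -> W) : linear f -> linear g ->
  linear (fun x => g (f x)).
Proof. by move=> lf lg c x y; rewrite lf lg. Qed.

Lemma linear_big (I : Type) (r : seq I) (P : pred I) (F : I -> U -> V) :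
  (forall i, P i -> linear (F i)) -> linear (fun x => \sum_(i <- r | P i) F i x).
Proof.
move=> lF c x y; rewrite scaler_sumr -big_split /=; apply: eq_bigr => i Pi.
exact: lF.
Qed.

Lemma linear_idf : linear (@idfun U).
Proof. by []. Qed.

Lemma linear_zero : linear (fun _ : U => 0 : V).
Proof. by move=> c x y; rewrite scaler0 addr0. Qed.

End LinearClosure.

Section Graded.

Variables (k : fieldType) (V : grMod k).
Implicit Types (x y : V) (i j : int).

Lemma prD i x y : gr_pr i (x + y) = gr_pr i x + gr_pr i y.
Proof. exact: linD (gr_pr_linear i) _ _. Qed.

Lemma prZ i c x : gr_pr i (c *: x) = c *: gr_pr i x.
Proof. exact: linZ (gr_pr_linear i) _ _. Qed.

Lemma prN i x : gr_pr i (- x) = - gr_pr i x.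
Proof. exact: linN (gr_pr_linear i) _. Qed.

Lemma homog_pr i x : homog i (gr_pr i x).
Proof. by rewrite /homog gr_pr_pr eqxx. Qed.

Lemma homog0 i : homog i (0 : V).
Proof. exact: gr_pr0. Qed.

Lemma homogD i x y : homog i x -> homog i y -> homog i (x + y).
Proof. by rewrite /homog prD => -> ->. Qed.

Lemma homogZ i c x : homog i x -> homog i (c *: x).
Proof. by rewrite /homog prZ => ->. Qed.

Lemma homogN i x : homog i x -> homog i (- x).
Proof. by rewrite /homog prN => ->. Qed.

Lemma homogB i x y : homog i x -> homog i y -> homog i (x - y).
Proof. by move=> hx hy; apply/homogD/homogN. Qed.

Lemma homog_sum i (I : Type) (r : seq I) (P : pred I) (F : I -> V) :
  (forall a, P a -> homog i (F a)) -> homog i (\sum_(a <- r | P a) F a).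
Proof.
by move=> hF; elim/big_ind: _ => //; [exact: homog0 | move=> *; exact: homogD].
Qed.

Lemma pr_homog i j x : homog j x -> gr_pr i x = if i == j then x else 0.
Proof. by move=> hx; rewrite -hx gr_pr_pr hx. Qed.

Lemma homog_neq i j x : homog i x -> homog j x -> i != j -> x = 0.
Proof. by move=> hi /(pr_homog i); rewrite hi => + /negPf ij; rewrite ij. Qed.

Lemma homog_ind (Q : V -> Prop) x : Q 0 ->
  (forall y z, Q y -> Q z -> Q (y + z)) -> (forall i, Q (gr_pr i x)) -> Q x.
Proof.
by move=> Q0 QD Qx; have [s _ ->] := gr_pr_sum x; elim/big_ind: _.
Qed.

Lemma pr_ext x y : (forall i, gr_pr i x = gr_pr i y) -> x = y.
Proof.
move=> xy; apply/eqP; rewrite -subr_eq0; apply/eqP.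
have [s _ ->] := gr_pr_sum (x - y).
by rewrite big1 // => i _; rewrite prD prN xy subrr.
Qed.

Lemma linear_homog_ext (W : lmodType k) (f g : V -> W) :
  linear f -> linear g -> (forall i x, homog i x -> f x = g x) -> f =1 g.
Proof.
move=> lf lg fg x; apply: (homog_ind (Q := fun y => f y = g y)).
- by rewrite !lin0.
- by move=> y z; rewrite !linD // => -> ->.
- by move=> i; apply: fg (homog_pr i x).
Qed.

Definition degs (B : nat) : seq int :=
  undup ([seq n%:Z | n <- iota 0 B.+1] ++ [seq - n%:Z | n <- iota 0 B.+1]).

Lemma mem_degs B i : (i \in degs B) = (`|i| <= B)%N.
Proof.
rewrite mem_undup mem_cat; apply/orP/idP.
  by case=> /mapP[n]; rewrite mem_iota => + ->; lia.
move=> iB; have [i0|i0] := leP 0 i.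
  by left; apply/mapP; exists `|i|%N; rewrite ?mem_iota; lia.
by right; apply/mapP; exists `|i|%N; rewrite ?mem_iota; lia.
Qed.

Definition bounded (B : nat) x := forall i, (B < `|i|)%N -> gr_pr i x = 0.

Lemma bounded_exists x : exists B, bounded B x.
Proof.
have [s us xs] := gr_pr_sum x.
exists (\max_(i <- s) `|i|)%N => i iB; apply: gr_pr_supp xs _.
apply: contraL iB => si; rewrite -leqNgt.
by rewrite (big_rem _ si) /= leq_maxl.
Qed.

Lemma boundedW B B' x : (B <= B')%N -> bounded B x -> bounded B' x.
Proof. by move=> BB' bx i iB'; apply: bx; lia. Qed.

Lemma bounded_sum B x : bounded B x -> x = \sum_(i <- degs B) gr_pr i x.
Proof.
move=> bx; apply: pr_ext => i; rewrite (lin_sum (gr_pr_linear i)).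
have [iB|iB] := leqP `|i| B.
  rewrite (bigD1_seq i) ?undup_uniq ?mem_degs //= gr_pr_pr eqxx.
  by rewrite big1 ?addr0 // => j ji; rewrite gr_pr_pr eq_sym (negPf ji).
rewrite bx // big_seq big1 // => j; rewrite mem_degs gr_pr_pr => jB.
by case: eqP => // ij; lia.
Qed.

End Graded.

Arguments homog0 {k V}.

Lemma sign_odd (k : fieldType) (i : int) :
  (-1) ^ i = (-1) ^+ odd `|i|%N :> k.
Proof. by case: i => n; rewrite signr_odd //= /exprz invr_sign. Qed.

Lemma sign_eq (k : fieldType) (i j : int) :
  odd `|i|%N = odd `|j|%N -> (-1) ^ i = (-1) ^ j :> k.
Proof. by rewrite !sign_odd => ->. Qed.

Lemma signD (k : fieldType) (i j : int) :
  (-1) ^ (i + j) = (-1) ^ i * (-1) ^ j :> k.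
Proof. by rewrite expfzDr ?oppr_eq0 ?oner_eq0. Qed.

Lemma sign_sum (k : fieldType) (I : Type) (r : seq I) (P : pred I)
    (F : I -> int) :
  (-1) ^ (\sum_(i <- r | P i) F i) = \prod_(i <- r | P i) (-1) ^ F i :> k.
Proof. exact: (big_morph (fun i => (-1) ^ i) (@signD k)). Qed.

Lemma sign_sqr (k : fieldType) (i : int) : (-1) ^ i * (-1) ^ i = 1 :> k.
Proof. by rewrite -signD sign_odd; have -> : odd `|(i + i)%R|%N = false by lia. Qed.

(** The degree involution, (-1)^i on V_i.  It turns the Koszul signs of the
    axioms, which only make sense on homogeneous elements, into identities
    that are linear in every variable and hold for all elements. *)
Section DegreeInvolution.

Variables (k : fieldType) (V : grMod k).
Implicit Types (x y : V).

Definition sgn (x : V) : V :=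
  \sum_(i <- degs (projT1 (cid (bounded_exists x)))) (-1) ^ i *: gr_pr i x.

Lemma pr_sgn i x : gr_pr i (sgn x) = (-1) ^ i *: gr_pr i x.
Proof.
rewrite /sgn; case: cid => B bx /=; rewrite (lin_sum (gr_pr_linear i)).
have [iB|iB] := leqP `|i| B.
  rewrite (bigD1_seq i) ?undup_uniq ?mem_degs //= prZ gr_pr_pr eqxx.
  by rewrite big1 ?addr0 // => j ji; rewrite prZ gr_pr_pr eq_sym (negPf ji) scaler0.
rewrite bx // scaler0 big_seq big1 // => j; rewrite mem_degs prZ gr_pr_pr => jB.
by case: eqP => [ij|]; [lia | rewrite scaler0].
Qed.

Lemma sgn_linear : linear sgn.
Proof.
move=> c x y; apply: pr_ext => i; rewrite prD prZ !pr_sgn prD prZ.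
by rewrite scalerDr !scalerA [c * _]mulrC.
Qed.

Lemma sgn_homog i x : homog i x -> sgn x = (-1) ^ i *: x.
Proof.
move=> hx; apply: pr_ext => j; rewrite pr_sgn prZ (pr_homog _ hx).
by case: eqP => [->|]; rewrite ?scaler0.
Qed.

Lemma homog_sgn i x : homog i x -> homog i (sgn x).
Proof. by move=> hx; rewrite (sgn_homog hx); apply: homogZ. Qed.

Lemma sgnK : involutive sgn.
Proof.
by move=> x; apply: pr_ext => i; rewrite !pr_sgn scalerA sign_sqr scale1r.
Qed.

End DegreeInvolution.

Lemma homog_imageP (k : fieldType) (V W : grMod k) (f : V -> W) (m : int) :
  linear f -> (forall i x, homog i x -> homog (i + m) (f x)) ->
  forall i x, f (gr_pr i x) = gr_pr (i + m) (f x).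
Proof.
move=> lf df i.
apply: linear_homog_ext; [exact: linear_comp (gr_pr_linear i) lf |
  exact: linear_comp lf (gr_pr_linear _) |].
move=> j x hx; rewrite (pr_homog _ hx) (pr_homog _ (df _ _ hx)).
by rewrite (inj_eq (addIr _)); case: eqP => // _; rewrite lin0.
Qed.

Lemma grLinear_pr (k : fieldType) (V W : grMod k) (f : V -> W) :
  grLinear f -> forall i x, f (gr_pr i x) = gr_pr i (f x).
Proof.
move=> [lf df] i x; rewrite (homog_imageP (m := 0)) ?addr0 // => j y.
by rewrite addr0; apply: df.
Qed.

Lemma grLinear_sgn (k : fieldType) (V W : grMod k) (f : V -> W) :
  grLinear f -> forall x, f (sgn x) = sgn (f x).
Proof.
move=> gf x; apply: pr_ext => i; rewrite -(grLinear_pr gf) !pr_sgn.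
by rewrite (linZ gf.1) (grLinear_pr gf).
Qed.

Lemma sgn_degN1 (k : fieldType) (V W : grMod k) (f : V -> W) :
  linear f -> (forall i x, homog i x -> homog (i - 1) (f x)) ->
  forall x, f (sgn x) = - sgn (f x).
Proof.
move=> lf df; apply: linear_homog_ext.
- exact: (linear_comp (@sgn_linear _ _) lf).
- move=> c x y; rewrite lf sgn_linear opprD scalerN //.
move=> i x hx; rewrite (sgn_homog hx) (sgn_homog (df _ _ hx)) linZ //.
by rewrite -scaleNr signD (_ : (-1) ^ (-1) = -1 :> k) ?mulrN1 ?opprK // exprN1 invrN1.
Qed.

Lemma grLinear_comp (k : fieldType) (U V W : grMod k) (f : U -> V)
    (g : V -> W) :
  grLinear f -> grLinear g -> grLinear (fun x => g (f x)).
Proof.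
by move=> [lf df] [lg dg]; split=> [|i x hx]; [exact: linear_comp | auto].
Qed.

Lemma grLinear_zero (k : fieldType) (V W : grMod k) :
  grLinear (fun _ : V => 0 : W).
Proof. by split=> [|i x _]; [exact: linear_zero | exact: homog0]. Qed.

(** * Multilinear maps *)

Section Multilinear.

Variables (k : fieldType) (n : nat).

Definition multilin (X A C : lmodType k) (Phi : X -> {ffun 'I_n -> A} -> C) :=
  (forall x, linear (Phi^~ x)) /\
  (forall mu x a, linear (fun y => Phi mu (ffupd x a y))).

Lemma ffupdE (T : Type) (x : {ffun 'I_n -> T}) a y b :
  ffupd x a y b = if b == a then y else x b.
Proof. by rewrite ffunE. Qed.

Lemma ffupd_id (T : Type) (x : {ffun 'I_n -> T}) a : ffupd x a (x a) = x.
Proof. by apply/ffunP => b; rewrite ffupdE; case: eqP => [->|]. Qed.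

Lemma multilin_comp (X X' A A' C : lmodType k)
    (Phi : X -> {ffun 'I_n -> A} -> C) (u : X' -> X) (v : 'I_n -> A' -> A) :
  multilin Phi -> linear u -> (forall a, linear (v a)) ->
  multilin (fun mu x => Phi (u mu) [ffun a => v a (x a)]).
Proof.
move=> [Phil Phir] lu lv; split=> [x|mu x a c y z].
  exact: linear_comp lu (Phil _).
have E w : [ffun b => v b (ffupd x a w b)] =
           ffupd [ffun b => v b (x b)] a (v a w).
  by apply/ffunP => b; rewrite !ffunE; case: eqP => [->|].
by rewrite !E lv Phir.
Qed.

Lemma multilin_post (X A C D : lmodType k) (Phi : X -> {ffun 'I_n -> A} -> C)
    (w : C -> D) :
  multilin Phi -> linear w -> multilin (fun mu x => w (Phi mu x)).
Proof.
move=> [Phil Phir] lw; split=> [x|mu x a]; first exact: linear_comp (Phil x) lw.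
exact: linear_comp (Phir mu x a) lw.
Qed.

Lemma multilin_add (X A C : lmodType k) (Phi Psi : X -> {ffun 'I_n -> A} -> C) :
  multilin Phi -> multilin Psi -> multilin (fun mu x => Phi mu x + Psi mu x).
Proof.
move=> [Phil Phir] [Psil Psir]; split=> [x|mu x a].
  exact: linear_add (Phil x) (Psil x).
exact: linear_add (Phir mu x a) (Psir mu x a).
Qed.

Lemma multilin_sum (X A C : lmodType k) (I : finType)
    (Phi : I -> X -> {ffun 'I_n -> A} -> C) :
  (forall i, multilin (Phi i)) -> multilin (fun mu x => \sum_i Phi i mu x).
Proof.
move=> mPhi; split=> [x|mu x a]; apply: linear_big => i _.
  by case: (mPhi i) => + _; apply.
by case: (mPhi i) => _; apply.
Qed.

(** Expansion of all the arguments in their homogeneous components. *)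
Lemma multilin_ind (X A : grMod k) (C : lmodType k)
    (Phi : X -> {ffun 'I_n -> A} -> C) (Q : C -> Prop) B mu
    (x : {ffun 'I_n -> A}) :
  multilin Phi -> Q 0 -> (forall y z, Q y -> Q z -> Q (y + z)) ->
  bounded B mu -> (forall a, bounded B (x a)) ->
  (forall q (e : 'I_n -> int), (`|q| <= B)%N -> (forall a, `|e a| <= B)%N ->
     Q (Phi (gr_pr q mu) [ffun a => gr_pr (e a) (x a)])) ->
  Q (Phi mu x).
Proof.
move=> [Phil Phir] Q0 QD bmu bx Qhomog.
rewrite (bounded_sum bmu) (lin_sum (Phil x)) big_seq.
elim/big_ind: _ => // q; rewrite mem_degs => qB.
(* the slots of the list l are expanded one after the other *)
have expand (l : seq 'I_n) :
    (forall e, (forall a, `|e a| <= B)%N -> Q (Phi (gr_pr q mu)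
       [ffun a => if a \in l then gr_pr (e a) (x a) else x a])) ->
    Q (Phi (gr_pr q mu) x).
  elim: l => [|a l IHl] Ql.
    have := Ql (fun=> 0) (fun=> isT); congr (Q (Phi _ _)).
    by apply/ffunP => a; rewrite ffunE.
  apply: IHl => e eB.
  have [al|al] := boolP (a \in l).
    have := Ql e eB; congr (Q (Phi _ _)); apply/ffunP => b; rewrite !ffunE inE.
    by case: eqP => [->|] //=; rewrite al.
  set y := [ffun _ => _]; rewrite -(ffupd_id y a).
  have -> : y a = x a by rewrite ffunE (negPf al).
  rewrite (bounded_sum (bx a)) (lin_sum (Phir _ y a)) big_seq.
  elim/big_ind: _ => // j; rewrite mem_degs => jB.
  have := Ql (fun b => if b == a then j else e b).
  have -> : [ffun b => if b \in a :: l then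
      gr_pr (if b == a then j else e b) (x b) else x b] =
      ffupd y a (gr_pr j (x a)).
    apply/ffunP => b; rewrite !ffunE inE.
    by case: eqP => [->|].
  by apply=> b; case: ifP.
apply: (expand (enum 'I_n)) => e eB; have := Qhomog q e qB eB.
by congr (Q (Phi _ _)); apply/ffunP => a; rewrite !ffunE mem_enum.
Qed.

Lemma multilin_homog_ind (X A : grMod k) (C : lmodType k)
    (Phi : X -> {ffun 'I_n -> A} -> C) (Q : C -> Prop) mu
    (x : {ffun 'I_n -> A}) :
  multilin Phi -> Q 0 -> (forall y z, Q y -> Q z -> Q (y + z)) ->
  (forall q (e : 'I_n -> int),
     Q (Phi (gr_pr q mu) [ffun a => gr_pr (e a) (x a)])) ->
  Q (Phi mu x).
Proof.
move=> mPhi Q0 QD Qhomog; have [B0 b0] := bounded_exists mu.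
have [Bx bx] := choice (fun a => bounded_exists (x a)).
apply: (@multilin_ind X A C Phi Q (B0 + \sum_a Bx a)) => //.
  by apply: boundedW b0; lia.
move=> a; apply: boundedW (bx a); rewrite (bigD1 a) //=; lia.
Qed.

Lemma multilin_ext (X A : grMod k) (C : lmodType k)
    (Phi Psi : X -> {ffun 'I_n -> A} -> C) :
  multilin Phi -> multilin Psi ->
  (forall q (e : 'I_n -> int) mu (x : {ffun 'I_n -> A}), homog q mu ->
     (forall a, homog (e a) (x a)) ->
     Phi mu x = Psi mu x) ->
  forall mu x, Phi mu x = Psi mu x.
Proof.
move=> mPhi mPsi PhiPsi mu x; apply/eqP; rewrite -subr_eq0; apply/eqP.
have mN : multilin (fun mu x => Phi mu x - Psi mu x).
  apply: multilin_add => //; apply: (multilin_post (w := -%R)) => // c y z.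
  by rewrite opprD scalerN.
apply: (@multilin_homog_ind X A C _ (fun y => y = 0) mu x mN) => //.
  by move=> y z -> ->; rewrite addr0.
move=> q e; apply/eqP; rewrite subr_eq0; apply/eqP/(PhiPsi q e) => [|a].
  exact: homog_pr.
by rewrite ffunE; exact: homog_pr.
Qed.

Lemma multilin_scale (X A C : lmodType k) (Phi : X -> {ffun 'I_n -> A} -> C)
    (c : 'I_n -> k) mu (x : {ffun 'I_n -> A}) :
  multilin Phi ->
  Phi mu [ffun a => c a *: x a] = (\prod_a c a) *: Phi mu x.
Proof.
move=> [_ Phir].
have scale_list (l : seq 'I_n) : uniq l ->
    Phi mu [ffun a => if a \in l then c a *: x a else x a] =
    (\prod_(a <- l) c a) *: Phi mu x.
  elim: l => [_|a l IHl /= /andP[al ul]].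
    rewrite big_nil scale1r; congr (Phi _ _).
    by apply/ffunP => a; rewrite ffunE.
  rewrite big_cons -scalerA -IHl //.
  set z := [ffun b => if b \in l then _ else _].
  have -> : [ffun b => if b \in a :: l then c b *: x b else x b] =
            ffupd z a (c a *: x a).
    by apply/ffunP => b; rewrite !ffunE inE; case: eqP => [->|].
  rewrite (linZ (Phir _ _ a)); congr (_ *: Phi _ _).
  by rewrite -[RHS](ffupd_id z a) ffunE (negPf al).
rewrite -scale_list ?index_enum_uniq //; congr (Phi _ _).
by apply/ffunP => a; rewrite !ffunE mem_index_enum.
Qed.

Lemma multilin_zero (X A C : lmodType k) (Phi : X -> {ffun 'I_n -> A} -> C)
    mu (x : {ffun 'I_n -> A}) a :
  multilin Phi -> x a = 0 -> Phi mu x = 0.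
Proof. by move=> [_ Phir] xa; rewrite -(ffupd_id x a) xa (lin0 (Phir mu x a)). Qed.

End Multilinear.

Section Actions.

Variables (k : fieldType) (P : operad k).

Lemma act_multilin (A : grMod k) (S : algStruct P A) n :
  multilin (@al_act _ _ _ S n).
Proof.
by split=> [x|mu x a]; [exact: al_act_linearl | exact: al_act_linearr].
Qed.

Lemma act_sgn (A : grMod k) (S : algStruct P A) n (mu : P n) x :
  sgn (al_act S mu x) = al_act S (sgn mu) [ffun a => sgn (x a)].
Proof.
apply: (multilin_ext (Phi := fun mu x => sgn (al_act S mu x))
  (Psi := fun mu x => al_act S (sgn mu) [ffun a => sgn (x a)])).
- exact: multilin_post (act_multilin S n) (@sgn_linear _ _).
- apply: (multilin_comp (u := @sgn k (P n)) (v := fun=> @sgn k A)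
      (act_multilin S n)) => [|a]; exact: sgn_linear.
move=> q e {}mu {}x hmu hx.
rewrite (sgn_homog (al_act_deg S hmu hx)) (sgn_homog hmu).
rewrite (linZ (al_act_linearl S _)).
have -> : [ffun a => sgn (x a)] = [ffun a => (-1) ^ e a *: x a] :> {ffun _ -> _}.
  by apply/ffunP => a; rewrite !ffunE (sgn_homog (hx a)).
rewrite (multilin_scale _ _ _ (act_multilin S n)) scalerA signD.
by rewrite sign_sum.
Qed.

Lemma op_comp_sgn m n p (i : 'I_m) (e : (m + n = p.+1)%N) (mu : P m) (nu : P n) :
  sgn (op_comp i e mu nu) = op_comp i e (sgn mu) (sgn nu).
Proof.
move: mu; apply: linear_homog_ext.
- exact: (linear_comp (op_comp_linearl i e nu) (@sgn_linear _ _)).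
- exact: (linear_comp (@sgn_linear _ _) (op_comp_linearl i e (sgn nu))).
move=> a mu hmu; move: nu; apply: linear_homog_ext.
- exact: (linear_comp (op_comp_linearr i e mu) (@sgn_linear _ _)).
- exact: (linear_comp (@sgn_linear _ _) (op_comp_linearr i e (sgn mu))).
move=> b nu hnu; rewrite (sgn_homog (op_comp_deg i e hmu hnu)).
rewrite (sgn_homog hmu) (sgn_homog hnu) (linZ (op_comp_linearr i e _)).
by rewrite (linZ (op_comp_linearl i e _)) scalerA signD mulrC.
Qed.

Lemma op_comp_d_sgn m n p (i : 'I_m) (e : (m + n = p.+1)%N) (mu : P m)
    (nu : P n) :
  cc_d (op_comp i e mu nu) =
  op_comp i e (cc_d mu) nu + op_comp i e (sgn mu) (cc_d nu).
Proof.
move: mu; apply: linear_homog_ext.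
- exact: (linear_comp (op_comp_linearl i e nu) (@cc_d_linear _ _)).
- apply: linear_add.
    exact: (linear_comp (@cc_d_linear _ _) (op_comp_linearl i e nu)).
  exact: (linear_comp (@sgn_linear _ _) (op_comp_linearl i e _)).
move=> a mu hmu; rewrite (op_comp_d i e nu hmu) (sgn_homog hmu).
by rewrite (linZ (op_comp_linearl i e _)).
Qed.

Lemma d_sgn (C : chComplex k) (x : C) : cc_d (sgn x) = - sgn (cc_d x).
Proof. exact: (sgn_degN1 (@cc_d_linear _ C) (@cc_d_deg _ C)). Qed.

Lemma d_op_id : cc_d (op_id P) = 0.
Proof.
have e : (1 + 1 = 1.+1)%N by [].
have := op_comp_d ord0 e (op_id P) (op_id_deg P).
rewrite op_idl op_idl scale1r op_idr => /eqP.
by rewrite -subr_eq subrr => /eqP.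
Qed.

Lemma sgn_op_id : sgn (op_id P) = op_id P.
Proof. by rewrite (sgn_homog (op_id_deg P)) scale1r. Qed.

End Actions.

(** * Square-zero extensions and derivations *)

Section ShiftedModule.

Variables (k : fieldType) (V : grMod k).

Lemma grShift_pr i j (x : V) :
  gr_pr (i - 1) (gr_pr (j - 1) x) = if i == j then gr_pr (j - 1) x else 0.
Proof. by rewrite gr_pr_pr (inj_eq (addIr _)). Qed.

Lemma grShift_sum (x : V) : exists2 s : seq int,
  uniq s & x = \sum_(i <- s) gr_pr (i - 1) x.
Proof.
have [s us xs] := gr_pr_sum x; exists [seq i + 1 | i <- s].
  by rewrite map_inj_uniq //; apply: addIr.
by rewrite big_map {1}xs; apply: eq_bigr => i _; rewrite addrK.
Qed.

(** The suspension. *)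
Definition grShift : grMod k :=
  GrMod (fun i => gr_pr_linear (i - 1)) grShift_pr grShift_sum.

End ShiftedModule.

Lemma homog_sumP (k : fieldType) (V W : grMod k) i (z : grSum V W) :
  homog i z <-> homog i z.1 /\ homog i z.2.
Proof.
case: z => v w; rewrite /homog /= /grSum_pr /=.
by split=> [[-> ->]|[-> ->]].
Qed.

Lemma homog_epsP (k : fieldType) (V : grMod k) i (z : grSum V (grShift V)) :
  homog i z <-> homog i z.1 /\ homog (V := V) (i - 1) z.2.
Proof. exact: homog_sumP. Qed.

Lemma ffnthE (V : nmodType) n (x : {ffun 'I_n -> V}) (a : 'I_n) :
  ffnth x a = x a.
Proof. by rewrite /ffnth valK. Qed.

Lemma ffnth_lt (V : nmodType) n (x : {ffun 'I_n -> V}) l (h : (l < n)%N) :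
  ffnth x l = x (Ordinal h).
Proof. by rewrite /ffnth insubT. Qed.

Lemma ffnth_map (V W : nmodType) n (f : V -> W) (x : {ffun 'I_n -> V}) l :
  f 0 = 0 -> f (ffnth x l) = ffnth [ffun a => f (x a)] l.
Proof. by move=> f0; rewrite /ffnth; case: insub => [a|]; rewrite ?ffunE. Qed.

Section Insertion.

Variable (k : fieldType).

(** The argument of the terms of a derivation of degree -1: passing the slots
    before the a-th one costs their degree involution. *)
Definition ins (A : grMod k) n (x : {ffun 'I_n -> A}) (a : nat) (y : A) :=
  [ffun b : 'I_n => if (b < a)%N then sgn (x b) else
                    if b == a :> nat then y else x b].

Lemma ffnth_ins (A : grMod k) n (x : {ffun 'I_n -> A}) a y t : (t < n)%N ->
  ffnth (ins x a y) t = if (t < a)%N then sgn (ffnth x t) else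
                        if t == a then y else ffnth x t.
Proof. by move=> tn; rewrite !(ffnth_lt _ tn) ffunE. Qed.

Lemma ins_ffupd (A : grMod k) n (x : {ffun 'I_n -> A}) (a : 'I_n) y y' :
  ins x a y = ffupd (ins x a y') a y.
Proof.
apply/ffunP => b; rewrite !ffunE -val_eqE /=.
by case: ltngtP.
Qed.

Lemma ins_linear (X A C : grMod k) n (Phi : X -> {ffun 'I_n -> A} -> C) mu
    (x : {ffun 'I_n -> A}) (a : 'I_n) :
  multilin Phi -> linear (fun y => Phi mu (ins x a y)).
Proof.
move=> [_ Phir] c y z; rewrite (ins_ffupd _ _ _ 0) Phir.
by rewrite -!ins_ffupd.
Qed.

(** The link between inserted degree involutions and the sign of the Leibniz
    rule on homogeneous elements. *)
Lemma ins_sign (X A C : grMod k) n (Phi : X -> {ffun 'I_n -> A} -> C) mu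
    (x : {ffun 'I_n -> A}) (e : 'I_n -> int) (a : 'I_n) y :
  multilin Phi -> (forall b : 'I_n, (b < a)%N -> homog (e b) (x b)) ->
  Phi mu (ins x a y) =
  (-1) ^ (\sum_(b < n | (b < a)%N) e b) *: Phi mu (ffupd x a y).
Proof.
move=> mPhi hx.
rewrite sign_sum big_mkcond /= -(multilin_scale _ _ _ mPhi); congr (Phi _ _).
apply/ffunP => b; rewrite !ffunE -val_eqE /=; case: ltngtP => [ba|ba|ba].
- exact: sgn_homog (hx b ba).
- by rewrite scale1r.
- by rewrite scale1r.
Qed.

Lemma homog_ins (A : grMod k) n (x : {ffun 'I_n -> A}) (e : 'I_n -> int)
    (a : nat) y d :
  (forall b, homog (e b) (x b)) -> homog d y ->
  forall b : 'I_n, homog (if b == a :> nat then d else e b) (ins x a y b).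
Proof.
move=> hx hy b; rewrite ffunE; case: ltngtP => // _.
exact: homog_sgn (hx b).
Qed.

Lemma sum_ord_lt (V : nmodType) (F : nat -> V) n i : (i <= n)%N ->
  \sum_(a < n | (a < i)%N) F a = \sum_(0 <= a < i) F a.
Proof. by move=> le_in; rewrite (big_nat_widen 0 i n) // big_mkord. Qed.

(** The slots of mu o_i nu are those of mu other than i, and those of nu. *)
Lemma sum_outer (V : nmodType) (F : nat -> V) m n p (i : 'I_m) :
  (m + n = p.+1)%N ->
  \sum_(l < p) F l =
  \sum_(a < m | a != i) F (outer i n a) + \sum_(b < n) F (i + b)%N.
Proof.
move=> em; have im := ltn_ord i.
rewrite -(big_mkord predT) (@big_cat_nat _ _ _ i 0 p) //=; last by lia.
rewrite (@big_cat_nat _ _ _ (i + n) i p) /=; [|by lia|by lia].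
have -> : \sum_(i <= l < i + n) F l = \sum_(b < n) F (i + b)%N.
  rewrite -{1}[i : nat]add0n big_addn addKn big_mkord.
  by apply: eq_bigr => b _; rewrite addnC.
rewrite addrA addrAC; congr (_ + _).
rewrite -(big_mkord (fun a => a != i) (fun a => F (outer i n a))).
rewrite [RHS]big_mkcond.
rewrite (@big_cat_nat _ _ _ i 0 m) //=; last exact: ltnW.
rewrite (@big_cat_nat _ _ _ i.+1 i m) //=.
rewrite big_nat1 eqxx /= add0r.
congr (_ + _).
  apply: eq_big_nat => a ai.
  rewrite /outer; have -> : (a != i :> nat) by lia.
  by have -> : (a < i)%N by lia.
have -> : p = (m.-1 + n)%N by lia.
rewrite (big_addn i (m.-1 + n)%N n) -[i.+1]addn1 (big_addn i m 1).
have -> : (m.-1 + n - n)%N = (m - 1)%N by lia.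
apply: eq_big_nat => a ai.
rewrite /outer; have -> : (a + 1 != i :> nat) by lia.
have -> : (a + 1 < i)%N = false by lia.
by rewrite addn1.
Qed.

End Insertion.

Section KoszulParity.

Variables (n : nat) (s : 'S_n) (e : 'I_n -> int) (a : 'I_n).

Let e' (b : 'I_n) : int := if b == a :> nat then e a - 1 else e b.
Let inverted (b : 'I_n) :=
  ((a < b) && (s b < s a) || (b < a) && (s a < s b))%N.

(** Lowering the degree of one factor changes the sign of a permutation by the
    factors that it crosses. *)
Lemma koszul_lower : koszul s e = koszul s e' + \sum_(b | inverted b) e b.
Proof.
have eE b : e b = e' b + (b == a)%:R.
  by rewrite /e' val_eqE; case: eqP => [->|_]; rewrite ?subrK ?addr0.
rewrite /koszul (eq_bigr (fun b : 'I_n =>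
  \sum_(c < n | (b < c)%N && (s c < s b)%N) e' b * e' c +
  (\sum_(c < n | (b < c)%N && (s c < s b)%N) (b == a)%:R * e c +
   \sum_(c < n | (b < c)%N && (s c < s b)%N) e b * (c == a)%:R))); last first.
  move=> b _; rewrite -!big_split /=; apply: eq_bigr => c /andP[bc _].
  rewrite (eE b) (eE c) !mulrDl !mulrDr.
  have -> : (b == a)%:R * (c == a)%:R = 0 :> int.
    have [ba|_] := eqVneq b a; last by rewrite mul0r.
    have [ca|_] := eqVneq c a; last by rewrite mulr0.
    by rewrite ba ca ltnn in bc.
  by rewrite !addr0 !addrA addrAC.
rewrite big_split /=; congr (_ + _); rewrite big_split /=.
rewrite (bigD1 a) //= [X in _ + X + _]big1 ?addr0; last first.
  by move=> b /negPf ba; rewrite big1 // => c _; rewrite ba mul0r.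
rewrite [X in _ + X](eq_bigr (fun b : 'I_n =>
  if (b < a)%N && (s a < s b)%N then e b else 0)); last first.
  move=> b _; rewrite big_mkcond (bigD1 a) //= eqxx mulr1 big1 ?addr0 //.
  by move=> c /negPf ca; rewrite ca mulr0 if_same.
rewrite big_mkcond -big_split [RHS]big_mkcond /=; apply: eq_bigr => b _.
rewrite eqxx mul1r /inverted.
by case: (ltngtP a b) => //=; rewrite ?addr0 ?orbF ?add0r.
Qed.

(** Applying a derivation of degree -1 to the a-th factor before or after a
    permutation gives the same sign: a factor b contributes to an even number
    of the three sums over b < a, over s b < s a and over the inversions with
    a. *)
Lemma koszul_insert :
  odd `|(koszul s e' + \sum_(b < n | (b < a)%N) e b)%R|%N =
  odd `|(koszul s e + \sum_(b < n | (s b < s a)%N) e b)%R|%N.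
Proof.
have : \sum_(b | inverted b) e b + \sum_(b < n | (s b < s a)%N) e b +
       \sum_(b < n | (b < a)%N) e b =
       (\sum_(b < n | (b < a)%N || (s b < s a)%N) e b) * 2.
  rewrite ![X in X + _ + _]big_mkcond ![X in _ + X + _]big_mkcond.
  rewrite ![X in _ + X = _]big_mkcond [X in X * _]big_mkcond /=.
  rewrite -!big_split mulr_suml /=; apply: eq_bigr => b _; rewrite /inverted.
  have [ab|ab] := eqVneq a b; first by rewrite -ab !ltnn.
  have sab : s a != s b by rewrite (inj_eq (@perm_inj _ s)).
  have ltN (c d : 'I_n) : c != d -> (c < d)%N = ~~ (d < c)%N.
    by rewrite -val_eqE /=; case: ltngtP.
  rewrite (ltN _ _ ab) (ltN _ _ sab).
  by case: (b < a)%N; case: (s b < s a)%N => /=;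
    rewrite ?mulr_natr ?mulr2n ?add0r ?addr0.
rewrite koszul_lower; lia.
Qed.

End KoszulParity.

Section SquareZero.

Variables (k : fieldType) (P : operad k) (A : grMod k) (S : algStruct P A).

(** The value on mu(x) of the derivation that has the value y_a on x_a, the
    differential of the operad being included. *)
Definition der_act n (mu : P n) (x y : {ffun 'I_n -> A}) : A :=
  al_act S (cc_d mu) x + \sum_(a < n) al_act S (sgn mu) (ins x a (y a)).

(** The extension A[eps]/(eps^2) with eps of degree 1; a pair (x, y) stands for
    x + eps y. *)
Definition epsMod : grMod k := grSum A (grShift A).

Implicit Type z : epsMod.

Definition eps_act n (mu : P n) (z : {ffun 'I_n -> epsMod}) : epsMod :=
  (al_act S mu [ffun a => (z a).1],
   der_act mu [ffun a => (z a).1] [ffun a => (z a).2]).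

Lemma eps_act_multilin n : multilin (@eps_act n).
Proof.
have lf : linear (fun z => z.1 : A) by [].
have ls : linear (fun z => z.2 : A) by [].
have mS := act_multilin S n.
have m1 : multilin (fun (mu : P n) (z : {ffun 'I_n -> epsMod}) =>
    al_act S mu [ffun a => (z a).1]).
  exact: (multilin_comp (u := idfun) (v := fun=> fun z => z.1 : A) mS).
have m2 : multilin (fun (mu : P n) (z : {ffun 'I_n -> epsMod}) =>
    der_act mu [ffun a => (z a).1] [ffun a => (z a).2]).
  apply: multilin_add.
    apply: (multilin_comp (u := @cc_d _ _) (v := fun=> fun z => z.1 : A) mS) => //.
    exact: cc_d_linear.
  apply: multilin_sum => a.
  pose v (b : 'I_n) z : A := if (b < a)%N then sgn z.1 else
    if b == a :> nat then z.2 else z.1.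
  have E (z : {ffun 'I_n -> epsMod}) :
      ins [ffun b => (z b).1] a ([ffun b => (z b).2 : A] a) =
      [ffun b => v b (z b)].
    by apply/ffunP => b; rewrite !ffunE /v; case: ltngtP => // /val_inj ->.
  have := multilin_comp (u := @sgn _ _) (v := v) mS (@sgn_linear _ _).
  move=> /(_ _)[b|ml mr].
    rewrite /v; case: ltngtP => // _.
    exact: (linear_comp lf (@sgn_linear _ _)).
  split=> [z|mu z b c y y']; first by have := ml z; rewrite E.
  by rewrite !E; apply: mr.
case: m1 m2 => [l1 r1] [l2 r2]; split=> [z c mu nu|mu z a c y y'].
  by rewrite /eps_act; congr (_, _); [apply: l1 | apply: l2].
by rewrite /eps_act; congr (_, _); [apply: r1 | apply: r2].
Qed.

Lemma der_act_deg n (mu : P n) (x y : {ffun 'I_n -> A}) q (e : 'I_n -> int) :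
  homog q mu -> (forall a, homog (e a) (x a)) ->
  (forall a, homog (e a - 1) (y a)) ->
  homog (q + \sum_a e a - 1) (der_act mu x y).
Proof.
move=> hmu hx hy; apply: homogD.
  by rewrite addrAC; apply: al_act_deg => //; exact: cc_d_deg.
apply: homog_sum => a _; rewrite -addrA.
have -> : \sum_b e b - 1 = \sum_(b < n) if b == a :> nat then e a - 1 else e b.
  rewrite (bigD1 a) //= [RHS](bigD1 a) //= eqxx addrAC; congr (_ + _).
  by apply: eq_bigr => b /negPf; rewrite -val_eqE /= => ->.
apply: al_act_deg; first exact: homog_sgn.
exact: homog_ins.
Qed.

Lemma eps_act_deg n (mu : P n) (z : {ffun 'I_n -> epsMod}) q (e : 'I_n -> int) :
  homog q mu -> (forall a, homog (e a) (z a)) ->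
  homog (q + \sum_a e a) (eps_act mu z).
Proof.
move=> hmu hz; apply/homog_epsP; split=> /=.
  by apply: al_act_deg => // a; rewrite ffunE; case/homog_epsP: (hz a).
apply: der_act_deg => // a; rewrite ffunE; by case/homog_epsP: (hz a).
Qed.

Lemma eps_act_id (z : {ffun 'I_1 -> epsMod}) : eps_act (op_id P) z = z ord0.
Proof.
rewrite /eps_act /der_act d_op_id sgn_op_id (lin0 (al_act_linearl S _)) add0r.
by rewrite big_ord1 !al_act_id !ffunE /=; case: (z ord0).
Qed.

Lemma op_act_sgn n (s : 'S_n) (mu : P n) : sgn (op_act s mu) = op_act s (sgn mu).
Proof. by rewrite (grLinear_sgn (op_act_grLinear P s)). Qed.

Lemma eps_act_perm n (s : 'S_n) (mu : P n) (z : {ffun 'I_n -> epsMod})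
    (e : 'I_n -> int) :
  (forall a, homog (e a) (z a)) ->
  eps_act (op_act s mu) z =
  (-1) ^ koszul s e *: eps_act mu [ffun a => z (s^-1 a)%g].
Proof.
move=> hz.
set x := [ffun a => (z a).1 : A]; set y := [ffun a => (z a).2 : A].
have hx a : homog (e a) (x a) by rewrite ffunE; case/homog_epsP: (hz a).
have hy a : homog (e a - 1) (y a) by rewrite ffunE; case/homog_epsP: (hz a).
have E1 : [ffun a => ([ffun a => z (s^-1 a)%g] a).1 : A] =
          [ffun a => x (s^-1 a)%g] by apply/ffunP => a; rewrite !ffunE.
have E2 : [ffun a => ([ffun a => z (s^-1 a)%g] a).2 : A] =
          [ffun a => y (s^-1 a)%g] by apply/ffunP => a; rewrite !ffunE.
rewrite /eps_act E1 E2 -/x -/y; apply: injective_projections => /=.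
  exact: al_act_perm.
rewrite /der_act scalerDr op_act_d op_act_sgn (al_act_perm S _ _ hx).
congr (_ + _); rewrite scaler_sumr [RHS](reindex_inj (@perm_inj _ s)) /=.
apply: eq_bigr => a _; rewrite [in RHS]ffunE permK.
have hx' c : homog (e (s^-1 c)%g) ([ffun a => x (s^-1 a)%g] c).
  by rewrite ffunE.
rewrite (ins_sign _ _ (act_multilin S n) (fun b _ => hx b)).
rewrite (ins_sign _ _ (act_multilin S n) (fun b _ => hx' b)) scalerA.
have hxy (b : 'I_n) :
    homog (if b == a :> nat then e a - 1 else e b) (ffupd x a (y a) b).
  by rewrite ffupdE -val_eqE /=; case: eqP => // /val_inj ->.
rewrite (al_act_perm S _ _ hxy) scalerA -!signD.
congr (_ *: _); last first.
  congr (al_act S _ _); apply/ffunP => c; rewrite !ffunE.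
  by rewrite -(inj_eq (@perm_inj _ s)) permKV.
apply: sign_eq; rewrite [in LHS]addrC koszul_insert.
rewrite [X in _ = odd `|(_ + X)%R|%N](reindex_inj (@perm_inj _ s)) /=.
by under [in RHS]eq_bigr => b _ do rewrite permK.
Qed.

Section Composition.

Variables (m n p : nat) (i : 'I_m) (em : (m + n = p.+1)%N).
Variables (mu : P m) (nu : P n).

(** The argument of mu in (mu o_i nu)(x). *)
Definition comb (nu' : P n) (x : {ffun 'I_p -> A}) : {ffun 'I_m -> A} :=
  [ffun a => if a == i then al_act S nu' [ffun b : 'I_n => ffnth x (i + b)]
             else ffnth x (outer i n a)].

Variables (x y : {ffun 'I_p -> A}) (q : int) (e : 'I_p -> int).
Hypotheses (hnu : homog q nu) (hx : forall a, homog (e a) (x a)).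
Hypothesis hy : forall a, homog (e a - 1) (y a).

Let E := \sum_(l < p | (l < i)%N) e l.
Let xmid : {ffun 'I_n -> A} := [ffun b : 'I_n => ffnth x (i + b)].

Let slot_lt (b : 'I_n) : (i + b < p)%N.
Proof. have := ltn_ord i; have := ltn_ord b; lia. Qed.

Let outer_lt (a : 'I_m) : a != i -> (outer i n a < p)%N.
Proof.
rewrite -val_eqE /= /outer => ai; have := ltn_ord i; have := ltn_ord a.
case: ifP; lia.
Qed.

(* the derivation term at a slot l of mu o_i nu *)
Let term_lhs l := al_act S (op_comp i em (sgn mu) (sgn nu)) (ins x l (ffnth y l)).

Let term_lhsE l : (l < p)%N ->
  term_lhs l = (-1) ^ (q * (E - (l < i)%N%:R)) *:
    al_act S (sgn mu) (comb (sgn nu) (ins x l (ffnth y l))).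
Proof.
move=> lp; rewrite /term_lhs.
have hy' : homog (e (Ordinal lp) - 1) (ffnth y l) by rewrite (ffnth_lt _ lp).
rewrite (al_act_comp S i em _ (homog_sgn hnu) (homog_ins l hx hy')).
congr ((-1) ^ (q * _) *: _); rewrite /E.
have [li|li] := ltnP l i.
  rewrite (bigD1 (Ordinal lp)) //= [in RHS](bigD1 (Ordinal lp)) //= eqxx.
  rewrite addrAC; congr (_ + _ - _); apply: eq_bigr => b /andP[_].
  by rewrite -val_eqE /= => /negPf->.
rewrite subr0; apply: eq_bigr => b bi; case: eqP => // bl.
by rewrite bl ltnNge li in bi.
Qed.

Let term_outer (a : 'I_m) : a != i ->
  term_lhs (outer i n a) =
  (-1) ^ (q * E) *:
    al_act S (sgn mu) (ins (comb nu x) a (ffnth y (outer i n a))).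
Proof.
move=> ai; rewrite term_lhsE ?outer_lt //.
have ain : a != i :> nat by rewrite val_eqE.
have li : (outer i n a < i)%N = (a < i)%N by rewrite /outer; case: ifP; lia.
rewrite li; set l := outer i n a in li *.
pose c : k := if (a < i)%N then (-1) ^ q else 1.
have -> : comb (sgn nu) (ins x l (ffnth y l)) =
    ffupd (ins (comb nu x) a (ffnth y l)) i (c *: ins (comb nu x) a (ffnth y l) i).
  apply/ffunP => b; rewrite [LHS]ffunE ffupdE; have [_|bi] := eqVneq b i.
    rewrite [in RHS]ffunE ffunE eqxx.
    have midE (b' : 'I_n) :
        ffnth (ins x l (ffnth y l)) (i + b') =
        if (a < i)%N then xmid b' else sgn (xmid b').
      have b'n := ltn_ord b'; rewrite ffnth_ins // /xmid ffunE.
      have -> : (i + b' < l)%N = ~~ (a < i)%N.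
        by rewrite /l /outer; case: ifP; lia.
      have -> : (i + b' == l)%N = false by rewrite /l /outer; case: ifP; lia.
      by case: (a < i)%N.
    rewrite /c; case: ltngtP ain => // ai' _.
      rewrite (sgn_homog hnu) (linZ (al_act_linearl S _)); congr (_ *: al_act _ _ _).
      by apply/ffunP => b'; rewrite ffunE midE ai'.
    rewrite scale1r act_sgn; congr (al_act _ _ _).
    apply/ffunP => b'; rewrite ffunE midE [RHS]ffunE.
    by have -> : (a < i)%N = false by lia.
  rewrite ffnth_ins ?outer_lt // !ffunE (negPf bi).
  have bin : b != i :> nat by rewrite val_eqE.
  have -> : (outer i n b < l)%N = (b < a)%N.
    rewrite /l /outer; case: ifP; case: ifP; lia.
  have -> // : (outer i n b == l)%N = (b == a :> nat).
  rewrite /l /outer; case: ifP; case: ifP; lia.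
rewrite (linZ (al_act_linearr S _ _ _)) ffupd_id scalerA; congr (_ *: _).
rewrite /c; case: ifP => _; last by rewrite mulr1 subr0.
by rewrite -signD mulrBr mulr1 subrK.
Qed.

Let term_mid (b : 'I_n) :
  term_lhs (i + b) =
  (-1) ^ (q * E) *: al_act S (sgn mu)
    (ins (comb nu x) i (al_act S (sgn nu) (ins xmid b (ffnth y (i + b))))).
Proof.
rewrite term_lhsE ?slot_lt //; have -> : (i + b < i)%N = false by lia.
rewrite subr0; congr (_ *: al_act _ _ _); apply/ffunP => a; rewrite !ffunE.
have [->|ai] := eqVneq a i.
  rewrite ltnn eqxx; congr (al_act _ _ _); apply/ffunP => b'.
  by rewrite ffunE ffnth_ins // /xmid !ffunE ltn_add2l eqn_add2l.
have ain : a != i :> nat by rewrite val_eqE.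
rewrite ffnth_ins ?outer_lt // (negPf ain) /outer.
have [ai'|ai'] := ltnP a i; first by have -> : (a < i + b)%N by lia.
have bn := ltn_ord b.
have -> : ((a + n).-1 < i + b)%N = false by lia.
by have -> : ((a + n).-1 == i + b)%N = false by lia.
Qed.

Let term_d :
  al_act S (op_comp i em (sgn mu) (cc_d nu)) x =
  (-1) ^ (q * E) *:
    al_act S (sgn mu) (ins (comb nu x) i (al_act S (cc_d nu) xmid)).
Proof.
rewrite (al_act_comp S i em _ (cc_d_deg hnu) hx) -/E.
pose d (a : 'I_m) : int := oapp e 0 (insub (a : nat)).
have hd (b : 'I_m) : (b < i)%N -> homog (d b) (comb nu x b).
  move=> bi; have bp : (b < p)%N by have := ltn_ord i; lia.
  rewrite ffunE -val_eqE /= (ltn_eqF bi) /outer bi (ffnth_lt _ bp).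
  by rewrite /d insubT; exact: hx.
rewrite (ins_sign _ _ (act_multilin S m) hd) scalerA.
have -> : \sum_(b < m | (b < i)%N) d b = E.
  pose G (b : nat) : int := oapp e 0 (insub b).
  rewrite /E [LHS](sum_ord_lt G (ltnW (ltn_ord i))).
  rewrite -(sum_ord_lt G (n := p)); last by have := ltn_ord i; lia.
  by apply: eq_bigr => b _; rewrite /G valK.
congr (_ *: _); last first.
  congr (al_act S _ _); apply/ffunP => a; rewrite !ffunE.
  by case: eqP.
rewrite -signD mulrBl mul1r; apply: sign_eq; lia.
Qed.

(** Term by term, the derivative of (mu o_i nu)(x) at a slot of mu is a term of
    the derivative of mu, while its derivatives at the slots of nu, and the one
    of nu itself, add up to the term of the derivative of mu at the slot i. *)
Lemma der_act_comp :
  der_act (op_comp i em mu nu) x y = (-1) ^ (q * E) *: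
    der_act mu (comb nu x)
      [ffun a => if a == i then der_act nu xmid [ffun b : 'I_n => ffnth y (i + b)]
                 else ffnth y (outer i n a)].
Proof.
rewrite {1}/der_act op_comp_d_sgn op_comp_sgn.
rewrite (linD (al_act_linearl S _)) term_d -addrA {1}/der_act scalerDr.
congr (_ + _); first exact: (al_act_comp S i em).
rewrite (eq_bigr (fun l : 'I_p => term_lhs l)); last first.
  by move=> l _; rewrite /term_lhs ffnthE.
rewrite (sum_outer _ i em) [in RHS](bigD1 i) //= ffunE eqxx scalerDr.
rewrite [in LHS]addrCA addrC; congr (_ + _); last first.
  rewrite scaler_sumr; apply: eq_bigr => a ai; rewrite term_outer //.
  by rewrite ffunE (negPf ai).
rewrite (eq_bigr _ (fun b _ => term_mid b)) -scaler_sumr -scalerDr.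
congr (_ *: _); have lins := ins_linear (sgn mu) (comb nu x) i (act_multilin S m).
rewrite [in RHS]/der_act (linD lins) (lin_sum lins); congr (_ + _).
by apply: eq_bigr => b _; rewrite ffunE.
Qed.

End Composition.

Lemma eps_act_comp m n p (i : 'I_m) (em : (m + n = p.+1)%N)
    (mu : P m) (nu : P n) (z : {ffun 'I_p -> epsMod}) q (e : 'I_p -> int) :
  homog q nu -> (forall a, homog (e a) (z a)) ->
  eps_act (op_comp i em mu nu) z =
  (-1) ^ (q * \sum_(l < p | (l < i)%N) e l) *:
    eps_act mu [ffun a : 'I_m =>
      if a == i then eps_act nu [ffun b : 'I_n => ffnth z (i + b)]
      else ffnth z (outer i n a)].
Proof.
move=> hnu hz; pose x := [ffun a => (z a).1 : A]; pose y := [ffun a => (z a).2 : A].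
have hx a : homog (e a) (x a) by rewrite ffunE; case/homog_epsP: (hz a).
have hy a : homog (e a - 1) (y a) by rewrite ffunE; case/homog_epsP: (hz a).
have f1 t : (ffnth z t).1 = ffnth x t by rewrite (ffnth_map _ _ (f := fst)).
have f2 t : (ffnth z t).2 = ffnth y t by rewrite (ffnth_map _ _ (f := snd)).
have E1 : [ffun b : 'I_n => ([ffun b : 'I_n => ffnth z (i + b)] b).1] =
          [ffun b : 'I_n => ffnth x (i + b)].
  by apply/ffunP => b; rewrite !ffunE f1.
have E2 : [ffun b : 'I_n => ([ffun b : 'I_n => ffnth z (i + b)] b).2] =
          [ffun b : 'I_n => ffnth y (i + b)].
  by apply/ffunP => b; rewrite !ffunE f2.
set w := [ffun a : 'I_m => _].
have W1 : [ffun a => (w a).1] = comb i nu x.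
  by apply/ffunP => a; rewrite !ffunE; case: eqP; rewrite //= E1.
have W2 : [ffun a => (w a).2] = [ffun a =>
    if a == i then der_act nu [ffun b : 'I_n => ffnth x (i + b)]
                           [ffun b : 'I_n => ffnth y (i + b)]
    else ffnth y (outer i n a)].
  by apply/ffunP => a; rewrite !ffunE; case: eqP; rewrite //= E1 E2.
rewrite /eps_act W1 W2; apply: injective_projections => /=.
  exact: al_act_comp.
exact: der_act_comp.
Qed.

Definition epsStruct : algStruct P epsMod :=
  AlgStruct (fun n => (eps_act_multilin n).1)
    (fun n => (eps_act_multilin n).2)
    eps_act_deg eps_act_id eps_act_perm eps_act_comp.

End SquareZero.

(** * Free algebras *)

Section FreeAlgebra.

Local Notation rep := generic_quotient.repr.

Variables (k : fieldType) (P : operad k) (I : Type) (V : I -> grMod k).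

(** Formal expressions in the generators; the components of an element are
    among the operations, so that the quotient below is graded. *)
Inductive term : Type :=
  | Tgen i (v : V i)
  | Tzero
  | Tadd (t u : term)
  | Tscale (c : k) (t : term)
  | Tpr (d : int) (t : term)
  | Tact n (mu : P n) (x : 'I_n -> term).

Record valuation (C : grAlg P) := Valuation {
  val_fun :> forall i, V i -> C;
  val_grLinear : forall i, grLinear (@val_fun i) }.

Fixpoint eval (C : grAlg P) (g : valuation C) (t : term) : C :=
  match t with
  | Tgen i v => g i v
  | Tzero => 0
  | Tadd t u => eval g t + eval g u
  | Tscale c t => c *: eval g t
  | Tpr d t => gr_pr d (eval g t)
  | Tact n mu x => al_act C mu [ffun a => eval g (x a)]
  end.

(** Two terms are identified when they have the same value in all the graded
    algebras.  This impredicative relation is compatible with the operations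
    and validates the axioms of algebras at once. *)
Definition equiv_term (t u : term) : bool :=
  `[< forall (C : grAlg P) (g : valuation C), eval g t = eval g u >].

HB.instance Definition _ := gen_eqMixin term.
HB.instance Definition _ := gen_choiceMixin term.

Lemma equiv_term_refl : reflexive equiv_term.
Proof. by move=> t; apply/asboolP. Qed.

Lemma equiv_term_sym : symmetric equiv_term.
Proof.
by move=> t u; apply/asboolP/asboolP => tu C g; rewrite tu.
Qed.

Lemma equiv_term_trans : transitive equiv_term.
Proof.
move=> u t v /asboolP tu /asboolP uv; apply/asboolP => C g.
by rewrite tu uv.
Qed.

Canonical equiv_term_rel :=
  EquivRel equiv_term equiv_term_refl equiv_term_sym equiv_term_trans.

Definition freeT := {eq_quot equiv_term}%qT.

HB.instance Definition _ := Choice.on freeT.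

Definition toFree (t : term) : freeT := \pi_freeT%qT t.

Definition feval (C : grAlg P) (g : valuation C) (x : freeT) : C :=
  eval g (rep x).

Lemma feval_pi (C : grAlg P) (g : valuation C) t : feval g (toFree t) = eval g t.
Proof.
rewrite /feval /toFree; have := reprK (\pi_freeT%qT t).
by move=> /eqmodP/asboolP.
Qed.

Lemma eval_rep (C : grAlg P) (g : valuation C) t :
  eval g (rep (toFree t)) = eval g t.
Proof. exact: feval_pi. Qed.

Lemma feval_ext (x y : freeT) :
  (forall (C : grAlg P) (g : valuation C), feval g x = feval g y) -> x = y.
Proof.
by move=> xy; rewrite -[x]reprK -[y]reprK; apply/eqmodP/asboolP.
Qed.

Definition fzero := toFree Tzero.
Definition fadd (x y : freeT) := toFree (Tadd (rep x) (rep y)).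
Definition fopp (x : freeT) := toFree (Tscale (-1) (rep x)).
Definition fscale c (x : freeT) := toFree (Tscale c (rep x)).
Definition fpr d (x : freeT) := toFree (Tpr d (rep x)).

Lemma faddA : associative fadd.
Proof. by move=> x y z; apply: feval_ext => C g; rewrite !feval_pi /= !eval_rep addrA. Qed.

Lemma faddC : commutative fadd.
Proof. by move=> x y; apply: feval_ext => C g; rewrite !feval_pi /= addrC. Qed.

Lemma fadd0 : left_id fzero fadd.
Proof. by move=> x; apply: feval_ext => C g; rewrite feval_pi /= eval_rep add0r. Qed.

Lemma faddN : left_inverse fzero fopp fadd.
Proof.
by move=> x; apply: feval_ext => C g; rewrite !feval_pi /= eval_rep /= scaleN1r addNr.
Qed.

HB.instance Definition _ := GRing.isZmodule.Build freeT faddA faddC fadd0 faddN.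

Lemma feval0 (C : grAlg P) (g : valuation C) : feval g 0 = 0.
Proof. exact: feval_pi. Qed.

Lemma fevalD (C : grAlg P) (g : valuation C) x y :
  feval g (x + y) = feval g x + feval g y.
Proof. exact: feval_pi. Qed.

Lemma fscaleA a b x : fscale a (fscale b x) = fscale (a * b) x.
Proof. by apply: feval_ext => C g; rewrite !feval_pi /= eval_rep scalerA. Qed.

Lemma fscale1 : left_id 1 fscale.
Proof. by move=> x; apply: feval_ext => C g; rewrite feval_pi /= scale1r. Qed.

Lemma fscaleDr : right_distributive fscale +%R.
Proof.
move=> c x y; apply: feval_ext => C g.
by rewrite fevalD !feval_pi /= eval_rep /= scalerDr.
Qed.

Lemma fscaleDl x : {morph fscale^~ x : a b / a + b}.
Proof.
move=> a b; apply: feval_ext => C g.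
by rewrite fevalD !feval_pi /= scalerDl.
Qed.

HB.instance Definition _ :=
  GRing.Zmodule_isLmodule.Build k freeT fscaleA fscale1 fscaleDr fscaleDl.

Lemma fevalZ (C : grAlg P) (g : valuation C) c x :
  feval g (c *: x) = c *: feval g x.
Proof. exact: feval_pi. Qed.

Lemma feval_linear (C : grAlg P) (g : valuation C) : linear (feval g).
Proof. by move=> c x y; rewrite fevalD fevalZ. Qed.

Lemma feval_pr (C : grAlg P) (g : valuation C) d x :
  feval g (fpr d x) = gr_pr d (feval g x).
Proof. exact: feval_pi. Qed.

Lemma fpr_linear d : linear (fpr d).
Proof.
move=> c x y; apply: feval_ext => C g.
by rewrite fevalD fevalZ !feval_pr fevalD fevalZ prD prZ.
Qed.

Lemma fpr_pr i j x : fpr i (fpr j x) = if i == j then fpr j x else 0.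
Proof.
apply: feval_ext => C g; rewrite !feval_pr gr_pr_pr.
by case: eqP; rewrite ?feval_pr ?feval0.
Qed.

(** An element of the quotient has finitely many components because this bound
    does not depend on the valuation. *)
Lemma eval_bounded t : exists B, forall (C : grAlg P) (g : valuation C),
  bounded B (eval g t).
Proof.
elim: t => [i v||t [B tB] u [B' uB']|c t [B tB]|d t [B tB]|n mu x IHx] /=.
- have [B vB] := bounded_exists v; exists B => C g j jB.
  by rewrite -(grLinear_pr (val_grLinear g i)) vB // (lin0 (val_grLinear g i).1).
- by exists 0%N => C g j _; exact: gr_pr0.
- exists (B + B')%N => C g j jB; rewrite prD tB ?uB' ?addr0 //; lia.
- by exists B => C g j jB; rewrite prZ tB ?scaler0.
- exists B => C g j jB; rewrite gr_pr_pr; case: eqP => // <-.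
  by rewrite tB.
have [Bx xB] := choice IHx; have [B0 muB] := bounded_exists mu.
pose B := (B0 + \sum_a Bx a)%N.
exists (B + n * B)%N => C g j jB.
have mS := act_multilin C n.
apply: (multilin_ind (Q := fun y => gr_pr j y = 0) (B := B) mS).
- exact: gr_pr0.
- by move=> y z yj zj; rewrite prD yj zj addr0.
- by apply: boundedW muB; rewrite /B; lia.
- move=> a; rewrite ffunE; apply: boundedW (xB a C g).
  by rewrite /B (bigD1 a) //=; lia.
move=> q e qB eB; set y := al_act _ _ _.
have hy : homog (q + \sum_a e a) y.
  by apply: al_act_deg => [|a]; rewrite ?ffunE; exact: homog_pr.
rewrite (pr_homog _ hy); case: eqP => // jE; exfalso.
have : (`|(\sum_a e a)%R| <= n * B)%N.
  have -> : (n * B = \sum_(a < n) B)%N by rewrite sum_nat_const card_ord.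
  elim/big_ind2: _ => // e1 b1 e2 b2; lia.
lia.
Qed.

Lemma fpr_sum x : exists2 s : seq int, uniq s & x = \sum_(i <- s) fpr i x.
Proof.
have [B xB] := eval_bounded (rep x); exists (degs B); first exact: undup_uniq.
apply: feval_ext => C g; rewrite (lin_sum (feval_linear g)).
rewrite [LHS](bounded_sum (xB C g)); apply: eq_bigr => i _.
by rewrite feval_pr.
Qed.

Definition freeMod : grMod k := GrMod fpr_linear fpr_pr fpr_sum.

Lemma feval_grLinear (C : grAlg P) (g : valuation C) :
  grLinear (feval g : freeMod -> C).
Proof.
split=> [|i x hx]; first exact: feval_linear.
by rewrite /homog -feval_pr -[in RHS]hx.
Qed.

Definition fact n (mu : P n) (x : {ffun 'I_n -> freeMod}) : freeMod :=
  toFree (Tact mu (fun a => rep (x a))).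

Lemma feval_act (C : grAlg P) (g : valuation C) n (mu : P n) x :
  feval g (fact mu x) = al_act C mu [ffun a => feval g (x a)].
Proof. exact: feval_pi. Qed.

Lemma feval_upd (C : grAlg P) (g : valuation C) n (x : {ffun 'I_n -> freeMod}) a y :
  [ffun b => feval g (ffupd x a y b)] =
  ffupd [ffun b => feval g (x b)] a (feval g y).
Proof. by apply/ffunP => b; rewrite !ffunE; case: eqP. Qed.

Lemma homog_feval (C : grAlg P) (g : valuation C) n (e : 'I_n -> int)
    (x : {ffun 'I_n -> freeMod}) :
  (forall a, homog (e a) (x a)) ->
  forall a, homog (e a) ([ffun a => feval g (x a)] a).
Proof. by move=> hx a; rewrite ffunE; apply: (feval_grLinear g).2. Qed.

Lemma fact_linearl n (x : {ffun 'I_n -> freeMod}) :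
  linear (fun mu : P n => fact mu x).
Proof.
move=> c mu nu; apply: feval_ext => C g.
by rewrite fevalD fevalZ !feval_act al_act_linearl.
Qed.

Lemma fact_linearr n (mu : P n) (x : {ffun 'I_n -> freeMod}) (a : 'I_n) :
  linear (fun y => fact mu (ffupd x a y)).
Proof.
move=> c y z; apply: feval_ext => C g.
by rewrite fevalD fevalZ !feval_act !feval_upd fevalD fevalZ al_act_linearr.
Qed.

Lemma fact_deg n (mu : P n) (x : {ffun 'I_n -> freeMod}) q (e : 'I_n -> int) :
  homog q mu -> (forall a, homog (e a) (x a)) ->
  homog (q + \sum_a e a) (fact mu x).
Proof.
move=> hmu hx; apply: feval_ext => C g; rewrite feval_pr feval_act.
by rewrite (al_act_deg C hmu (homog_feval g hx)).
Qed.

Lemma fact_id (x : {ffun 'I_1 -> freeMod}) : fact (op_id P) x = x ord0.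
Proof.
by apply: feval_ext => C g; rewrite feval_act al_act_id ffunE.
Qed.

Lemma fact_perm n (s : 'S_n) (mu : P n) (x : {ffun 'I_n -> freeMod})
    (e : 'I_n -> int) :
  (forall a, homog (e a) (x a)) ->
  fact (op_act s mu) x =
  (-1) ^ koszul s e *: fact mu [ffun a => x (s^-1 a)%g].
Proof.
move=> hx; apply: feval_ext => C g; rewrite fevalZ !feval_act.
rewrite (al_act_perm C _ _ (homog_feval g hx)); congr (_ *: al_act C _ _).
by apply/ffunP => a; rewrite !ffunE.
Qed.

Lemma feval_nth (C : grAlg P) (g : valuation C) n (x : {ffun 'I_n -> freeMod}) l :
  feval g (ffnth x l) = ffnth [ffun a => feval g (x a)] l.
Proof. by apply: (ffnth_map (f := feval g)); exact: feval0. Qed.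

Lemma fact_comp m n p (i : 'I_m) (em : (m + n = p.+1)%N)
    (mu : P m) (nu : P n) (x : {ffun 'I_p -> freeMod}) q (e : 'I_p -> int) :
  homog q nu -> (forall a, homog (e a) (x a)) ->
  fact (op_comp i em mu nu) x =
  (-1) ^ (q * \sum_(l < p | (l < i)%N) e l) *:
    fact mu [ffun a : 'I_m =>
      if a == i then fact nu [ffun b : 'I_n => ffnth x (i + b)]
      else ffnth x (outer i n a)].
Proof.
move=> hnu hx; apply: feval_ext => C g; rewrite fevalZ !feval_act.
rewrite (al_act_comp C i em _ hnu (homog_feval g hx)); congr (_ *: al_act C _ _).
apply/ffunP => a; rewrite !ffunE (fun_if (feval g)) feval_act !feval_nth.
congr (if _ then al_act C _ _ else _); apply/ffunP => b.
by rewrite !ffunE feval_nth.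
Qed.

Definition freeStruct : algStruct P freeMod :=
  AlgStruct fact_linearl fact_linearr fact_deg fact_id fact_perm fact_comp.

Definition freeAlg : grAlg P := GrAlg freeStruct.

Definition fgen i (v : V i) : freeAlg := toFree (Tgen v).

Lemma fgen_grLinear i : grLinear (@fgen i).
Proof.
split=> [c v w|d v hv]; apply: feval_ext => C g.
  by rewrite fevalD fevalZ !feval_pi /=; apply: (val_grLinear g i).1.
rewrite feval_pr feval_pi /= -(grLinear_pr (val_grLinear g i)).
by rewrite hv.
Qed.

Lemma feval_hom (C : grAlg P) (g : valuation C) :
  is_grAlgHom (feval g : freeAlg -> C).
Proof.
split; first exact: feval_grLinear.
by move=> n mu x; exact: feval_act.
Qed.

(** Every element is represented by a term, so that induction on terms gives the
    fact that the free algebra has no proper subalgebra containing V. *)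
Lemma free_ind (Q : freeAlg -> Prop) :
  (forall i (v : V i), Q (fgen v)) -> Q 0 ->
  (forall x y, Q x -> Q y -> Q (x + y)) -> (forall c x, Q x -> Q (c *: x)) ->
  (forall d x, Q x -> Q (gr_pr d x)) ->
  (forall n (mu : P n) (x : {ffun 'I_n -> freeAlg}),
     (forall a, Q (x a)) -> Q (al_act freeAlg mu x)) ->
  forall x, Q x.
Proof.
move=> Qgen Q0 QD QZ Qpr Qact x; rewrite -[x]reprK.
have QE (t : term) (y : freeAlg) : Q (toFree t) ->
    (forall (C : grAlg P) (g : valuation C), feval g y = eval g t) -> Q y.
  move=> Qt yt; suff -> : y = toFree t by [].
  by apply: feval_ext => C g; rewrite yt feval_pi.
elim: (rep x) => {x} [i v||t Qt u Qu|c t Qt|d t Qt|n mu y Qy].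
- exact: Qgen.
- exact: Q0.
- have -> : \pi_freeT%qT (Tadd t u) = (toFree t + toFree u :> freeAlg); last exact: QD.
  by apply: feval_ext => C g; rewrite fevalD !feval_pi.
- have -> : \pi_freeT%qT (Tscale c t) = (c *: toFree t :> freeAlg); last exact: QZ.
  by apply: feval_ext => C g; rewrite fevalZ !feval_pi.
- have -> : \pi_freeT%qT (Tpr d t) = (gr_pr d (toFree t : freeAlg)); last exact: Qpr.
  by apply: feval_ext => C g; rewrite feval_pr !feval_pi.
have -> : \pi_freeT%qT (Tact mu y) =
          al_act freeAlg mu [ffun a => toFree (y a) : freeAlg].
  apply: feval_ext => C g; rewrite feval_act !feval_pi /=.
  by congr (al_act C _ _); apply/ffunP => a; rewrite !ffunE feval_pi.
by apply: Qact => a; rewrite ffunE.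
Qed.

End FreeAlgebra.

(** * Derivations of free algebras *)

Section Homs.

Variables (k : fieldType) (P : operad k).

Record subalg (M : grAlg P) (Q : M -> Prop) : Prop := Subalg {
  subalg0 : Q 0;
  subalgD : forall x y, Q x -> Q y -> Q (x + y);
  subalgZ : forall c x, Q x -> Q (c *: x);
  subalg_pr : forall d x, Q x -> Q (gr_pr d x);
  subalg_act : forall n (mu : P n) (x : {ffun 'I_n -> M}),
    (forall a, Q (x a)) -> Q (al_act M mu x) }.

Definition generates (M : grAlg P) (G : M -> Prop) : Prop :=
  forall Q, subalg Q -> (forall x, G x -> Q x) -> forall x, Q x.

(** Freeness on a family of graded modules, that is, on their direct sum. *)
Definition is_free_family (I : Type) (V : I -> grMod k) (M : grAlg P)
    (gen : forall i, V i -> M) : Prop :=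
  (forall i, grLinear (@gen i)) /\
  forall (C : grAlg P) (g : forall i, V i -> C), (forall i, grLinear (@g i)) ->
    exists h : M -> C,
      [/\ is_grAlgHom h, forall i v, h (gen i v) = g i v
        & forall h' : M -> C, is_grAlgHom h' ->
            (forall i v, h' (gen i v) = g i v) -> forall x, h' x = h x].

Lemma is_free_familyP (V : grMod k) (M : grAlg P) (gen : unit -> V -> M) :
  is_free (gen tt) <-> is_free_family (V := fun=> V) gen.
Proof.
split=> [[gi univ]|[gi univ]]; split=> [|C g gg]; [by case| |exact: gi|].
- have [h [hh hi hu]] := univ C (g tt) (gg tt); exists h; split=> // [[]|] //.
  by move=> h' hh' hi'; apply: hu => // v; apply: (hi' tt).
- have [h [hh hi hu]] := univ C (fun=> g) (fun=> gg); exists h; split=> //.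
  by move=> h' hh' hi'; apply: hu => // -[].
Qed.

Lemma is_free_unit (V : grMod k) (M : grAlg P) (iota : V -> M) :
  is_free iota -> is_free_family (V := fun=> V) (fun _ : unit => iota).
Proof. by move=> freeM; apply/is_free_familyP. Qed.

Lemma hom_id (M : grAlg P) : is_grAlgHom (@idfun M).
Proof.
split=> // n mu x /=; congr (al_act M _ _).
by apply/ffunP => a; rewrite ffunE.
Qed.

Lemma hom_comp (M N C : grAlg P) (f : M -> N) (g : N -> C) :
  is_grAlgHom f -> is_grAlgHom g -> is_grAlgHom (fun x => g (f x)).
Proof.
move=> [gf fact] [gg gact]; split; first exact: grLinear_comp gf gg.
move=> n mu x; rewrite fact gact; congr (al_act C _ _).
by apply/ffunP => a; rewrite !ffunE.
Qed.

Lemma free_family_hom_ext (I : Type) (V : I -> grMod k) (M C : grAlg P)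
    (gen : forall i, V i -> M) (f g : M -> C) :
  is_free_family gen -> is_grAlgHom f -> is_grAlgHom g ->
  (forall i v, f (gen i v) = g (gen i v)) -> forall x, f x = g x.
Proof.
move=> [ggen univ] hf hg fg x.
have [|h [_ _ hu]] := univ C (fun i v => g (gen i v)).
  by move=> i; apply: grLinear_comp (ggen i) hg.1.
by rewrite (hu f) // (hu g).
Qed.

Lemma free_is_free_family (I : Type) (V : I -> grMod k) :
  is_free_family (M := freeAlg P V) (@fgen k P I V).
Proof.
split=> [i|C g gg]; first exact: fgen_grLinear.
exists (feval (Valuation gg)); split=> [|i v|h' [gh' act_h'] h'g].
- exact: feval_hom.
- exact: feval_pi.
pose val' := Valuation gg.
apply: (free_ind (Q := fun x => h' x = feval val' x)).
- by move=> i v; rewrite h'g feval_pi.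
- by rewrite (lin0 gh'.1) feval0.
- by move=> x y hx hy; rewrite (linD gh'.1) fevalD hx hy.
- by move=> c x hx; rewrite (linZ gh'.1) fevalZ hx.
- by move=> d x hx; rewrite (grLinear_pr gh') (grLinear_pr (feval_grLinear _)) hx.
move=> n mu x hx; rewrite act_h' feval_act; congr (al_act C _ _).
by apply/ffunP => a; rewrite !ffunE hx.
Qed.

Lemma free_family_generates (I : Type) (V : I -> grMod k) (M : grAlg P)
    (gen : forall i, V i -> M) :
  is_free_family gen -> generates (fun x => exists i v, x = gen i v).
Proof.
move=> freeM Q [Q0 QD QZ Qpr Qact] Qgen x; have [ggen univ] := freeM.
(* M is a retract of the algebra of terms, where induction is available *)
have [h [hh hgen _]] := univ (freeAlg P V) (@fgen k P I V) (@fgen_grLinear k P I V).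
have [_ univF] := free_is_free_family V.
have [g [hg ggen' _]] := univF M gen ggen.
have <- : g (h x) = x.
  apply: (free_family_hom_ext freeM (hom_comp hh hg) (hom_id M)) => i v.
  by rewrite hgen ggen'.
apply: (free_ind (Q := fun y => Q (g y))) (h x).
- by move=> i v; rewrite ggen'; apply: Qgen; exists i, v.
- by rewrite (lin0 hg.1.1).
- by move=> y z Qy Qz; rewrite (linD hg.1.1); apply: QD.
- by move=> c y Qy; rewrite (linZ hg.1.1); apply: QZ.
- by move=> d y Qy; rewrite (grLinear_pr hg.1); apply: Qpr.
by move=> n mu y Qy; rewrite hg.2; apply: Qact => a; rewrite ffunE.
Qed.

End Homs.

Section Derivations.

Variables (k : fieldType) (P : operad k).

Definition epsAlg (C : grAlg P) : grAlg P := GrAlg (epsStruct C).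

(** Derivations of degree -1 along h, in the sense of algebras over a
    differential graded operad: [der_act] contains the term (d mu)(h x). *)
Definition is_der (M C : grAlg P) (h D : M -> C) : Prop :=
  [/\ linear D, forall i x, homog i x -> homog (i - 1) (D x)
    & forall n (mu : P n) (x : {ffun 'I_n -> M}),
        D (al_act M mu x) =
        der_act C mu [ffun a => h (x a)] [ffun a => D (x a)]].

(** A derivation is the second component of a morphism to the square-zero
    extension, so that free algebras determine derivations on generators. *)
Lemma der_hom (M C : grAlg P) (h D : M -> C) : is_grAlgHom h -> is_der h D ->
  is_grAlgHom (fun x => (h x, D x) : epsAlg C).
Proof.
move=> [[lh dh] acth] [lD dD actD]; split; first split=> [c x y|i x hx].
- by rewrite lh lD.
- by apply/homog_epsP; split; [exact: dh | exact: dD].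
move=> n mu x; rewrite acth actD /= /eps_act.
have -> : [ffun a => ([ffun a => (h (x a), D (x a)) : epsAlg C] a).1 : C] =
          [ffun a => h (x a)] by apply/ffunP => a; rewrite !ffunE.
have -> // : [ffun a => ([ffun a => (h (x a), D (x a)) : epsAlg C] a).2 : C] =
          [ffun a => D (x a)] by apply/ffunP => a; rewrite !ffunE.
Qed.

Lemma fst_hom (C : grAlg P) : is_grAlgHom (fun z : epsAlg C => z.1 : C).
Proof. by split; [split=> // i z /homog_epsP[] | ]. Qed.

Lemma hom_der (M C : grAlg P) (h : M -> epsAlg C) : is_grAlgHom h ->
  is_der (fun x => (h x).1) (fun x => (h x).2).
Proof.
move=> [[lh dh] acth]; split=> [c x y|i x /dh/homog_epsP[] //|n mu x].
  by rewrite lh.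
rewrite acth /=; congr (der_act C _ _ _).
  by apply/ffunP => a; rewrite !ffunE.
by apply/ffunP => a; rewrite !ffunE.
Qed.

Lemma der_unique (I : Type) (V : I -> grMod k) (M C : grAlg P)
    (gen : forall i, V i -> M) (h D D' : M -> C) :
  is_free_family gen -> is_grAlgHom h -> is_der h D -> is_der h D' ->
  (forall i v, D (gen i v) = D' (gen i v)) -> forall x, D x = D' x.
Proof.
move=> freeM hh derD derD' DD' x.
have E := free_family_hom_ext freeM (der_hom hh derD) (der_hom hh derD').
apply: (congr1 (fun z : epsAlg C => z.2 : C) (E _ x)) => i v.
by rewrite DD'.
Qed.

Lemma der_exists (I : Type) (V : I -> grMod k) (M : grAlg P)
    (gen : forall i, V i -> M) (d0 : forall i, V i -> M) :
  is_free_family gen -> (forall i, linear (@d0 i)) ->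
  (forall i j v, homog j v -> homog (j - 1) (d0 i v)) ->
  exists D : M -> M, is_der idfun D /\ forall i v, D (gen i v) = d0 i v.
Proof.
move=> freeM ld0 dd0; have [ggen univ] := freeM.
have [|h [hh hgen _]] := univ (epsAlg M) (fun i v => (gen i v, d0 i v)).
  move=> i; split=> [c v w|j v hv]; first by rewrite (ggen i).1 ld0.
  by apply/homog_epsP; split; [exact: (ggen i).2 | exact: dd0].
have h1 x : (h x).1 = x.
  apply: (free_family_hom_ext freeM (hom_comp hh (fst_hom M)) (hom_id M)) => i v.
  by rewrite hgen.
exists (fun x => (h x).2); split=> [|i v]; last by rewrite hgen.
by have := hom_der hh; have -> : (fun x => (h x).1) = idfun by apply: funext.
Qed.

Lemma hom_ins (M N : grAlg P) (f : M -> N) n (x : {ffun 'I_n -> M}) a y :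
  is_grAlgHom f ->
  [ffun b => f (ins x a y b)] = ins [ffun b => f (x b)] a (f y).
Proof.
move=> hf; apply/ffunP => b; rewrite !ffunE -(grLinear_sgn hf.1).
by case: ltngtP.
Qed.

Lemma hom_der_act (M N : grAlg P) (f : M -> N) n (mu : P n)
    (x y : {ffun 'I_n -> M}) : is_grAlgHom f ->
  f (der_act M mu x y) = der_act N mu [ffun a => f (x a)] [ffun a => f (y a)].
Proof.
move=> hf; rewrite /der_act (linD hf.1.1) (lin_sum hf.1.1) hf.2.
congr (_ + _); apply: eq_bigr => a _; rewrite hf.2; congr (al_act N _ _).
by rewrite hom_ins // ffunE.
Qed.

Lemma der_post (M N C : grAlg P) (h D : M -> N) (f : N -> C) :
  is_grAlgHom f -> is_der h D -> is_der (fun x => f (h x)) (fun x => f (D x)).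
Proof.
move=> hf [lD dD actD]; split=> [|i x hx|n mu x].
- exact: linear_comp lD hf.1.1.
- exact/hf.1.2/dD.
rewrite actD hom_der_act //; congr (der_act C _ _ _).
  by apply/ffunP => a; rewrite !ffunE.
by apply/ffunP => a; rewrite !ffunE.
Qed.

Lemma der_pre (M N C : grAlg P) (h D : N -> C) (f : M -> N) :
  is_grAlgHom f -> is_der h D -> is_der (fun x => h (f x)) (fun x => D (f x)).
Proof.
move=> hf [lD dD actD]; split=> [|i x hx|n mu x].
- exact: linear_comp hf.1.1 lD.
- exact/dD/hf.1.2.
rewrite hf.2 actD; congr (der_act C _ _ _).
  by apply/ffunP => a; rewrite !ffunE.
by apply/ffunP => a; rewrite !ffunE.
Qed.

Lemma der_act_sign (A : grMod k) (S : algStruct P A) n (mu : P n)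
    (x y : {ffun 'I_n -> A}) q (e : 'I_n -> int) :
  homog q mu -> (forall a, homog (e a) (x a)) ->
  der_act S mu x y = al_act S (cc_d mu) x +
    \sum_(a < n) (-1) ^ (q + \sum_(b < n | (b < a)%N) e b) *:
      al_act S mu (ffupd x a (y a)).
Proof.
move=> hmu hx; congr (_ + _); apply: eq_bigr => a _.
rewrite (ins_sign _ _ (act_multilin S n) (fun b _ => hx b)) (sgn_homog hmu).
by rewrite (linZ (al_act_linearl S _)) scalerA -signD addrC.
Qed.

(** The homogeneous Leibniz rule of a differential graded algebra extends to all
    elements, both sides being multilinear in the form with degree
    involutions. *)
Lemma dg_der (A : dgAlg P) :
  is_der (M := dg_grAlg A) (C := dg_grAlg A) idfun (@cc_d _ A).
Proof.
split=> [|i x hx|n]; [exact: cc_d_linear | exact: cc_d_deg |].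
have mS := act_multilin A n.
apply: (multilin_ext (Phi := fun (mu : P n) x => cc_d (al_act A mu x))
  (Psi := fun mu x => der_act A mu [ffun a => x a] [ffun a => cc_d (x a)])).
- exact: multilin_post mS (@cc_d_linear _ _).
- have := multilin_comp (u := idfun) (v := fun=> fun x : A => (x, cc_d x) : epsMod A)
    (eps_act_multilin A n).
  have lpair (a : 'I_n) : linear (fun x : A => (x, cc_d x) : epsMod A).
    by move=> c x y; rewrite cc_d_linear.
  move=> /(_ (@linear_idf _ _) lpair) mpair.
  have [//|ml mr] := multilin_post (w := fun z : epsMod A => z.2 : A) mpair.
  have E (mu : P n) (x : {ffun 'I_n -> A}) :
      (eps_act A mu [ffun a => (x a, cc_d (x a)) : epsMod A]).2 =
      der_act A mu [ffun a => x a] [ffun a => cc_d (x a)].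
    rewrite /=; congr (der_act A _ _ _).
      by apply/ffunP => a; rewrite !ffunE.
    by apply/ffunP => a; rewrite !ffunE.
  split=> [x c mu nu|mu x a c y z]; first by rewrite -!E; apply: ml.
  by rewrite -!E; apply: mr.
move=> q e mu x hmu hx; rewrite (dg_act_d hmu hx).
have -> : [ffun a => x a] = x by apply/ffunP => a; rewrite ffunE.
rewrite (der_act_sign A _ hmu hx); congr (_ + _).
by apply: eq_bigr => a _; rewrite ffunE.
Qed.

(** For distinct slots a and b, the terms of D(D(mu(x))) where D is applied to
    x_a and to x_b appear twice, with opposite signs. *)
Lemma der_sqr (M : grAlg P) (D : M -> M) (G : M -> Prop) :
  is_der idfun D -> generates G -> (forall x, G x -> D (D x) = 0) ->
  forall x, D (D x) = 0.
Proof.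
move=> [lD dD actD] genM DG; apply: (genM (fun x => D (D x) = 0)) => //.
split=> [|x y Dx Dy|c x Dx|d x Dx|n mu x Dx].
- by rewrite !(lin0 lD).
- by rewrite !(linD lD) Dx Dy addr0.
- by rewrite !(linZ lD) Dx scaler0.
- by rewrite !(homog_imageP lD dD) Dx gr_pr0.
have sD y : D (sgn y) = - sgn (D y) by exact: sgn_degN1.
have idE (y : {ffun 'I_n -> M}) : [ffun a => idfun (y a)] = y.
  by apply/ffunP => a; rewrite ffunE.
have mM := act_multilin M n.
rewrite actD idE /der_act (linD lD) (lin_sum lD) actD idE /der_act cc_dd.
rewrite (lin0 (al_act_linearl M _)) add0r.
pose xD (a : 'I_n) := ins x a (D (x a)).
pose T (a b : 'I_n) := al_act M mu (ins (xD a) b (D (xD a b))).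
have termE (a : 'I_n) :
    D (al_act M (sgn mu) (ins x a ([ffun a => D (x a)] a))) =
    - al_act M (sgn (cc_d mu)) (xD a) + \sum_(b < n | b != a) T a b.
  rewrite ffunE -/(xD a) actD idE /der_act d_sgn (linN (al_act_linearl M _)).
  congr (_ + _); rewrite (bigD1 a) //= sgnK ffunE.
  rewrite (multilin_zero (a := a) _ mM) ?add0r.
    by apply: eq_bigr => b _; rewrite ffunE.
  by rewrite !ffunE ltnn eqxx Dx.
rewrite (eq_bigr _ (fun a _ => termE a)) big_split /= addrA.
rewrite sumrN; set s := (X in X - _); set s' := (X in _ - X).
have -> : s = s' by apply: eq_bigr => a _; rewrite ffunE.
rewrite subrr add0r {s s'}.
have Tanti (a b : 'I_n) : (b < a)%N -> T a b = - T b a.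
  move=> ba; rewrite /T /xD !ffunE ba.
  have -> : (a < b)%N = false by lia.
  have -> : (a == b :> nat) = false by lia.
  rewrite sD (linN (ins_linear _ _ _ mM)); congr (- al_act M _ _).
  apply/ffunP => c; rewrite !ffunE.
  have [cb|bc|cb] := ltngtP c b.
  - by have -> : (c < a)%N by lia.
  - by case: ltngtP.
  - by have -> : (c < a)%N by lia.
have split_ab (a : 'I_n) : \sum_(b < n | b != a) T a b =
    \sum_(b < n | (b < a)%N) T a b + \sum_(b < n | (a < b)%N) T a b.
  rewrite (bigID (fun b : 'I_n => (b < a)%N)) /=; congr (_ + _).
    by apply: eq_bigl => b; rewrite -val_eqE /=; case: ltngtP.
  by apply: eq_bigl => b; rewrite -val_eqE /=; case: ltngtP.
rewrite (eq_bigr _ (fun a _ => split_ab a)) big_split /=.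
rewrite [X in _ + X](exchange_big_dep predT) //= -big_split big1 // => a _.
rewrite -big_split big1 //= => b ba.
by rewrite (Tanti _ _ ba) addNr.
Qed.

Lemma der_homog (G : grMod k) (S : algStruct P G) (D : G -> G) :
  is_der (M := GrAlg S) (C := GrAlg S) idfun D ->
  forall n (mu : P n) (x : {ffun 'I_n -> G}) q (e : 'I_n -> int),
  homog q mu -> (forall a, homog (e a) (x a)) ->
  D (al_act S mu x) = al_act S (cc_d mu) x +
    \sum_(a < n) (-1) ^ (q + \sum_(b < n | (b < a)%N) e b) *:
      al_act S mu (ffupd x a (D (x a))).
Proof.
move=> [_ _ actD] n mu x q e hmu hx; rewrite actD.
have -> : [ffun a => idfun (x a)] = x by apply/ffunP => a; rewrite ffunE.
rewrite (der_act_sign S _ hmu hx); congr (_ + _).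
by apply: eq_bigr => a _; rewrite ffunE.
Qed.

End Derivations.

(** * KS-extensions *)

Section KSExtensions.

Variables (k : fieldType) (P : operad k).

Lemma dgHom_grLinear (M N : dgAlg P) (f : M -> N) : is_dgAlgHom f -> grLinear f.
Proof. by case=> [[]]. Qed.

(** Two derivations along a morphism are compared on generators. *)
Lemma free_family_dgHom (I : Type) (V : I -> grMod k) (M C : dgAlg P)
    (gen : forall i, V i -> M) (f : M -> C) :
  is_free_family (M := dg_grAlg M) gen ->
  is_grAlgHom (A := dg_grAlg M) (B := dg_grAlg C) f ->
  (forall i v, f (cc_d (gen i v)) = cc_d (f (gen i v))) -> is_dgAlgHom f.
Proof.
move=> freeM hf fd; split=> //; apply: (der_unique freeM hf) => //.
  exact: (der_post hf (dg_der M)).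
exact: (der_pre hf (dg_der C)).
Qed.

Section Construction.

Variables (V V' : grMod k) (A : dgAlg P) (iota : V -> A) (n : int).
Variable (del : V' -> A).
Hypotheses (n_gt0 : 0 < n) (V'n : forall v : V', homog n v).
Hypotheses (ldel : linear del) (cdel : forall v, Defs.cycle (n - 1) (del v)).
Hypothesis freeA : is_free (A := dg_grAlg A) iota.

(** The differential is the derivation with value j(d v) on V and j(del v) on
    V'; on the image of A it agrees with j d, as both are derivations along j,
    and it squares to zero because it does on generators. *)
Lemma KSext_exists : exists (B : dgAlg P) (j : A -> B) (eta : V' -> B),
  is_KSext iota n del j eta.
Proof.
have freeA1 := is_free_unit freeA.
pose W := grSum V V'; pose F := freeAlg P (fun _ : unit => W).
pose gen := @fgen k P unit (fun=> W).
have gg : grLinear (gen tt) by exact: fgen_grLinear.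
have freeF : is_free_family gen by exact: free_is_free_family.
have [|j [hj jiota _]] := freeA.2 F (fun v => gen tt (v, 0)).
  split=> [c v w|i v hv].
    rewrite -gg.1; congr (gen tt _).
    by apply: injective_projections; rewrite //= scaler0 addr0.
  by apply: gg.2; apply/homog_sumP; split=> //; exact: homog0.
pose d0 (_ : unit) (w : W) : F := j (cc_d (iota w.1)) + j (del w.2).
have del_deg i v : homog i v -> homog (i - 1) (del v).
  move=> hv; have [->|ni] := eqVneq i n; first exact: (cdel v).1.
  rewrite (homog_neq hv (V'n v) ni) (lin0 ldel); exact: homog0.
have [||D [derD Dgen]] := der_exists freeF (d0 := d0).
- move=> [] c v w; rewrite /d0 /= freeA.1.1 cc_d_linear hj.1.1 ldel hj.1.1.
  by rewrite scalerDr addrACA.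
- move=> [] i v /homog_sumP[h1 h2]; apply: homogD; apply: hj.1.2.
    exact/cc_d_deg/freeA.1.2.
  exact: del_deg.
have Dj x : D (j x) = j (cc_d x).
  apply: (der_unique freeA1 hj (der_pre hj derD) (der_post hj (dg_der A))).
  by move=> [] v; rewrite jiota Dgen /d0 /= (lin0 ldel) (lin0 hj.1.1) addr0.
have DD : forall x, D (D x) = 0.
  apply: (der_sqr derD (free_family_generates freeF)) => _ [[] [w ->]].
  rewrite Dgen /d0 (linD (let: And3 l _ _ := derD in l)) !Dj cc_dd.
  by rewrite (cdel _).2 !(lin0 hj.1.1) addr0.
case: (derD) => lD dD _.
pose B : dgAlg P := @DgAlg k P (ChComplex lD dD DD) F (der_homog derD).
have genE : (fun w : W => j (iota w.1) + gen tt (0, w.2)) = gen tt.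
  apply: funext => w; rewrite jiota -(linD gg.1); congr (gen tt _).
  case: w => v v'; apply: injective_projections => /=; [exact: addr0 | exact: add0r].
exists B, j, (fun v => gen tt (0, v)); split=> //; split=> //.
- suff : is_free (V := W) (A := F) (fun w => j (iota w.1) + gen tt (0, w.2)).
    by [].
  by rewrite genE; apply/is_free_familyP.
- by split=> // x; rewrite -Dj.
move=> v /=; rewrite Dgen /d0 /= (lin0 freeA.1.1) (lin0 (@cc_d_linear _ _)).
by rewrite (lin0 hj.1.1) add0r.
Qed.

End Construction.

Section Properties.

Variables (V V' : grMod k) (A B : dgAlg P) (iota : V -> A) (n : int).
Variables (del : V' -> A) (j : A -> B) (eta : V' -> B).
Hypothesis ksB : is_KSext iota n del j eta.

Let gen (w : grSum V V') : B := j (iota w.1) + eta w.2.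

Let freeA : is_free (A := dg_grAlg A) iota.
Proof. by case: ksB. Qed.

Let freeB : is_free (V := grSum V V') (A := dg_grAlg B) gen.
Proof. by case: ksB => _ _ _ _ []. Qed.

Let hj : is_dgAlgHom j.
Proof. by case: ksB => _ _ _ _ []. Qed.

Let jl : linear j.
Proof. exact: (dgHom_grLinear hj).1. Qed.

Lemma KSext_gen1 v : gen (v, 0) = j (iota v).
Proof.
have <- : gen (v, 0) - gen (0, 0) = j (iota v).
  by rewrite /gen /= (lin0 freeA.1.1) (lin0 jl) add0r addrK.
by rewrite [gen (0, 0)](lin0 freeB.1.1) subr0.
Qed.

Lemma KSext_gen2 v : gen (0, v) = eta v.
Proof. by rewrite /gen /= (lin0 freeA.1.1) (lin0 jl) add0r. Qed.

Lemma KSext_eta_grLinear : grLinear eta.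
Proof.
have etaE : eta = (fun v => gen (0, v)) by apply: funext => v; rewrite KSext_gen2.
rewrite etaE; split=> [c v w|i v hv].
  rewrite -freeB.1.1; congr (gen _).
  by apply: injective_projections; rewrite //= scaler0 addr0.
by apply: freeB.1.2; apply/homog_sumP; split=> //; exact: homog0.
Qed.

Lemma KSext_lift (C : grAlg P) (f : A -> C) (phi : V' -> C) :
  is_grAlgHom (A := dg_grAlg A) f -> grLinear phi ->
  exists f' : B -> C, [/\ is_grAlgHom (A := dg_grAlg B) f',
    forall x, f' (j x) = f x & forall v, f' (eta v) = phi v].
Proof.
move=> hf gphi.
have [|f' [hf' f'gen _]] := freeB.2 C (fun w => f (iota w.1) + phi w.2).
  split=> [c v w|i v /homog_sumP[h1 h2]].
    by rewrite /= freeA.1.1 hf.1.1 gphi.1 scalerDr addrACA.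
  by apply: homogD; [apply/hf.1.2/freeA.1.2 | apply: gphi.2].
exists f'; split=> // [x|v]; last first.
  by rewrite -KSext_gen2 f'gen /= (lin0 freeA.1.1) (lin0 hf.1.1) add0r.
apply: (free_family_hom_ext (is_free_unit freeA) (hom_comp hj.1 hf') hf).
by move=> _ v; rewrite -KSext_gen1 f'gen /= (lin0 gphi.1) addr0.
Qed.

(** The retraction kills V'.  It does not commute with the differentials. *)
Lemma KSext_inj : injective j.
Proof.
have [r [_ rj _]] := KSext_lift (hom_id (dg_grAlg A)) (grLinear_zero _ _).
by move=> x y xy; rewrite -[x]rj xy rj.
Qed.

Lemma KSext_dgLift (C : dgAlg P) (f : A -> C) (phi : V' -> C) :
  is_dgAlgHom f -> grLinear phi -> (forall v, cc_d (phi v) = f (del v)) ->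
  exists f' : B -> C, [/\ is_dgAlgHom f',
    forall x, f' (j x) = f x & forall v, f' (eta v) = phi v].
Proof.
move=> hf gphi dphi; have [f' [hf' f'j f'eta]] := KSext_lift hf.1 gphi.
have deta v : cc_d (eta v) = j (del v) by case: ksB => _ _ _ _ [].
exists f'; split=> //.
apply: (free_family_dgHom (is_free_unit freeB) hf') => _ w.
have dl := @cc_d_linear k; rewrite /gen (linD (dl _)) !(linD hf'.1.1) (linD (dl _)).
by rewrite -hj.2 !f'j hf.2 deta f'j f'eta dphi.
Qed.

Lemma KSext_generates : generates (M := dg_grAlg B)
  (fun x => (exists y, x = j y) \/ exists v, x = eta v).
Proof.
move=> Q sQ Qgen; apply: (free_family_generates (is_free_unit freeB)) => //.
by move=> _ [_ [w ->]]; apply: (subalgD sQ); apply: Qgen; [left|right]; eexists.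
Qed.

End Properties.

End KSExtensions.

(** * Low degrees of algebras over a tame operad *)

Section Units.

Variables (k : fieldType) (P : operad k).
Hypothesis P0 : op_reduced P \/ op_unitary P.

Lemma op0_homog (u : P 0%N) : homog 0 u.
Proof.
case: P0 => [u0|[e [he _ uE]]]; first by rewrite (u0 u); exact: homog0.
by have [c ->] := uE u; apply: homogZ.
Qed.

Lemma op0_d (u : P 0%N) : cc_d u = 0.
Proof. by apply: (homog_neq (cc_d_deg (op0_homog u)) (op0_homog _)). Qed.

Lemma act0E (A : dgAlg P) (u : P 0%N) (x : {ffun 'I_0 -> A}) :
  al_act A u x = alg_unit A u.
Proof. by congr (al_act A _ _); apply/ffunP => -[]. Qed.

Lemma unit_linear (A : dgAlg P) : linear (alg_unit A).
Proof. exact: al_act_linearl. Qed.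

Lemma unit_homog (A : dgAlg P) u : homog 0 (alg_unit A u).
Proof.
have := al_act_deg A (x := [ffun=> 0]) (e := fun _ : 'I_0 => 0) (op0_homog u).
by rewrite big_ord0 addr0; apply; case.
Qed.

Lemma unit_d (A : dgAlg P) u : cc_d (alg_unit A u) = 0.
Proof.
have [_ _ actD] := dg_der A; rewrite [LHS]actD /der_act op0_d big_ord0 addr0.
exact: (lin0 (al_act_linearl _ _)).
Qed.

Lemma hom_unit (A B : dgAlg P) (f : A -> B) u : is_dgAlgHom f ->
  f (alg_unit A u) = alg_unit B u.
Proof. by move=> [hf _]; rewrite [LHS]hf.2; exact: act0E. Qed.

(** A unit among the arguments is absorbed by a partial composition. *)
Lemma act_unit (A : dgAlg P) m (mu : P m.+1) (i : 'I_m.+1)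
    (x : {ffun 'I_m.+1 -> A}) (e : 'I_m.+1 -> int) u :
  x i = alg_unit A u -> (forall a, homog (e a) (x a)) ->
  al_act A mu x =
  al_act A (op_comp i (addn0 m.+1) mu u) [ffun a => x (lift i a)].
Proof.
move=> xi hx; rewrite (al_act_comp A i _ mu (op0_homog u) (e := e \o lift i));
  last by move=> a; rewrite ffunE; exact: hx.
rewrite mul0r scale1r; congr (al_act A _ _); apply/ffunP => a; rewrite ffunE.
have [->|ai] := eqVneq a i; first by rewrite act0E.
have [a' ->|aE] := unliftP i a; last by rewrite aE eqxx in ai.
have -> : outer i 0 (lift i a') = a'.
  by rewrite /outer /= /bump; case: (leqP i a') => /= ?; case: ltnP => /= ?; lia.
by rewrite ffnthE ffunE.
Qed.

Lemma units_subalg (A : dgAlg P) :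
  subalg (M := dg_grAlg A) (fun x => exists u, x = alg_unit A u).
Proof.
split=> [|_ _ [u ->] [v ->]|c _ [u ->]|d _ [u ->]|n].
- by exists 0; rewrite (lin0 (unit_linear A)).
- by exists (u + v); rewrite (linD (unit_linear A)).
- by exists (c *: u); rewrite (linZ (unit_linear A)).
- rewrite (pr_homog _ (unit_homog A u)); case: (d == 0 :> int); first by exists u.
  by exists 0; rewrite (lin0 (unit_linear A)).
elim: n => [|n IHn] mu x xu; first by exists mu; exact: act0E.
have [u xE] := xu ord0.
have hx a : homog 0 (x a) by have [v ->] := xu a; exact: unit_homog.
have -> : al_act (dg_grAlg A) mu x = _ := act_unit mu xE hx.
by apply: IHn => a; rewrite ffunE.
Qed.

End Units.

Section Tame.

Variables (k : fieldType) (P : operad k) (r : nat).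
Hypothesis P1 : op_connected P.
Hypothesis P0 : op_reduced P \/ op_unitary P.
Hypothesis P_tame : op_tame r P.

(** Since units have degree 0, this contains the vanishing of M_i for all
    nonzero i up to r. *)
Definition low_units (M : dgAlg P) : Prop :=
  forall (i : int) (x : M), homog i x -> i <= r%:Z -> exists u, x = alg_unit M u.

Section AddedGenerators.

Variables (M : dgAlg P) (K : M -> Prop) (N : int).
Hypotheses (rN : r%:Z <= N) (subK : subalg (M := dg_grAlg M) K).
Hypothesis lowK : forall (i : int) x, K x -> homog i x -> i <= r%:Z ->
  exists u, x = alg_unit M u.

Let upToN (x : M) := forall i : int, i <= N -> K (gr_pr i x).

Let upToN0 : upToN 0.
Proof. by move=> i _; rewrite gr_pr0; exact: subalg0 subK. Qed.

Let upToND x y : upToN x -> upToN y -> upToN (x + y).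
Proof.
by move=> xN yN i iN; rewrite prD; apply: (subalgD subK); [exact: xN | exact: yN].
Qed.

Let upToN_K x : K x -> upToN x.
Proof. by move=> Kx i _; exact: (subalg_pr subK). Qed.

Let upToN_high i x : homog i x -> N + 1 <= i -> upToN x.
Proof.
move=> hx iN j jN; rewrite (pr_homog _ hx).
by case: eqP => [|_]; [lia | exact: (subalg0 subK)].
Qed.

(** If no argument is a unit, all of them have degree at least r + 1; tameness
    then bounds the degree of a product of arity at least 2 from below by one
    more than the degree of any argument. *)
Let upToN_act m (mu : P m) (x : {ffun 'I_m -> M}) q (e : 'I_m -> int) :
  homog q mu -> (forall a, homog (e a) (x a)) ->
  (forall a, K (x a) \/ N + 1 <= e a) -> upToN (al_act M mu x).
Proof.
elim: m mu x q e => [|m IHm] mu x q e hmu hx Kx.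
  by apply: upToN_K; apply: (subalg_act subK) => -[].
have [[a [Ka ar]]|no_unit] := EM (exists a, K (x a) /\ e a <= r%:Z).
  have [u xu] := lowK Ka (hx a) ar.
  rewrite (act_unit P0 mu xu hx); apply: (IHm _ _ (q + 0) (e \o lift a)).
  - exact: op_comp_deg hmu (op0_homog P0 u).
  - by move=> b; rewrite ffunE; exact: hx.
  - by move=> b; rewrite ffunE; exact: Kx.
have e_gt a : r%:Z + 1 <= e a.
  case: (Kx a) => [Ka|]; last by lia.
  have [|] := leP (e a) r%:Z; last by lia.
  by move=> ar; case: no_unit; exists a.
case: m => [|m] in mu x e hmu hx Kx e_gt {IHm no_unit} *.
  have [c ->] := P1.2 mu.
  rewrite (linZ (al_act_linearl M x)) al_act_id => i iN.
  rewrite prZ; apply: (subalgZ subK).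
  by case: (Kx ord0) => [/upToN_K|/(upToN_high (hx ord0))]; apply.
have [allK|/existsNP[a Na]] := EM (forall a, K (x a)).
  by apply: upToN_K; exact: (subalg_act subK).
have {Na} eN : N + 1 <= e a by case: (Kx a).
have [qlow|qhigh] := leP q ((1 - m.+2%:Z) * (1 + r%:Z)).
  by rewrite (P_tame (erefl : 1 < m.+2)%N qlow hmu) (lin0 (al_act_linearl M x)).
apply: upToN_high (al_act_deg M hmu hx) _.
have : \sum_(b < m.+2 | b != a) (r%:Z + 1) <= \sum_(b < m.+2 | b != a) e b.
  by apply: ler_sum => b _; exact: e_gt.
rewrite sumr_const cardC1 card_ord [X in _ -> N + 1 <= q + X](bigD1 a) //=.
set s := \sum_(_ < _ | _) _; rewrite -mulr_natr natz; move: qhigh eN => qhigh eN es.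
nia.
Qed.

(** Adding generators of degree N + 1 >= r + 1 to a subalgebra K does not change
    it in degrees at most N.  The elements with all the components of degree
    at most N in K are shown to form a subalgebra. *)
Lemma tame_low_degrees (G : M -> Prop) :
  generates (M := dg_grAlg M) G -> (forall x, G x -> K x \/ homog (N + 1) x) ->
  forall i x, homog i x -> i <= N -> K x.
Proof.
move=> genM GK i x hx iN; suff : upToN x by move=> /(_ i iN); rewrite hx.
apply: (genM upToN); last first.
  by move=> y /GK[/upToN_K//|hy]; exact: upToN_high hy _.
split=> [//|y z|c y yN j jN|d y yN j jN|n mu y yN].
- exact: upToND.
- by rewrite prZ; apply: (subalgZ subK); exact: yN.
- rewrite gr_pr_pr; case: eqP => [<-|_]; [exact: yN | exact: (subalg0 subK)].
apply: (@multilin_homog_ind _ _ _ _ _ _ upToN mu y (act_multilin M n)) => // q e.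
apply: (upToN_act (homog_pr q mu) (e := e)) => a; rewrite ffunE.
  exact: homog_pr.
by have [eN|eN] := leP (e a) N; [left; exact: yN | right; lia].
Qed.

End AddedGenerators.

End Tame.

(** * Finite dimensionality *)

Section Span.

Variable k : fieldType.

Definition spans (V : lmodType k) (s : seq V) (x : V) : Prop :=
  exists c : nat -> k, x = \sum_(j < size s) c j *: s`_j.

Definition fin_spanned (V : lmodType k) (U : V -> Prop) : Prop :=
  exists s, forall x, U x -> spans s x.

Section Basics.

Variables (V : lmodType k) (s : seq V).

Lemma spans0 : spans s 0.
Proof. by exists (fun=> 0); rewrite big1 // => j _; rewrite scale0r. Qed.

Lemma spansD x y : spans s x -> spans s y -> spans s (x + y).
Proof.
move=> [c ->] [d ->]; exists (fun j => c j + d j).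
by rewrite -big_split; apply: eq_bigr => j _; rewrite scalerDl.
Qed.

Lemma spansZ a x : spans s x -> spans s (a *: x).
Proof.
move=> [c ->]; exists (fun j => a * c j).
by rewrite scaler_sumr; apply: eq_bigr => j _; rewrite scalerA.
Qed.

Lemma spans_mem x : x \in s -> spans s x.
Proof.
move=> xs; exists (fun j => (j == index x s)%:R).
rewrite (bigD1 (Ordinal (_ : index x s < size s)%N)) ?index_mem //= => si.
rewrite eqxx scale1r nth_index // big1 ?addr0 // => j.
by rewrite -val_eqE /= => /negPf->; rewrite scale0r.
Qed.

Lemma spans_ind (Q : V -> Prop) x : Q 0 ->
  (forall y z, Q y -> Q z -> Q (y + z)) -> (forall a y, Q y -> Q (a *: y)) ->
  (forall y, y \in s -> Q y) -> spans s x -> Q x.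
Proof.
move=> Q0 QD QZ Qs [c ->]; elim/big_ind: _ => // j _; apply/QZ/Qs.
exact: mem_nth.
Qed.

End Basics.

Lemma spans_sub (V : lmodType k) (s t : seq V) x :
  (forall y, y \in s -> spans t y) -> spans s x -> spans t x.
Proof.
by move=> st; apply: spans_ind => //; [exact: spans0|exact: spansD|exact: spansZ].
Qed.

Lemma spans_map (V W : lmodType k) (f : V -> W) (s : seq V) x :
  linear f -> spans s x -> spans (map f s) (f x).
Proof.
move=> lf; apply: (spans_ind (Q := fun y => spans (map f s) (f y))).
- by rewrite lin0 //; exact: spans0.
- by move=> y z; rewrite (linD lf); exact: spansD.
- by move=> a y; rewrite (linZ lf); exact: spansZ.
by move=> y ys; apply/spans_mem/map_f.
Qed.

Lemma spans_catl (V : lmodType k) (s t : seq V) x : spans s x -> spans (s ++ t) x.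
Proof. by apply: spans_sub => y ys; apply: spans_mem; rewrite mem_cat ys. Qed.

Lemma spans_catr (V : lmodType k) (s t : seq V) x : spans t x -> spans (s ++ t) x.
Proof. by apply: spans_sub => y ys; apply: spans_mem; rewrite mem_cat ys orbT. Qed.

Lemma fin_spanned_exists (V : lmodType k) (T : finType) (U : T -> V -> Prop) :
  (forall t, fin_spanned (U t)) -> fin_spanned (fun x => exists t, U t x).
Proof.
move=> /choice[s sU]; exists (flatten [seq s t | t <- enum T]) => x [t /sU].
apply: spans_sub => y yt; apply/spans_mem/flattenP; exists (s t) => //.
by apply: map_f; rewrite mem_enum.
Qed.

Lemma spans_ord (V : lmodType k) (s : seq V) x :
  spans s x <-> exists c : 'I_(size s) -> k, x = \sum_j c j *: s`_j.
Proof.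
split=> [[c ->]|[c ->]]; first by exists c.
exists (fun j => oapp c 0 (insub j)); apply: eq_bigr => j _.
by rewrite valK.
Qed.

Lemma finite_typeP (V : grMod k) :
  finite_type V <-> forall i, fin_spanned (fun x : V => homog i x).
Proof.
split=> fV i; have := fV i.
  move=> [n [s hs sV]]; exists [seq s j | j <- enum 'I_n] => x /sV[c ->].
  elim/big_ind: _ => [|y z|j _]; [exact: spans0 | exact: spansD |].
  by apply/spansZ/spans_mem/map_f; rewrite mem_enum.
move=> [s sV]; exists (size s), (fun j => gr_pr i s`_j) => [j|x hx].
  exact: homog_pr.
have /spans_ord[c xc] := sV x hx; exists c; rewrite -[LHS]hx [in LHS]xc.
rewrite (lin_sum (gr_pr_linear i)); apply: eq_bigr => j _; exact: prZ.
Qed.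

(** A subspace of a finite dimensional space is finite dimensional: it contains
    a subspace of maximal dimension. *)
Lemma fin_spanned_subspace (V : lmodType k) (U : V -> Prop) :
  U 0 -> (forall x y, U x -> U y -> U (x + y)) ->
  (forall a x, U x -> U (a *: x)) -> fin_spanned U ->
  exists s, (forall x, x \in s -> U x) /\ forall x, U x -> spans s x.
Proof.
move=> U0 UD UZ [s sU]; set n := size s.
pose f (c : 'rV[k]_n) : V := \sum_j c 0 j *: s`_j.
have lf : linear f.
  move=> a c d; rewrite /f scaler_sumr -big_split; apply: eq_bigr => j _.
  by rewrite !mxE scalerDl scalerA.
pose dimU (m : nat) : bool := `[< exists W : {vspace 'rV[k]_n},
  (forall c, c \in W -> U (f c)) /\ \dim W = m >].
have dimU0 : exists m, dimU m.
  exists 0%N; apply/asboolP; exists 0%VS; rewrite dimv0; split=> // c.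
  by rewrite memv0 => /eqP->; rewrite (lin0 lf).
have dimU_le m : dimU m -> (m <= n)%N.
  move=> /asboolP[W [_ <-]]; apply: leq_trans (dimvS (subvf W)) _.
  by rewrite dimvf /dim /= mul1n.
case: (ex_maxnP dimU0 dimU_le) => m /asboolP[W [UW <-]] Wmax.
exists (map f (vbasis W)); split=> [_ /mapP[c cW ->]|x Ux].
  by apply: UW; apply: vbasis_mem.
have /spans_ord[c0 xc] := sU x Ux; pose c : 'rV[k]_n := \row_j c0 j.
have xE : x = f c by rewrite xc; apply: eq_bigr => j _; rewrite mxE.
rewrite xE; apply: spans_map => //.
have cW : c \in W.
  have /Wmax dim_le : dimU (\dim (W + <[c]>)%VS).
    apply/asboolP; exists (W + <[c]>)%VS; split=> // y.
    move=> /memv_addP[w wW [v /vlineP[a ->] ->]]; rewrite (linD lf) (linZ lf) -xE.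
    by apply: UD; [exact: UW | exact: UZ].
  have := dimv_leqif_sup (addvSl W <[c]>); case=> _.
  rewrite eqn_leq dim_le dimvS ?addvSl // => /esym sub_W.
  by rewrite memvE (subv_trans (addvSr W _) sub_W).
apply/spans_ord; rewrite size_tuple.
by exists (fun i => coord (vbasis W) i c); exact: coord_vbasis.
Qed.

End Span.

Section NormalForms.

Variables (k : fieldType) (P : operad k) (M : dgAlg P).
Variables (d : nat) (w : 'I_d -> M) (e : 'I_d -> int).
Hypothesis hw : forall j, homog (e j) (w j).
Hypothesis gen_w : generates (M := dg_grAlg M) (fun x => exists j, x = w j).

Definition monomial (x : M) : Prop := exists n (nu : P n) q (c : 'I_n -> 'I_d),
  homog q nu /\ x = al_act M nu [ffun a => w (c a)].

Inductive sums : M -> Prop :=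
  | sums0 : sums 0
  | sumsS x y : monomial x -> sums y -> sums (x + y).

Let sumsD x y : sums x -> sums y -> sums (x + y).
Proof.
by elim=> [|z t mz _ IHz] sy; rewrite ?add0r // -addrA; apply/sumsS/IHz.
Qed.

Let sums1 x : monomial x -> sums x.
Proof. by move=> mx; rewrite -[x]addr0; apply: sumsS mx sums0. Qed.

Let monomial_homog x : monomial x -> exists i, homog i x.
Proof.
move=> [n [nu [q [c [hnu ->]]]]]; exists (q + \sum_a e (c a)).
by apply: al_act_deg => // a; rewrite ffunE.
Qed.

Let monomialZ a x : monomial x -> monomial (a *: x).
Proof.
move=> [n [nu [q [c [hnu ->]]]]]; exists n, (a *: nu), q, c.
by split; [exact: homogZ | rewrite (linZ (al_act_linearl M _))].
Qed.

(** Arguments that are generators come last, so that substituting a monomial in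
    the slot t does not affect the induction on the number t of slots before
    them. *)
Let act_monomials t m (mu : P m) q (x : {ffun 'I_m -> M}) :
  homog q mu -> (forall a : 'I_m, (a < t)%N -> monomial (x a)) ->
  (forall a : 'I_m, (t <= a)%N -> exists j, x a = w j) -> sums (al_act M mu x).
Proof.
elim: t m mu q x => [|t IHt] m mu q x hmu xt xw.
  have [c xc] := choice (fun a => xw a (leq0n a)).
  apply: sums1; exists m, mu, q, c; split=> //; congr (al_act M _ _).
  by apply/ffunP => a; rewrite ffunE.
have [tm|mt] := ltnP t m; last first.
  apply: (IHt _ _ _ _ hmu) => a at_; first by apply: xt; lia.
  by have := ltn_ord a; lia.
pose i := Ordinal tm; have [n [nu [q' [c [hnu xi]]]]] := xt i (ltnSn t).
have em : (m + n = (m + n).-1.+1)%N by lia.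
pose y : {ffun 'I_(m + n).-1 -> M} := 
  [ffun l : 'I_(m + n).-1 => if (l < t)%N then ffnth x l else
   if (insub (l - t)%N : option 'I_n) is Some b then w (c b) else ffnth x (l.+1 - n)].
have y_lt l : (l < t)%N -> ffnth y l = ffnth x l.
  move=> lt; have lp : (l < (m + n).-1)%N by lia.
  by rewrite (ffnth_lt _ lp) ffunE /= lt.
have y_mid (b : 'I_n) : ffnth y (t + b) = w (c b).
  have bn := ltn_ord b; have lp : (t + b < (m + n).-1)%N by lia.
  rewrite (ffnth_lt _ lp) ffunE /= addKn valK.
  by have -> : (t + b < t)%N = false by lia.
have y_gt a : (t < a < m)%N -> ffnth y (a + n).-1 = ffnth x a.
  move=> ta; have lp : ((a + n).-1 < (m + n).-1)%N by lia.
  rewrite (ffnth_lt _ lp) ffunE /=.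
  have -> : ((a + n).-1 < t)%N = false by lia.
  by rewrite insubF; [congr (ffnth x _); lia | lia].
have y_cases (l : 'I_(m + n).-1) : [\/ (l < t)%N /\ y l = ffnth x l,
    exists b, y l = w (c b) | exists a, (t < a < m)%N /\ y l = ffnth x a].
  have lmn := ltn_ord l; rewrite -(ffnthE y l).
  have [lt|tl] := ltnP l t; first by constructor 1; rewrite y_lt.
  have [bn|nb] := ltnP (l - t) n.
    constructor 2; exists (Ordinal bn); rewrite -y_mid /=; congr (ffnth y _); lia.
  constructor 3; exists (l.+1 - n)%N; split; first by lia.
  rewrite -y_gt; [congr (ffnth y _)|]; lia.
have y_w (l : 'I_(m + n).-1) : (t <= l)%N -> exists j, y l = w j.
  case: (y_cases l) => [[lt _]|[b ->] _|[a [ta ->]] _]; first by lia.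
    by exists (c b).
  have am : (a < m)%N by lia.
  by rewrite (ffnth_lt _ am); apply: xw => /=; lia.
have y_mon (l : 'I_(m + n).-1) : (l < t)%N -> monomial (y l).
  move=> lt; have lm : (l < m)%N by lia.
  by rewrite -(ffnthE y) y_lt // (ffnth_lt _ lm); apply: xt => /=; lia.
have /choice[f hf] (l : 'I_(m + n).-1) : exists i, homog i (y l).
  have [lt|tl] := ltnP l t; first exact/monomial_homog/y_mon.
  by have [j ->] := y_w l tl; exists (e j).
have := al_act_comp M i em mu hnu hf.
have -> : [ffun a => if a == i then al_act M nu [ffun b : 'I_n => ffnth y (i + b)]
                     else ffnth y (outer i n a)] = x.
  apply/ffunP => a; rewrite ffunE; have [->|ai] := eqVneq a i.
    rewrite xi; congr (al_act M _ _); apply/ffunP => b.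
    by rewrite !ffunE y_mid.
  have am := ltn_ord a; have at_ : a != t :> nat by rewrite -val_eqE in ai.
  rewrite /outer /= -[RHS]ffnthE; have [lt|tl] := ltnP a t; first exact: y_lt.
  by apply: y_gt; lia.
set s := (-1) ^ _ => actE.
have s2 : s * s = 1 by exact: sign_sqr.
have -> : al_act M mu x = s *: al_act M (op_comp i em mu nu) y.
  by rewrite actE scalerA s2 scale1r.
rewrite -(linZ (al_act_linearl M _)).
apply: (IHt _ _ (q + q')) => //; exact/homogZ/op_comp_deg.
Qed.

Let sumsZ c x : sums x -> sums (c *: x).
Proof.
elim=> [|y z my _ IH]; first by rewrite scaler0; exact: sums0.
by rewrite scalerDr; apply/sumsS/IH/monomialZ.
Qed.

(** Iterated products of generators reduce to sums of single operations applied
    to generators. *)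
Lemma monomials_span x : sums x.
Proof.
apply: (gen_w (Q := sums)); last first.
  move=> _ [j ->]; apply: sums1; exists 1%N, (op_id P), 0, (fun=> j).
  by split; [exact: op_id_deg | rewrite al_act_id ffunE].
split=> [|y z|c y|i y|n mu y sy]; [exact: sums0|exact: sumsD|exact: sumsZ| |].
  elim=> [|z t mz _ IH]; first by rewrite gr_pr0; exact: sums0.
  rewrite prD; apply: sumsD IH; have [j hz] := monomial_homog mz.
  by rewrite (pr_homog _ hz); case: eqP => _; [exact: sums1 | exact: sums0].
have expand (l : seq 'I_n) : forall z : {ffun 'I_n -> M},
    (forall a, a \notin l -> monomial (z a)) -> (forall a, sums (z a)) ->
    sums (al_act M mu z).
  elim: l => [|a l IHl] z zm sz.
    apply: (@multilin_homog_ind _ _ _ _ _ _ sums mu z (act_multilin M n)) => //.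
      exact: sums0.
    move=> q f; apply: (act_monomials (t := n) (homog_pr q mu)) => b bn.
      rewrite ffunE; have [j hz] := monomial_homog (zm b isT).
      rewrite (pr_homog _ hz); case: eqP => _; first exact: zm.
      by rewrite -[0](scale0r (z b)); apply/monomialZ/zm.
    by have := ltn_ord b; lia.
  rewrite -(ffupd_id z a); elim: (sz a) => [|u v mu_ _ IH].
    by rewrite (lin0 (al_act_linearr M mu z a)); exact: sums0.
  rewrite (linD (al_act_linearr M mu z a)); apply: sumsD IH.
  apply: IHl => b; rewrite ffupdE; last by case: ifP => _; [exact: sums1 | exact: sz].
  by have [//|ba] := eqVneq b a; move=> bl; apply: zm; rewrite inE negb_or ba.
by apply: (expand (enum 'I_n)) => // a; rewrite mem_enum.
Qed.

(** A monomial of arity m in generators of degree at least r + 2 has degree at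
    least m + r + 2, so that finitely many arities occur in each degree. *)
Lemma tame_finite_type (r : nat) : op_tame r P -> op_finite_type P ->
  (forall j, r%:Z + 2 <= e j) -> finite_type M.
Proof.
move=> P_tame finP e_gt; apply/finite_typeP => i.
pose T := {m : 'I_(`|i|.+2) & {ffun 'I_m -> 'I_d}}.
pose U (t : T) (x : M) := exists2 nu : P (tag t),
  homog (i - \sum_a e (tagged t a)) nu &
  x = al_act M nu [ffun a => w (tagged t a)].
have [|s sU] := fin_spanned_exists (U := U).
  move=> t; have /finite_typeP finPt := finP (tag t).
  have [s sP] := finPt (i - \sum_a e (tagged t a)).
  exists [seq al_act M nu [ffun a => w (tagged t a)] | nu <- s] => _ [nu hnu ->].
  exact: (spans_map (al_act_linearl M _) (sP nu hnu)).
exists s => x hx; rewrite -hx; elim: (monomials_span x) => [|y z my _ IH].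
  by rewrite gr_pr0; exact: spans0.
rewrite prD; apply: spansD IH; case: my => m [nu [q [c [hnu ->]]]].
have hy : homog (q + \sum_a e (c a)) (al_act M nu [ffun a => w (c a)]).
  by apply: al_act_deg => // a; rewrite ffunE.
rewrite (pr_homog _ hy); case: eqP => [iE|_]; last exact: spans0.
have sum_ge : m%:Z * (r%:Z + 2) <= \sum_a e (c a).
  have -> : m%:Z * (r%:Z + 2) = \sum_(a < m) (r%:Z + 2).
    by rewrite sumr_const card_ord -[RHS]mulr_natl (natz m).
  by apply: ler_sum => a _.
have [mi|im] := ltnP m `|i|.+2; last first.
  rewrite (P_tame m q _ _ nu hnu) ?(lin0 (al_act_linearl M _)); first exact: spans0.
    by lia.
  nia.
apply: sU; exists (Tagged (fun m : 'I_(`|i|.+2) => {ffun 'I_m -> 'I_d})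
  (finfun c : {ffun 'I_(Ordinal mi) -> 'I_d})); exists nu => /=.
  rewrite iE; have -> : \sum_a e ([ffun a => c a] a) = \sum_a e (c a).
    by apply: eq_bigr => a _; rewrite ffunE.
  by rewrite addrK.
by congr (al_act M _ _); apply/ffunP => a; rewrite !ffunE.
Qed.

End NormalForms.

(** * Attaching the generators of one degree *)

Section Subspaces.

Variables (k : fieldType) (U : lmodType k).

Record subspace := Subspace {
  subspace_mem :> U -> Prop;
  subspace0 : subspace_mem 0;
  subspaceD : forall x y, subspace_mem x -> subspace_mem y -> subspace_mem (x + y);
  subspaceZ : forall c x, subspace_mem x -> subspace_mem (c *: x) }.

Variable Z : subspace.

Definition subspace_pred : {pred U} := fun x => `[< Z x >].

Lemma subspace_closed : submod_closed subspace_pred.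
Proof.
split=> [|c x y /asboolP Zx /asboolP Zy]; apply/asboolP; first exact: subspace0.
exact/subspaceD/Zy/subspaceZ.
Qed.

HB.instance Definition _ :=
  GRing.isSubmodClosed.Build k U subspace_pred subspace_closed.

Record subspace_type := SubspaceElt {
  subspace_val : U; _ : subspace_val \in subspace_pred }.

HB.instance Definition _ := [isSub for subspace_val].
HB.instance Definition _ := [Choice of subspace_type by <:].
HB.instance Definition _ := [SubChoice_isSubLmodule of subspace_type by <:].

(** A vector space of generators for Z modulo B.  It need not be the quotient
    Z / B, but it vanishes when Z / B does and is finite dimensional when Z / B
    is. *)
Lemma quotient_generators (B : U -> Prop) : B 0 ->
  exists (L : lmodType k) (phi : L -> U),
  [/\ linear phi, forall v, Z (phi v),
      forall z, Z z -> exists v, B (z - phi v),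
      (forall z, Z z -> B z) -> forall v : L, v = 0
    & (exists s, (forall y, y \in s -> Z y) /\
         forall z, Z z -> exists2 x, spans s x & B (z - x)) ->
      exists t : seq L, forall v, spans t v].
Proof.
move=> B0; have [ZB|nZB] := EM (forall z, Z z -> B z).
  exists 'rV[k]_0, (fun=> 0); split.
  - exact: linear_zero.
  - by move=> _; exact: subspace0.
  - by move=> z Zz; exists 0; rewrite subr0; exact: ZB.
  - by move=> _ v; exact: thinmx0.
  - by move=> _; exists [::] => v; rewrite thinmx0; exact: spans0.
have [[s [sZ Zs]]|ns] := EM (exists s, (forall y, y \in s -> Z y) /\
    forall z, Z z -> exists2 x, spans s x & B (z - x)).
  pose phi (c : 'rV[k]_(size s)) : U := \sum_j c 0 j *: s`_j.
  exists 'rV[k]_(size s), phi; split=> //.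
  - move=> a c c'; rewrite /phi scaler_sumr -big_split; apply: eq_bigr => j _.
    by rewrite !mxE scalerDl scalerA.
  - move=> c; rewrite /phi; elim/big_ind: _ => [|x y|j _].
    + exact: subspace0.
    + exact: subspaceD.
    + exact/subspaceZ/sZ/mem_nth.
  - move=> z Zz; have [_ /spans_ord[c ->] Bx] := Zs z Zz; exists (\row_j c j).
    by move: Bx; congr (B (z - _)); apply: eq_bigr => j _; rewrite mxE.
  exists [seq delta_mx 0 j | j <- enum 'I_(size s)] => v.
  rewrite [v]row_sum_delta; elim/big_ind: _ => [|x y|j _].
  - exact: spans0.
  - exact: spansD.
  - by apply/spansZ/spans_mem/map_f; rewrite mem_enum.
exists subspace_type, \val; split=> //.
  by move=> v; apply/asboolP; exact: (valP v).
move=> z Zz; have zin : z \in subspace_pred by apply/asboolP.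
by exists (SubspaceElt zin); rewrite subrr.
Qed.

End Subspaces.

Section Concentrated.

Variables (k : fieldType) (L : lmodType k) (n : int).

Definition conc_pr (i : int) (x : L) : L := if i == n then x else 0.

Lemma conc_pr_linear i : linear (conc_pr i).
Proof.
by move=> c x y; rewrite /conc_pr; case: eqP => // _; rewrite scaler0 addr0.
Qed.

Lemma conc_pr_pr i j x :
  conc_pr i (conc_pr j x) = if i == j then conc_pr j x else 0.
Proof.
rewrite /conc_pr; case: (eqVneq i j) => [<-|ij]; first by case: (i == n).
case: (eqVneq i n) => [iE|//]; case: (eqVneq j n) => [jE|//].
by rewrite iE jE eqxx in ij.
Qed.

Lemma conc_pr_sum x : exists2 s : seq int,
  uniq s & x = \sum_(i <- s) conc_pr i x.
Proof. by exists [:: n] => //; rewrite big_seq1 /conc_pr eqxx. Qed.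

Definition grConc : grMod k := GrMod conc_pr_linear conc_pr_pr conc_pr_sum.

Lemma homog_conc (x : grConc) : homog n x.
Proof. by rewrite /homog /= /conc_pr eqxx. Qed.

Lemma homog_concP i (x : grConc) : homog i x -> i = n \/ x = 0.
Proof.
rewrite /homog /= /conc_pr; case: eqP => [->|_ <-]; first by left.
by right.
Qed.

Lemma conc_grLinear (W : grMod k) (f : L -> W) : linear f ->
  (forall x, homog n (f x)) -> grLinear (f : grConc -> W).
Proof.
move=> lf df; split=> // i x /homog_concP[->|->]; first exact: df.
by rewrite (lin0 lf); exact: homog0.
Qed.

End Concentrated.

(** * The inductive step *)

Section Step.

Variables (k : fieldType) (P : operad k) (r : nat).
Hypothesis P1 : op_connected P.
Hypothesis P0 : op_reduced P \/ op_unitary P.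
Hypothesis P_tame : op_tame r P.
Variable A : dgAlg P.
Hypothesis A_conn : alg_connected r A.

Definition finiteness : Prop :=
  [/\ op_finite_type P, alg_connected r.+1 A & finite_type_homology A].

Definition fin_generated (M : dgAlg P) : Prop := exists s : seq M,
  (forall x, x \in s -> exists2 i, r%:Z + 2 <= i & homog i x) /\
  generates (M := dg_grAlg M) (fun x : M => x \in s).

Lemma fin_generated_finite_type (M : dgAlg P) :
  op_finite_type P -> fin_generated M -> finite_type M.
Proof.
move=> finP [s [hs gens]].
have /choice[e he] (j : 'I_(size s)) : exists i, r%:Z + 2 <= i /\ homog i s`_j.
  by have [i ri hi] := hs _ (mem_nth 0 (ltn_ord j)); exists i.
apply: (@tame_finite_type k P M (size s) (fun j => s`_j) e _ _ r) => //.
- by move=> j; exact: (he j).2.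
- move=> Q sQ Qw; apply: gens => // x xs; apply: Qw.
  have xs' : (index x s < size s)%N by rewrite index_mem.
  by exists (Ordinal xs'); rewrite /= nth_index.
by move=> j; exact: (he j).1.
Qed.

(** The invariant of the construction.  On homology f is bijective in degrees
    less than r + n and surjective in degree r + n. *)
Record stage_ok (n : nat) (M : dgAlg P) (f : M -> A) : Prop := StageOk {
  ok_hom : is_dgAlgHom f;
  ok_low : low_units r M;
  ok_inj : forall (i : int) z, i < r%:Z + n%:Z -> Defs.cycle i z ->
    homologous i (f z) 0 -> homologous i z 0;
  ok_surj : forall (i : int) w, i <= r%:Z + n%:Z -> Defs.cycle i w ->
    exists2 z, Defs.cycle i z & homologous i w (f z);
  ok_fin : finiteness -> fin_generated M }.

Section OneStep.

Variables (n : nat) (M : dgAlg P) (f : M -> A).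
Hypothesis okM : stage_ok n f.

Let N : int := r%:Z + n%:Z.
Let hf := ok_hom okM.
Let fl : linear f := (dgHom_grLinear hf).1.
Let dl (C : chComplex k) : linear (@cc_d k C) := @cc_d_linear k C.

(** Cycles and boundaries of degree N + 1 of the cone of f; their quotient is
    the obstruction to going one degree further. *)
Definition cone_cycle (z : M * A) : Prop :=
  [/\ Defs.cycle N z.1, homog (N + 1) z.2 & cc_d z.2 = f z.1].

Definition cone_boundary (z : M * A) : Prop := exists b a,
  [/\ homog (N + 1) b, homog (N + 1 + 1) a, z.1 = cc_d b & z.2 = f b + cc_d a].

Lemma cone_cycle0 : cone_cycle 0.
Proof.
by split=> /=; [split; [exact: homog0 | exact: lin0] | exact: homog0 | rewrite !lin0].
Qed.

Lemma cone_cycleD x y : cone_cycle x -> cone_cycle y -> cone_cycle (x + y).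
Proof.
move=> [[hx dx] hx2 ex] [[hy dy] hy2 ey]; split=> /=.
- by split; [exact: homogD | rewrite (linD (@dl _)) dx dy addr0].
- exact: homogD.
- by rewrite (linD (@dl _)) ex ey linD.
Qed.

Lemma cone_cycleZ c x : cone_cycle x -> cone_cycle (c *: x).
Proof.
move=> [[hx dx] hx2 ex]; split=> /=.
- by split; [exact: homogZ | rewrite (linZ (@dl _)) dx scaler0].
- exact: homogZ.
- by rewrite (linZ (@dl _)) ex linZ.
Qed.

Definition cone_cycles : subspace (M * A)%type :=
  Subspace cone_cycle0 cone_cycleD cone_cycleZ.

Lemma cone_boundary0 : cone_boundary 0.
Proof.
by exists 0, 0; split=> /=; [exact: homog0 | exact: homog0 | rewrite lin0 |
  rewrite (lin0 fl) lin0 ?addr0].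
Qed.

(** A cone cycle (z, a) is determined up to a cycle of A by z, which ranges over
    a subspace of the finite dimensional space of cycles of M. *)
Lemma cone_finite : finiteness -> exists s : seq (M * A)%type,
  (forall y, y \in s -> cone_cycle y) /\
  forall z, cone_cycle z -> exists2 x, spans s x & cone_boundary (z - x).
Proof.
move=> fin; have [finP _ finH] := fin.
have /finite_typeP/(_ N)[sM sMN] := fin_generated_finite_type finP (ok_fin okM fin).
have [m [sA sAc sAs]] := finH (N + 1).
pose U (z : M) := Defs.cycle N z /\ exists a, homog (N + 1) a /\ cc_d a = f z.
have [||||s1 [s1U Us1]] := @fin_spanned_subspace _ _ U.
- by split; [split; [exact: homog0|exact: lin0] | exists 0; split; [exact: homog0 | rewrite !lin0]].
- move=> x y [[hx dx] [a [ha da]]] [[hy dy] [b [hb db]]]; split.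
    by split; [exact: homogD | rewrite (linD (@dl _)) dx dy addr0].
  by exists (a + b); split; [exact: homogD | rewrite (linD (@dl _)) da db linD].
- move=> c x [[hx dx] [a [ha da]]]; split.
    by split; [exact: homogZ | rewrite (linZ (@dl _)) dx scaler0].
  by exists (c *: a); split; [exact: homogZ | rewrite (linZ (@dl _)) da linZ].
- by exists sM => x [[hx _] _]; exact: sMN.
have /choice[al alP] (z : M) : exists a, U z -> homog (N + 1) a /\ cc_d a = f z.
  by have [[_ [a ha]]|nU] := EM (U z); [exists a | exists 0].
pose t1 : seq (M * A)%type := [seq (y, al y) | y <- s1].
pose t2 : seq (M * A)%type := [seq (0, sA j) | j <- enum 'I_m].
exists (t1 ++ t2); split=> [y|[z a] [cz ha dz]].
  rewrite mem_cat => /orP[] /mapP[x]; last first.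
    move=> _ ->; have [hx dx] := sAc x; split=> //=; last by rewrite dx lin0.
    by split; [exact: homog0 | exact: lin0].
  move=> xs ->; have Ux := s1U x xs; have [h1 h2] := alP x Ux.
  by case: Ux => [cx _]; split.
have [x1 [x1s x1c x1z]] : exists x1, [/\ spans t1 x1, cone_cycle x1 & x1.1 = z].
  have Uz : U z by split=> //; exists a.
  move: (Us1 z Uz); apply: (spans_ind (Q := fun z => exists x1,
    [/\ spans t1 x1, cone_cycle x1 & x1.1 = z])).
  - by exists 0; split=> //; [exact: spans0 | exact: cone_cycle0].
  - move=> _ _ [x [xs xc <-]] [y [ys yc <-]]; exists (x + y).
    by split=> //; [exact: spansD | exact: cone_cycleD].
  - move=> c _ [x [xs xc <-]]; exists (c *: x).
    by split=> //; [exact: spansZ | exact: cone_cycleZ].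
  move=> y ys; exists (y, al y); split=> //; first by apply/spans_mem/map_f.
  by have Uy := s1U y ys; have [h1 h2] := alP y Uy; case: Uy => [cy _]; split.
have [c [a' ha' aE]] : exists c : 'I_m -> k,
    homologous (N + 1) (a - x1.2) (\sum_j c j *: sA j).
  apply: sAs; case: x1c => _ h1 h2; split; first exact: homogB.
  by rewrite (linB (@dl _)) dz h2 x1z subrr.
exists (x1 + \sum_j c j *: (0, sA j)).
  apply: spansD; first exact: spans_catl.
  apply: spans_catr; elim/big_ind: _ => [|y y'|j _].
  - exact: spans0.
  - exact: spansD.
  - by apply/spansZ/spans_mem/map_f; rewrite mem_enum.
have E : \sum_j c j *: (0, sA j) = (0, \sum_j c j *: sA j) :> M * A.
  by elim/big_rec2: _ => // j x y _ ->; apply: injective_projections;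
    rewrite //= scaler0 addr0.
exists 0, a'; rewrite E; split=> //=; first exact: homog0.
  by rewrite x1z addr0 subrr lin0.
by rewrite (lin0 fl) add0r opprD addrA aE.
Qed.

(** When A is (r+1)-connected, no generator of degree r + 1 is needed. *)
Lemma cone_acyclic : n = 0%N -> alg_connected r.+1 A ->
  (forall u, homologous 0 (alg_unit A u) 0 -> u = 0) ->
  forall z, cone_cycle z -> cone_boundary z.
Proof.
move=> n0 [_ _ A_acyc] unit_inj [z a] [[/= hz dz] /= ha /= da].
have Nr : N = r%:Z by rewrite /N n0 addr0.
have z0 : z = 0.
  have [|u zu] := ok_low okM hz; first by rewrite Nr.
  have [N0|N0] := eqVneq N 0; last first.
    by apply: (homog_neq hz _ N0); rewrite zu; exact: unit_homog.
  rewrite zu (unit_inj u) ?(lin0 (unit_linear M)) //.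
  exists a; first by rewrite -N0.
  by rewrite subr0 da /= zu hom_unit.
have [||b hb ab] := A_acyc (N + 1) _ a; first by rewrite Nr; lia.
  by split=> //; rewrite da z0 (lin0 fl).
exists 0, b; split=> //=; [exact: homog0 | by rewrite z0 lin0 |].
by rewrite (lin0 fl) add0r -ab subr0.
Qed.

End OneStep.

Lemma unit_injective u : homologous 0 (alg_unit A u) 0 -> u = 0.
Proof.
case: A_conn => _ unit_bij _ u0.
have [|v [_ v_uniq]] := unit_bij 0.
  by split; [exact: homog0 | exact: (lin0 (@cc_d_linear _ _))].
have <- : v = 0.
  apply: v_uniq; exists 0; first exact: homog0.
  by rewrite (lin0 (unit_linear A)) subrr (lin0 (@cc_d_linear _ _)).
apply/esym/v_uniq; case: u0 => b hb ub; exists (- b); first exact: homogN.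
by rewrite (linN (@cc_d_linear _ _)) -ub subr0 sub0r.
Qed.

(** A KS-extension of M that is a possible next stage, with the extension
    [st_f] of f to it. *)
Record step (n : nat) (V : grMod k) (M : dgAlg P) (iota : V -> M) (f : M -> A) :=
  Step {
  st_V : grMod k;
  st_M : dgAlg P;
  st_del : st_V -> M;
  st_j : M -> st_M;
  st_eta : st_V -> st_M;
  st_f : st_M -> A;
  st_KS : is_KSext iota (r%:Z + n.+1%:Z) st_del st_j st_eta;
  st_fj : forall x, st_f (st_j x) = f x;
  st_onto : forall (i : int) y, homog i y -> i <= r%:Z + n%:Z ->
    exists2 x, homog i x & y = st_j x;
  st_ok : stage_ok n.+1 st_f }.

(** The new generators represent the homology of the cone of f in degree N + 1.
    A class of degree N in the kernel of f is a cone cycle, hence becomes a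
    boundary; a cycle w of A of degree N + 1 gives the cone cycle (0, w), hence
    is hit up to a boundary. *)
Lemma step_exists n (V : grMod k) (M : dgAlg P) (iota : V -> M) (f : M -> A) :
  is_free (A := dg_grAlg M) iota -> stage_ok n f -> inhabited (step n iota f).
Proof.
move=> freeM okM; have hf := ok_hom okM; have fl := (dgHom_grLinear hf).1.
have dl (C : chComplex k) : linear (@cc_d k C) := @cc_d_linear k C.
pose N : int := r%:Z + n%:Z; pose N1 : int := r%:Z + n.+1%:Z.
have N1E : N1 = N + 1 by rewrite /N1 /N; lia.
have [L [phi [lphi phiZ Zphi L0 Lfin]]] :=
  quotient_generators (cone_cycles okM) (cone_boundary0 okM).
pose V' := grConc L N1; pose del (v : V') : M := (phi v).1.
have ldel : linear del by move=> c x y; rewrite /del lphi.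
have cdel v : Defs.cycle (N1 - 1) (del v).
  by rewrite N1E addrK; case: (phiZ v).
have [|B [j [eta ks]]] := KSext_exists (n := N1) _ (@homog_conc _ L N1) ldel cdel freeM.
  by rewrite /N1; lia.
have psi_gr : grLinear (fun v : V' => (phi v).2).
  apply: conc_grLinear => [c x y|v]; first by rewrite lphi.
  by rewrite N1E; case: (phiZ v).
have [|f' [hf' f'j f'eta]] := KSext_dgLift ks hf psi_gr.
  by move=> v; case: (phiZ v).
have hj : is_dgAlgHom j by case: ks => _ _ _ _ [].
have deta v : cc_d (eta v) = j (del v) by case: ks => _ _ _ _ [].
have geta := KSext_eta_grLinear ks.
have jl := (dgHom_grLinear hj).1; have jdeg := (dgHom_grLinear hj).2.
have f'l := (dgHom_grLinear hf').1.
have jinj := KSext_inj ks; have genB := KSext_generates ks.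
have onto (i : int) y : homog i y -> i <= N -> exists2 x, homog i x & y = j x.
  move=> hy iN; suff [x yx] : exists x, y = j x.
    exists (gr_pr i x); first exact: homog_pr.
    by rewrite (grLinear_pr (dgHom_grLinear hj)) -yx.
  move: i y hy iN.
  apply: (tame_low_degrees P1 P0 P_tame (N := N) (K := fun y => exists x, y = j x) _ _ _ genB).
  - by rewrite /N; lia.
  - split=> [|_ _ [x ->] [y ->]|c _ [x ->]|d _ [x ->]|m mu y /choice[x yx]].
    + by exists 0; rewrite lin0.
    + by exists (x + y); rewrite linD.
    + by exists (c *: x); rewrite linZ.
    + by exists (gr_pr d x); rewrite (grLinear_pr (dgHom_grLinear hj)).
    exists (al_act M mu (finfun x)); rewrite [RHS]hj.1.2.
    by congr (al_act B _ _); apply/ffunP => a; rewrite !ffunE yx.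
  - move=> i _ [x ->] hx ir.
    have [|u xu] := ok_low okM (i := i) (x := x) _ ir.
      by apply: jinj; rewrite (grLinear_pr (dgHom_grLinear hj)).
    by exists u; rewrite xu hom_unit.
  move=> _ [[x ->]|[v ->]]; [by left; exists x | right].
  by rewrite -N1E; apply: geta.2; exact: homog_conc.
have jcycle i x : Defs.cycle i (j x) -> Defs.cycle i x.
  move=> [hx dx]; split; apply: jinj; last by rewrite hj.2 dx lin0.
  by rewrite (grLinear_pr (dgHom_grLinear hj)).
constructor; apply: (@Step _ _ _ _ _ V' B del j eta f' ks f'j onto).
split=> //.
- move=> i x hx ir; have [|y hy ->] := onto i x hx; first by rewrite /N; lia.
  by have [u ->] := ok_low okM hy ir; exists u; rewrite hom_unit.
- move=> i z iN cz zb; have iN' : i <= N by rewrite /N; lia.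
  have [y _ zy] := onto i z cz.1 iN'; rewrite zy in cz zb *.
  have cy := jcycle _ _ cz; rewrite f'j in zb.
  have [iN''|/negbTE ltNi] := boolP (i < N).
    have [b hb yb] := ok_inj okM iN'' cy zb; exists (j b); first exact: jdeg.
    by rewrite -hj.2 -yb linB // (lin0 jl).
  have {iN' ltNi} iE : i = N by move: iN' ltNi; case: ltgtP.
  rewrite {}iE in cy zb *; have [a ha fya] := zb.
  have [|v [b [a' [hb ha' y1 y2]]]] := Zphi (y, a).
    by split=> //=; rewrite -fya subr0.
  exists (eta v + j b).
    apply: homogD; last exact: jdeg.
    by rewrite -N1E; apply: geta.2; exact: homog_conc.
  rewrite (linD (@dl _)) deta -hj.2 -y1 /= subr0 linB // /del addrC subrK //.
- move=> i w iN cw; have [iN'|Ni] := leP i N.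
    have [z [hz dz] wz] := ok_surj okM iN' cw; exists (j z).
      by split; [exact: jdeg | rewrite -hj.2 dz lin0].
    by rewrite f'j.
  have iE : i = N + 1 by move: iN Ni; rewrite /N; lia.
  rewrite {}iE in cw *; case: cw => hw dw.
  have [|v [b [a' [hb ha' y1 y2]]]] := Zphi (0, w).
    by split=> //=; [split; [exact: homog0 | exact: lin0] | rewrite dw lin0].
  exists (eta v + j b).
    split; first apply: homogD; last 1 first.
    - by rewrite (linD (@dl _)) deta -hj.2 -y1 /= sub0r (linN jl) addrN.
    - by rewrite -N1E; apply: geta.2; exact: homog_conc.
    - exact: jdeg.
  exists a' => //; rewrite linD // f'eta f'j opprD addrA.
  by move: y2 => /= ->; rewrite addrC addKr.
move=> fin; have [_ A_conn1 _] := fin.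
have [t tL] := Lfin (cone_finite okM fin).
have [s [hs gens]] := ok_fin okM fin.
pose t' : seq V' := if n == 0%N then [::] else t.
have t'L v : spans t' v.
  rewrite /t'; case: eqP => [n0|_]; last exact: tL.
  rewrite (L0 _ v); first exact: spans0.
  exact: (cone_acyclic okM n0 A_conn1 unit_injective).
exists ([seq j x | x <- s] ++ [seq eta v | v <- t']); split=> [x|Q sQ Qst].
  rewrite mem_cat => /orP[] /mapP[y].
    by move=> /hs[i ri hi] ->; exists i => //; exact: jdeg.
  rewrite /t'; case: eqP => // /eqP n0 _ ->; exists N1; first by rewrite /N1; lia.
  by apply: geta.2; exact: homog_conc.
apply: genB => // _ [[x ->]|[v ->]].
  apply: (gens (fun x => Q (j x))); last first.
    by move=> y ys; apply: Qst; rewrite mem_cat map_f.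
  split=> [|y z Qy Qz|c y Qy|d y Qy|m mu y Qy].
  - by rewrite lin0 //; exact: (subalg0 sQ).
  - by rewrite linD //; exact: (subalgD sQ).
  - by rewrite linZ //; exact: (subalgZ sQ).
  - by rewrite (grLinear_pr (dgHom_grLinear hj)); exact: (subalg_pr sQ).
  by rewrite hj.1.2; apply: (subalg_act sQ) => a; rewrite ffunE.
move: (t'L v); apply: (spans_ind (Q := fun v => Q (eta v))).
- by rewrite (lin0 geta.1); exact: (subalg0 sQ).
- by move=> y z Qy Qz; rewrite (linD geta.1); exact: (subalgD sQ).
- by move=> c y Qy; rewrite (linZ geta.1); exact: (subalgZ sQ).
by move=> y ys; apply: Qst; rewrite mem_cat (map_f eta ys) orbT.
Qed.

End Step.

(** * The tower and its union *)

Section Base.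

Variables (k : fieldType) (P : operad k) (r : nat).
Hypothesis P0 : op_reduced P \/ op_unitary P.
Variable A : dgAlg P.
Hypothesis A_conn : alg_connected r A.

(** The first stage is P(0), as the free algebra on the zero module.  Its
    homology agrees with that of A up to degree r by r-connectedness. *)
Lemma base_exists : exists (M : dgAlg P) (f : M -> A),
  [/\ is_free (V := grZero k) (A := dg_grAlg M) (fun=> 0), stage_ok r 0 f
    & forall x : M, exists u, x = alg_unit M u].
Proof.
have dl (C : chComplex k) : linear (@cc_d k C) := @cc_d_linear k C.
pose V (_ : unit) := grZero k; pose F := freeAlg P V.
have freeF : is_free_family (M := F) (@fgen k P unit V) by exact: free_is_free_family.
have genE (v : grZero k) : fgen P (V := V) (i := tt) v = 0.
  by have -> : v = 0 by [exact: thinmx0]; rewrite (lin0 (freeF.1 tt).1).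
have [||D [derD Dgen]] := der_exists freeF (d0 := fun _ _ => 0).
- by move=> i; exact: linear_zero.
- by move=> *; exact: homog0.
have lD : linear D by case: derD.
have DD : forall x, D (D x) = 0.
  apply: (der_sqr derD (free_family_generates freeF)) => _ [i [v ->]].
  by rewrite Dgen lin0.
case: (derD) => _ dD _.
pose M : dgAlg P := @DgAlg k P (ChComplex lD dD DD) F (der_homog derD).
have freeM : is_free_family (M := dg_grAlg M) (@fgen k P unit V) by exact: freeF.
have [|f [hf fgenE _]] := freeF.2 (dg_grAlg A) (fun _ _ => 0).
  by move=> i; exact: grLinear_zero.
have hfd : is_dgAlgHom (A := M) f.
  apply: (free_family_dgHom freeM hf) => i v.
  by rewrite fgenE (lin0 (@dl _)) /= Dgen (lin0 hf.1.1).
have unitsM (x : M) : exists u, x = alg_unit M u.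
  apply: (free_family_generates freeM (units_subalg P0 M)) => _ [[] [v ->]].
  by exists 0; rewrite [LHS]genE (lin0 (unit_linear M)).
exists M, f; split=> //.
  have := (is_free_familyP (M := dg_grAlg M) (fun t => @fgen k P unit V t)).2 freeM.
  by have -> : @fgen k P unit V tt = (fun=> 0) by apply: funext.
have [Aneg A0 Apos] := A_conn.
split=> //.
- move=> i z iN [hz _] fz; have [u zu] := unitsM z.
  suff -> : z = 0 by exists 0; rewrite ?subrr ?(lin0 (@dl _)) //; exact: homog0.
  have [i0|i0] := eqVneq i 0; last first.
    by apply: (homog_neq hz _ i0); rewrite zu; exact: unit_homog.
  rewrite zu (unit_injective A_conn (u := u)) ?(lin0 (unit_linear M)) //.
  by rewrite -i0 -(hom_unit u hfd) -zu.
- move=> i w ir cw; rewrite addr0 in ir.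
  have zero : acyclic_at A i -> exists2 z : M, Defs.cycle i z & homologous i w (f z).
    move=> Ai; exists 0; last by rewrite (lin0 hf.1.1); exact: Ai.
    by split; [exact: homog0 | exact: (lin0 (@dl _))].
  have [i0|i0|i0] := ltgtP i 0; first exact/zero/Aneg.
    by apply/zero/Apos; lia.
  rewrite i0 in cw *; have [u [wu _]] := A0 w cw.
  exists (alg_unit M u); last by rewrite hom_unit.
  by split; [exact: unit_homog | exact: unit_d].
move=> _; exists [::]; split=> // Q sQ _ x; have [u ->] := unitsM x.
by apply: (subalg_act sQ) => -[].
Qed.

End Base.

Section FreenessTransport.

Variables (k : fieldType) (P : operad k).

Lemma is_free_iso (V W : grMod k) (M : grAlg P) (iota : V -> M) (e : W -> V)
    (e' : V -> W) :
  grLinear e -> grLinear e' -> cancel e e' -> cancel e' e ->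
  is_free iota -> is_free (fun w => iota (e w)).
Proof.
move=> ge ge' eK e'K [giota univ]; split; first exact: grLinear_comp ge giota.
move=> C g gg; have [h [hh hi hu]] := univ C _ (grLinear_comp ge' gg).
exists h; split=> // [v|h' hh' h'i]; first by rewrite hi eK.
by apply: hu => // v; rewrite -h'i e'K.
Qed.

End FreenessTransport.

Section Tower.

Variables (k : fieldType) (P : operad k) (r : nat).
Hypothesis P0 : op_reduced P \/ op_unitary P.
Hypothesis P_tame : op_tame r P.
Variable A : dgAlg P.
Hypothesis A_conn : alg_connected r A.

Record stage (n : nat) := Stage {
  sg_V : grMod k;
  sg_M : dgAlg P;
  sg_iota : sg_V -> sg_M;
  sg_f : sg_M -> A;
  sg_free : is_free (A := dg_grAlg sg_M) sg_iota;
  sg_ok : stage_ok r n sg_f }.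

Lemma step_free n (S : stage n) (T : step r n (@sg_iota _ S) (@sg_f _ S)) :
  is_free (V := grSum (sg_V S) (st_V T)) (A := dg_grAlg (st_M T))
    (fun w => st_j T (sg_iota w.1) + st_eta w.2).
Proof. by case: (st_KS T) => _ _ _ _ []. Qed.

Definition next_stage n (S : stage n)
    (T : step r n (@sg_iota _ S) (@sg_f _ S)) : stage n.+1 :=
  Stage (step_free T) (st_ok T).

Variable base : stage 0.
Variable pick : forall n (S : stage n), step r n (@sg_iota _ S) (@sg_f _ S).

Fixpoint tower n : stage n :=
  if n is n'.+1 then next_stage (pick (tower n')) else base.

Hypothesis base_V : forall v w : sg_V base, v = w.
Hypothesis base_units : forall x : sg_M base, exists u, x = alg_unit _ u.

Let M n : dgAlg P := sg_M (tower n).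
Let T n := pick (tower n).
Let j n : M n -> M n.+1 := st_j (T n).
Let f n : M n -> A := @sg_f _ (tower n).

Definition new_gens n : grMod k :=
  if n is n'.+1 then st_V (T n') else grZero k.

Definition new_gen n : new_gens n -> M n :=
  match n with 0 => fun=> 0 | n'.+1 => @st_eta _ _ _ _ _ _ _ _ _ (T n') end.

Let del n : new_gens n.+1 -> M n := @st_del _ _ _ _ _ _ _ _ _ (T n).
Let gmap n : gens new_gens n -> M n := @gens_map k P new_gens M j new_gen n.

Let ok n : stage_ok r n (@f n) := sg_ok (tower n).
Let hf n : is_dgAlgHom (@f n) := ok_hom (ok n).

Let ks0 n := st_KS (T n).

Let hj n : is_dgAlgHom (@j n).
Proof. by case: (ks0 n) => _ _ _ _ []. Qed.

Let d_new n (v : new_gens n.+1) : cc_d (new_gen v) = j (del v).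
Proof. by case: (ks0 n) v => _ _ _ _ []. Qed.

Let new_grLinear n : grLinear (@new_gen n).
Proof.
case: n => [|n]; first exact: grLinear_zero.
exact: KSext_eta_grLinear (ks0 n).
Qed.

(* [gens] and the modules of generators of the stages are built by the same
   recursion, but from trivial modules that need not be identical. *)
Let gens_iso n : exists (e : gens new_gens n -> sg_V (tower n))
    (e' : sg_V (tower n) -> gens new_gens n),
  [/\ grLinear e, grLinear e', cancel e e', cancel e' e
    & forall w, gmap w = sg_iota (e w)].
Proof.
elim: n => [|n [e [e' [ge ge' eK e'K gE]]]].
  exists (fun=> 0), (fun=> 0); split=> //.
  - exact: grLinear_zero.
  - exact: grLinear_zero.
  - by move=> w; rewrite [RHS]thinmx0.
  move=> w; rewrite (lin0 (sg_free base).1.1); exact: (erefl (0 : M 0)).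
exists (fun w => (e w.1, w.2)), (fun w => (e' w.1, w.2)); split.
- split=> [c v w|i w /homog_sumP[h1 h2]].
    by apply: injective_projections; rewrite //= ge.1.
  by apply/homog_sumP; split=> //; exact: ge.2.
- split=> [c v w|i w /homog_sumP[h1 h2]].
    by apply: injective_projections; rewrite //= ge'.1.
  by apply/homog_sumP; split=> //; exact: ge'.2.
- by move=> w; rewrite /= eK; case: w.
- by move=> w; rewrite /= e'K; case: w.
by move=> w; rewrite /= -gE.
Qed.

Let free_gmap n : is_free (A := dg_grAlg (M n)) (@gmap n).
Proof.
have [e [e' [ge ge' eK e'K gE]]] := gens_iso n.
have -> : @gmap n = (fun w => sg_iota (e w)) by apply: funext.
exact: is_free_iso ge ge' eK e'K (sg_free (tower n)).
Qed.

Let ks n : is_KSext (@gmap n) (r%:Z + n.+1%:Z) (@del n) (@j n) (@new_gen n.+1).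
Proof.
case: (ks0 n) => h1 h2 h3 _ [_ h5 h6]; split=> //.
by split=> //; exact: free_gmap n.+1.
Qed.

(** The union is the free algebra on all the generators at once. *)
Let F : grAlg P := freeAlg P new_gens.
Let fg n (v : new_gens n) : F := fgen P v.

Let freeF : is_free_family (M := F) fg.
Proof. exact: free_is_free_family. Qed.

Fixpoint gensF n : gens new_gens n -> F :=
  match n with
  | 0 => fun=> 0
  | n'.+1 => fun w => gensF w.1 + @fg n'.+1 w.2
  end.

Let gensF_grLinear n : grLinear (@gensF n).
Proof.
elim: n => [|n [lg dg]]; first exact: grLinear_zero.
split=> [c v w|i w /homog_sumP[h1 h2]] /=.
  by rewrite lg (freeF.1 n.+1).1 scalerDr addrACA.
by apply: homogD; [exact: dg | exact: (freeF.1 n.+1).2].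
Qed.

Let incl_exists : exists incl : forall n, M n -> F, forall n,
  is_grAlgHom (A := dg_grAlg (M n)) (@incl n) /\
  forall w, incl n (gmap w) = gensF w.
Proof.
have H n : exists h : M n -> F, is_grAlgHom (A := dg_grAlg (M n)) h /\
    forall w, h (gmap w) = gensF w.
  by have [h [hh hg _]] := (free_gmap n).2 F _ (gensF_grLinear n); exists h.
by exists (fun n => projT1 (cid (H n))) => n; case: (cid (H n)).
Qed.

(** The differential is the derivation of F with value incl(del v) on the
    generators, so that it extends the differentials of all the stages. *)
Lemma union_exists : exists (Minf : dgAlg P) (finf : Minf -> A)
    (incl : forall n, M n -> Minf),
  [/\ forall n, is_dgAlgHom (@incl n), forall n x, incl n.+1 (j x) = incl n x,
      forall n, injective (@incl n), forall y, exists n x, y = incl n x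
    & is_dgAlgHom finf /\ forall n x, finf (incl n x) = f x].
Proof.
have [incl hincl] := incl_exists.
have hi n := (hincl n).1; have incl_gen n := (hincl n).2.
have dl (C : chComplex k) : linear (@cc_d k C) := @cc_d_linear k C.
have jl n : linear (@j n) := (dgHom_grLinear (hj n)).1.
have gmapS n (w : gens new_gens n) v : @gmap n.+1 (w, v) = j (gmap w) + new_gen v.
  by [].
have j_gmap n (w : gens new_gens n) : j (gmap w) = @gmap n.+1 (w, 0).
  by rewrite gmapS (lin0 (new_grLinear n.+1).1) addr0.
have new_gmap n (v : new_gens n.+1) : new_gen v = @gmap n.+1 (0, v).
  by rewrite gmapS (lin0 (free_gmap n).1.1) (lin0 (@jl n)) add0r.
have incl_j n x : incl n.+1 (j x) = incl n x.
  move: x; apply: (free_family_hom_ext (is_free_unit (free_gmap n))) => //.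
    exact: (hom_comp (hj n).1 (hi n.+1)).
  move=> _ w; rewrite j_gmap !incl_gen /= (lin0 (freeF.1 n.+1).1).
  exact: addr0.
have incl_new n (v : new_gens n.+1) : incl n.+1 (new_gen v) = fg v.
  by rewrite new_gmap incl_gen /= (lin0 (gensF_grLinear n).1) add0r.
have inclW n m (x : M n) : (n <= m)%N -> exists y, incl n x = incl m y.
  move=> /subnK <-; elim: (m - n)%N => [|p [y ->]]; first by exists x.
  by exists (j y); rewrite incl_j.
pose d0 n : new_gens n -> F :=
  match n with 0 => fun=> 0 | n'.+1 => fun v => incl n' (del v) end.
have [||D [derD Dgen]] := der_exists freeF (d0 := d0).
- case=> [|n] c v w; first by rewrite /= scaler0 addr0.
  by case: (ks0 n) => _ _ [ldel _] _ _; rewrite /= [del _]ldel (hi n).1.1.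
- case=> [|n] i v hv; first exact: homog0.
  case: (ks0 n) => _ V'n [ldel cdel] _ _; apply: (hi n).1.2.
  have [->|ni] := eqVneq i (r%:Z + n.+1%:Z); first exact: (cdel v).1.
  have -> : v = 0 := homog_neq hv (V'n v) ni.
  by rewrite (lin0 ldel : del 0 = 0); exact: homog0.
have lD : linear D by case: derD.
have D_incl n x : D (incl n x) = incl n (cc_d x).
  move: x; apply: (der_unique (is_free_unit (free_gmap n)) (hi n)
    (der_pre (hi n) derD) (der_post (hi n) (dg_der (M n)))) => _.
  elim: n => [|n IHn] w.
    rewrite (lin0 (@dl _) : cc_d (gmap w) = 0) (lin0 (hi 0%N).1.1 : incl _ (gmap w) = 0).
    by rewrite (lin0 lD) ?(lin0 (hi 0%N).1.1).
  case: w => w v; rewrite gmapS (linD (@dl _)) -(hj n).2 d_new.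
  rewrite !(linD (hi n.+1).1.1) (linD lD) !incl_j IHn incl_new.
  by rewrite Dgen.
have DD : forall x, D (D x) = 0.
  apply: (der_sqr derD (free_family_generates freeF)) => _ [[|n] [v ->]].
    by rewrite Dgen /= lin0.
  rewrite Dgen /= D_incl; case: (ks0 n) => _ _ [_ cdel] _ _.
  by rewrite (cdel v).2 (lin0 (hi n).1.1).
case: (derD) => _ dD _.
pose Minf : dgAlg P := @DgAlg k P (ChComplex lD dD DD) F (der_homog derD).
pose g n : new_gens n -> A := fun v => f (new_gen v).
have [|finf [hfinf finf_gen _]] := freeF.2 (dg_grAlg A) g.
  by move=> n; exact: grLinear_comp (new_grLinear n) (dgHom_grLinear (hf n)).
have finf_incl n x : finf (incl n x) = f x.
  move: x; apply: (free_family_hom_ext (is_free_unit (free_gmap n))).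
  - exact: (hom_comp (hi n) hfinf).
  - exact: (hf n).1.
  move=> _; elim: n => [|n IHn] w.
    rewrite (lin0 (hi 0%N).1.1 : incl _ (gmap w) = 0) (lin0 hfinf.1.1).
    by rewrite (lin0 (hf 0%N).1.1.1 : f (gmap w) = 0).
  case: w => w v; rewrite gmapS (linD (hi n.+1).1.1) (linD hfinf.1.1).
  rewrite incl_j incl_new IHn finf_gen (linD (dgHom_grLinear (hf n.+1)).1).
  by congr (_ + _); rewrite /f /j /= st_fj.
have union (y : F) : exists n (x : M n), y = incl n x.
  move: y; apply: (free_family_generates freeF); last first.
    move=> _ [[|n] [v ->]].
      exists 0%N, 0; rewrite (lin0 (hi 0%N).1.1).
      by have -> : v = 0 by [exact: thinmx0]; rewrite (lin0 (freeF.1 0%N).1).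
    by exists n.+1, (new_gen v); rewrite incl_new.
  split=> [|_ _ [n [x ->]] [m [y ->]]|c _ [n [x ->]]|d _ [n [x ->]]|m mu y].
  - by exists 0%N, 0; rewrite (lin0 (hi 0%N).1.1).
  - have [x' ->] := inclW n (n + m)%N x (leq_addr _ _).
    have [y' ->] := inclW m (n + m)%N y (leq_addl _ _).
    by exists (n + m)%N, (x' + y'); rewrite (linD (hi _).1.1).
  - by exists n, (c *: x); rewrite (linZ (hi _).1.1).
  - by exists n, (gr_pr d x); rewrite (grLinear_pr (hi _).1).
  move=> /choice[n yn]; pose N := (\sum_a n a)%N.
  have /choice[x yx] a : exists x, y a = incl N x.
    have [x ->] := yn a; apply: inclW; rewrite /N (bigD1 a) //=; exact: leq_addr.
  exists N, (al_act (M N) mu (finfun x)); rewrite [RHS](hi N).2.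
  by congr (al_act F _ _); apply/ffunP => a; rewrite !ffunE yx.
(* M n is a retract of the union: the generators attached later are killed *)
have retract n : exists rho : F -> M n,
    is_grAlgHom (B := dg_grAlg (M n)) rho /\ forall x, rho (incl n x) = x.
  elim: n => [|n [rho [hrho rhoK]]].
    have [|rho [hrho _ _]] := freeF.2 (dg_grAlg (M 0)) (fun _ _ => 0).
      by move=> i; exact: grLinear_zero.
    exists rho; split=> //.
    apply: (free_family_hom_ext (is_free_unit (free_gmap 0)) (hom_comp (hi 0%N) hrho)
      (hom_id _)) => _ w.
    by rewrite incl_gen /= (lin0 hrho.1.1).
  pose g1 m : new_gens m -> M n.+1 := fun v => j (rho (fg v)).
  pose g' := dfwith (T := fun m => new_gens m -> M n.+1) g1 (@new_gen n.+1).
  have g'n : g' n.+1 = @new_gen n.+1 by exact: dfwith_in.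
  have g'm m : m != n.+1 -> g' m = @g1 m.
    by move=> mn; rewrite /g' dfwith_out // eq_sym.
  have [|rho' [hrho' rho'g _]] := freeF.2 (dg_grAlg (M n.+1)) g'.
    move=> m; have [->|mn] := eqVneq m n.+1; first by rewrite g'n.
    rewrite g'm //.
    exact: grLinear_comp (grLinear_comp (freeF.1 m) hrho.1) (dgHom_grLinear (hj n)).
  exists rho'; split=> //.
  have rho'_gensF m (w : gens new_gens m) : (m <= n)%N ->
      rho' (gensF w) = j (rho (gensF w)).
    elim: m w => [|m IHm] w mn /=.
      by rewrite (lin0 hrho'.1.1) (lin0 hrho.1.1) (lin0 (@jl n)).
    rewrite (linD hrho'.1.1) (linD hrho.1.1) (linD (@jl n)) IHm; last exact: ltnW.
    by rewrite rho'g g'm //; lia.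
  have rho'_incl x : rho' (incl n x) = j x.
    rewrite -[in RHS](rhoK x); move: x.
    apply: (free_family_hom_ext (is_free_unit (free_gmap n)) (hom_comp (hi n) hrho')
      (hom_comp (hom_comp (hi n) hrho) (hj n).1)) => _ w.
    by rewrite !incl_gen rho'_gensF.
  apply: (free_family_hom_ext (is_free_unit (free_gmap n.+1))
    (hom_comp (hi n.+1) hrho') (hom_id _)) => _ [w v].
  rewrite gmapS (linD (hi n.+1).1.1) (linD hrho'.1.1) incl_j rho'_incl.
  by rewrite incl_new rho'g g'n.
exists Minf, finf, incl; split=> //.
- by move=> n; split=> [|x]; [exact: hi | rewrite -D_incl].
- by move=> n x y xy; have [rho [_ rhoK]] := retract n; rewrite -[x]rhoK xy rhoK.
split=> //; split=> // y; have [n [x ->]] := union y.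
by rewrite /= D_incl !finf_incl (hf n).2.
Qed.

(** The stages M n and M m, for m >= n, agree in degrees up to r + n, so that the
    homology of the union in a given degree is that of a stage. *)
Lemma tower_model : exists (Minf : dgAlg P) (finf : Minf -> A),
  [/\ sullivan_minimal_model r finf,
      forall x : Minf, homog 0 x -> exists! u : P 0%N, alg_unit Minf u = x,
      forall i : int, i < r%:Z -> i != 0 ->
        forall x : Minf, homog i x -> x = 0
    & op_finite_type P -> alg_connected r.+1 A -> finite_type_homology A ->
      finite_type Minf].
Proof.
have [Minf [finf [incl [hi incl_j incl_inj union [hfinf finf_incl]]]]] := union_exists.
have il n : linear (@incl n) := (dgHom_grLinear (hi n)).1.
have dl (C : chComplex k) : linear (@cc_d k C) := @cc_d_linear k C.
have incl_homog n (i : int) x : homog i (incl n x) -> homog i x.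
  by move=> hx; apply: (@incl_inj n); rewrite (grLinear_pr (dgHom_grLinear (hi n))).
have onto n (i : int) y : homog i y -> i <= r%:Z + n%:Z ->
    exists2 x : M n, homog i x & y = incl n x.
  move=> hy iN; have [m [x yx]] := union y; rewrite {}yx in hy *.
  have {hy} hx := incl_homog _ _ _ hy.
  have [le_mn|/ltnW le_nm] := leqP m n.
    move: le_mn hx => /subnK <-; elim: (n - m)%N => [|p IHp] hx; first by exists x.
    have [z hz ->] := IHp hx; exists (j z); last by rewrite incl_j.
    exact: (dgHom_grLinear (hj _)).2.
  move: le_nm x hx => /subnK <-; elim: (m - n)%N => [|p IHp] x hx; first by exists x.
  have [|y' hy' xy] := st_onto (s := T (p + n)%N) hx; first by lia.
  by rewrite [x]xy incl_j; exact: IHp.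
have unit_inj (M' : dgAlg P) (h : M' -> A) : is_dgAlgHom h -> injective (alg_unit M').
  move=> hh u u' uu'; apply/eqP; rewrite -subr_eq0; apply/eqP.
  apply: (unit_injective A_conn); rewrite (linB (unit_linear A)).
  rewrite -!(hom_unit _ hh) uu' subrr; exists 0; first exact: homog0.
  by rewrite subrr (lin0 (@dl _)).
have low (i : int) (x : Minf) : homog i x -> i <= r%:Z -> exists u, x = alg_unit Minf u.
  move=> hx ir; have [|y hy ->] := onto 0%N i x hx; first by lia.
  by have [u ->] := ok_low (ok 0) hy ir; exists u; rewrite hom_unit.
have lift_cycle n (i : int) y : Defs.cycle i y -> i <= r%:Z + n%:Z ->
    exists2 x : M n, Defs.cycle i x & y = incl n x.
  move=> [hy dy] iN; have [x hx yx] := onto n i y hy iN; exists x => //.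
  by split=> //; apply: (@incl_inj n); rewrite (hi n).2 -yx dy lin0.
exists Minf, finf; split.
- split=> //.
    have base_bij : bijective (alg_unit (M 0)).
      have /choice[g gE] := base_units; exists g => [u|x]; last by rewrite -gE.
      by apply: (unit_inj _ _ (hf 0)); rewrite -gE.
    constructor; apply: (@SullivanTower k P r Minf M new_gens
      (fun n => r%:Z + n%:Z) del j new_gen incl) => //.
    + by move=> n n1; lia.
    + by move=> n n1; lia.
  move=> i; pose n := `|i|.+1; have iN : i < r%:Z + n%:Z by rewrite /n; lia.
  split=> [z cz fz|w cw].
    have [x cx zx] := lift_cycle n i z cz (ltW iN); rewrite zx finf_incl in fz *.
    have [b hb xb] := ok_inj (ok n) iN cx fz; exists (incl n b).
      exact: (dgHom_grLinear (hi n)).2.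
    by rewrite -(hi n).2 -xb !subr0.
  have [z [hz dz] wz] := ok_surj (ok n) (ltW iN) cw; exists (incl n z).
    by split; [exact: (dgHom_grLinear (hi n)).2 | rewrite -(hi n).2 dz lin0].
  by rewrite finf_incl.
- move=> x hx; have [|u xu] := low 0 x hx; first by lia.
  by exists u; split=> // u' xu'; apply: (unit_inj _ _ hfinf); rewrite xu' xu.
- move=> i ir i0 x hx; have [u xu] := low i x hx (ltW ir).
  by apply: (homog_neq hx _ i0); rewrite xu; exact: unit_homog.
move=> finP A1 finH; apply/finite_typeP => i; pose n := `|i|%N.
have /finite_typeP/(_ i)[s sM] :=
  fin_generated_finite_type P_tame finP (ok_fin (ok n) (And3 finP A1 finH)).
exists [seq incl n x | x <- s] => y hy.
have [|x hx ->] := onto n i y hy; first by rewrite /n; lia.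
exact/spans_map/sM.
Qed.

End Tower.

Theorem theorem7p1 (k : fieldType) (k_char0 : [pchar k] =i pred0) (r : nat)
    (P : operad k) (P1 : op_connected P) (P0 : op_reduced P \/ op_unitary P)
    (P_tame : op_tame r P) (A : dgAlg P) (A_conn : alg_connected r A) :
  exists (M : dgAlg P) (f : M -> A),
    [/\ sullivan_minimal_model r f,
        (* M_0 = P(0), through the unit map *)
        forall x : M, homog 0 x -> exists! u : P 0%N, alg_unit M u = x,
        forall i : int, i < r%:Z -> i != 0 ->
          forall x : M, homog i x -> x = 0
      & op_finite_type P -> alg_connected r.+1 A -> finite_type_homology A ->
        finite_type M].
Proof.
have [M0 [f0 [free0 ok0 units0]]] := base_exists P0 A_conn.
have pick n (S : stage r A n) : step r n (@sg_iota _ _ _ _ _ S) (@sg_f _ _ _ _ _ S).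
  have := step_exists P1 P0 P_tame A_conn (sg_free S) (sg_ok S).
  by move=> inh; have [T _] := cid (let: inhabits T := inh in ex_intro xpredT T isT).
apply: (tower_model P0 P_tame A_conn (base := Stage free0 ok0) pick) => // v w.
by rewrite [v]thinmx0 [w]thinmx0.
Qed.
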